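(* Let $(\mathcal T,\mathbf r)$ be a reduced T-mesh with a smoothness distribution constant along each maximal segment, and let $m,m'\ge0$ be integers. For each $(\mathcal T',\mathbf r')\in[\mathcal T,\mathbf r]_{\mathrm I}^{+}$ set $\mathcal C(\mathcal T',\mathbf r'):=\operatorname{CNDC}_{m,m'}^{\mathbf r'}(\mathcal T')$. Then $(\mathcal T,\mathbf r)$ is dimensionally stable (for the ordered bi-degree $(m,m')$) if and only if $$\dim\mathcal H_{m,m'}^{\mathbf r'}\bigl(\mathcal C(\mathcal T',\mathbf r');\mathcal T'\bigr)$$ is constant as $(\mathcal T',\mathbf r')$ ranges over $[\mathcal T,\mathbf r]_{\mathrm I}^{+}$. Equivalently, after choosing corresponding bases for the spaces $\mathcal M(\mathcal C(\mathcal T',\mathbf r'))$, dimensional stability holds if and only if $\operatorname{rank}K_{\mathcal C(\mathcal T',\mathbf r')}(\mathcal T')$ is constant on $[\mathcal T,\mathbf r]_{\mathrm I}^{+}$.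
   Context: **T-meshes.** Coordinates on $\mathbb R^2$ are $(s,t)$, with $s$ horizontal and $t$ vertical. Let $\Omega\subset\mathbb R^2$ be a finite union of closed axis-aligned rectangles with pairwise disjoint interiors, with $\Omega$ simply connected and $\Omega^\circ$ connected. A T-mesh on $\Omega$ is a triple $\mathcal T=(\mathcal T_2,\mathcal T_1,\mathcal T_0)$: $\mathcal T_2$ is the finite set of these closed rectangles (cells); $\mathcal T_1=\mathcal T_1^h\cup\mathcal T_1^v$ is a finite set of closed horizontal and vertical segments (edges) contained in $\bigcup_{\sigma\in\mathcal T_2}\partial\sigma$; $\mathcal T_0$ is the set of endpoints of edges (vertices); each $\partial\sigma$ is a finite union of edges; distinct cells $\sigma,\sigma'$ satisfy $\sigma\cap\sigma'=\partial\sigma\cap\partial\sigma'$, a finite union of edges and vertices; distinct edges meet only in vertices. Interior edges $\mathcal T_1^\circ$ are the edges meeting $\Omega^\circ$; the other edges are boundary edges. Interior vertices $\mathcal T_0^\circ$ are the vertices in $\Omega^\circ$. (Different T-meshes may live on different domains $\Omega$.) **Maximal segments.** A segment is a connected union of edges lying on one straight line. $\operatorname{MS}(\mathcal T)$ is the set of maximal segments consisting of interior edges. Such a segment is a cross-cut if both endpoints lie on $\partial\Omega$, a ray if exactly one does, and a maximal interior segment (MIS) if it does not meet $\partial\Omega$; these sets are $\operatorname{CC}(\mathcal T)$, $\operatorname{Ray}(\mathcal T)$, $\operatorname{MIS}(\mathcal T)$. A boundary maximal segment is a maximal connected union of boundary edges on one line; their set is $\operatorname{BMS}(\mathcal T)$.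 $\widehat{\operatorname{MS}}(\mathcal T)$ is the disjoint union of these four sets. $\mathcal T$ is reduced if no vertex is inserted merely to divide a straight edge into two collinear edges, every vertex lies on exactly one horizontal and exactly one vertical member of $\widehat{\operatorname{MS}}(\mathcal T)$, and the edges are exactly the closed subsegments between consecutive vertices on these members (so an interior and a boundary maximal segment of the same direction never meet collinearly at a common endpoint). **Smoothness.** A smoothness distribution is a map $\mathbf r:\mathcal T_1\to\{-1,0,1,\dots\}$ equal to $-1$ on boundary edges. It is constant along each maximal segment if for every $\rho\in\operatorname{MS}(\mathcal T)$ all edges $\tau\subset\rho$ have the same value $\mathbf r(\tau)=:r(\rho)$. For $\gamma\in\mathcal T_0^\circ$ with horizontal and vertical maximal segments $\rho_h(\gamma),\rho_v(\gamma)$ through it, $r_h(\gamma):=r(\rho_v(\gamma))$ and $r_v(\gamma):=r(\rho_h(\gamma))$. **Structural isomorphism and structural class.** For $\rho\in\widehat{\operatorname{MS}}(\mathcal T)$ let $\operatorname{cor}(\rho)$ be its constant $t$-coordinate if horizontal, its constant $s$-coordinate if vertical. For reduced T-meshes, a bijection $\alpha:\widehat{\operatorname{MS}}(\mathcal T)\to\widehat{\operatorname{MS}}(\mathcal T')$ is a structural isomorphism if (i) it maps $\operatorname{CC},\operatorname{Ray},\operatorname{MIS},\operatorname{BMS}$ of $\mathcal T$ onto those of $\mathcal T'$; (ii) for distinct $\rho,\eta$: $\rho\cap\eta\ne\varnothing\iff\alpha(\rho)\cap\alpha(\eta)\neq\varnothing$ (nonempty intersections are vertices, and $\alpha_0(\rho\cap\eta):=\alpha(\rho)\cap\alpha(\eta)$);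 (iii) $\rho\parallel\eta\iff\alpha(\rho)\parallel\alpha(\eta)$, and for parallel segments $\operatorname{cor}(\rho)<\operatorname{cor}(\eta)\iff\operatorname{cor}(\alpha(\rho))<\operatorname{cor}(\alpha(\eta))$. It is direction-preserving if it maps horizontal segments to horizontal ones and vertical to vertical ones. It induces bijections $\alpha_0$ of vertices, $\alpha_1$ of edges (the edge between consecutive vertices $\gamma,\gamma'$ of $\rho$ goes to the edge of $\alpha(\rho)$ between $\alpha_0(\gamma),\alpha_0(\gamma')$) and of cells. The structural class $[\mathcal T,\mathbf r]_{\mathrm I}^{+}$ is the set of pairs $(\mathcal T',\mathbf r')$ (reduced T-mesh with smoothness distribution) for which there is a direction-preserving structural isomorphism $\alpha$ from $\mathcal T$ to $\mathcal T'$ with $\mathbf r'(\alpha_1(\tau))=\mathbf r(\tau)$ for every $\tau\in\mathcal T_1^\circ$. **Spline space and stability.** $R_{a,b}=\operatorname{span}_{\mathbb R}\{s^it^j:0\le i\le a,\,0\le j\le b\}$, and $R_{a,b}=0$ if $a<0$ or $b<0$. $\mathcal S_{m,m'}^{\mathbf r}(\mathcal T)$ is the space of piecewise polynomial functions $f$ on $\Omega$ with $f|_\sigma\in R_{m,m'}$ for every cell $\sigma$ and $f$ of class $C^{\mathbf r(\tau)}$ across every interior edge $\tau$; $C^{-1}$ means no matching condition, so $f$ is regarded as a family of polynomials $(f_\sigma)_{\sigma\in\mathcal T_2}$. ($C^r$ across $\tau=$ common edge of $\sigma,\sigma'$ means $f_\sigma-f_{\sigma'}$ is divisible by $\ell_\tau^{r+1}$,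 where $\ell_\tau$ is a nonzero affine linear polynomial vanishing on the line of $\tau$.) $(\mathcal T,\mathbf r)$ is dimensionally stable (for $(m,m')$) if $\dim\mathcal S_{m,m'}^{\mathbf r'}(\mathcal T')=\dim\mathcal S_{m,m'}^{\mathbf r}(\mathcal T)$ for every $(\mathcal T',\mathbf r')\in[\mathcal T,\mathbf r]_{\mathrm I}^{+}$. **Correction spaces.** For a maximal segment $\rho$, $\ell_\rho$ is a nonzero affine linear polynomial vanishing on the line of $\rho$ (normalised as $s-s_0$ for $s=s_0$, $t-t_0$ for $t=t_0$). For an MIS $\rho$, $\mathcal B_\rho=R_{m,m'-r(\rho)-1}$ if $\rho$ is horizontal and $\mathcal B_\rho=R_{m-r(\rho)-1,m'}$ if $\rho$ is vertical. For $\mathcal A\subseteq\operatorname{MIS}(\mathcal T)$, $\mathcal M(\mathcal A)=\bigoplus_{\rho\in\mathcal A}[\rho]\mathcal B_\rho$ ($[\rho]$ a formal symbol). $\mathcal R(\mathcal T)\subseteq\mathcal M(\operatorname{MIS}(\mathcal T))$ is the subspace spanned by the vertex relations, for each interior vertex $\gamma=\rho_h\cap\rho_v$ ($\rho_h$ horizontal, $\rho_v$ vertical maximal segment) and each $q\in R_{m-r(\rho_v)-1,\,m'-r(\rho_h)-1}$: if both $\rho_h,\rho_v$ are MISs, $[\rho_v]\ell_{\rho_h}^{r(\rho_h)+1}q-[\rho_h]\ell_{\rho_v}^{r(\rho_v)+1}q$; if exactly one of them is an MIS, the same expression with the term of the non-MIS segment omitted. Put $\mathcal R_{\mathcal A}(\mathcal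 T):=\mathcal M(\mathcal A)\cap\mathcal R(\mathcal T)$ and $\mathcal H_{m,m'}^{\mathbf r}(\mathcal A;\mathcal T):=\mathcal M(\mathcal A)/\mathcal R_{\mathcal A}(\mathcal T)$. Having fixed a basis of $\mathcal M(\mathcal A)$ and any finite spanning set of $\mathcal R_{\mathcal A}(\mathcal T)$, $K_{\mathcal A}(\mathcal T)$ is the matrix whose columns are the coordinates of that spanning set (its rank does not depend on these choices). **Absolute weights.** A deletion state is a pair $(\mathcal A,\mathcal B)$ with $\mathcal A\cap\mathcal B=\varnothing$, $\mathcal A\cup\mathcal B=\operatorname{MIS}(\mathcal T)$. For $\rho\in\mathcal A$, $\operatorname{Mono}_{(\mathcal A,\mathcal B)}(\rho)$ is the set of vertices on $\rho$ lying on no MIS in $\mathcal A\setminus\{\rho\}$. With $(a)_+=\max\{a,0\}$, $\mu_h(\gamma)=(m-r_h(\gamma))_+$, $\mu_v(\gamma)=(m'-r_v(\gamma))_+$. The absolute weight $\Omega_{(\mathcal A,\mathcal B)}(\rho)$ is $\sum_{\gamma\in\operatorname{Mono}_{(\mathcal A,\mathcal B)}(\rho)}\mu_h(\gamma)$ for $\rho$ horizontal and $\sum_{\gamma\in\operatorname{Mono}_{(\mathcal A,\mathcal B)}(\rho)}\mu_v(\gamma)$ for $\rho$ vertical. The threshold is $\theta(\rho)=m+1$ for $\rho$ horizontal, $m'+1$ for $\rho$ vertical. An MIS $\rho\in\mathcal A$ is diagonalizable at $(\mathcal A,\mathcal B)$ if $\Omega_{(\mathcal A,\mathcal B)}(\rho)\ge\theta(\rho)$.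 **Deletion algorithm and weighted CNDC.** Start with $\mathcal A=\operatorname{MIS}(\mathcal T)$, $\mathcal B=\varnothing$. In each pass let $\mathcal Z$ be the set of all $\rho\in\mathcal A$ diagonalizable at $(\mathcal A,\mathcal B)$, and replace $\mathcal A$ by $\mathcal A\setminus\mathcal Z$ and $\mathcal B$ by $\mathcal B\cup\mathcal Z$; repeat until a pass has $\mathcal Z=\varnothing$. The final $\mathcal A$ is the weighted CNDC $\operatorname{CNDC}_{m,m'}^{\mathbf r}(\mathcal T)$. *)

(* Defs.v *)
From HB Require Import structures.
From mathcomp Require Import all_boot all_order all_algebra.
From mathcomp Require Import finmap.
From mathcomp Require Import all_classical all_reals all_analysis.

Set Implicit Arguments.
Unset Strict Implicit.
Unset Printing Implicit Defensive.

Import Order.TTheory GRing.Theory Num.Theory.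
Import numFieldNormedType.Exports.

Local Open Scope classical_set_scope.
Local Open Scope ring_scope.

(** * Linear algebra *)

Section LinearAlgebra.
Context {F : fieldType} {V : vectType F}.
Implicit Types (P : set V) (U W : {vspace V}) (v : V).

(* The linear span of an arbitrary set of vectors: the least subspace that
   contains it ([span_setP]); a set that is already a subspace is its own
   span ([mem_span_set]). *)
Definition span_set P : {vspace V} :=
  xget 0%VS
    [set U : {vspace V} | (forall v, P v -> v \in U) /\
                          (forall W, (forall v, P v -> v \in W) ->
                             (U <= W)%VS)].

Lemma span_setP P :
  (forall v, P v -> v \in span_set P) /\
  (forall W, (forall v, P v -> v \in W) -> (span_set P <= W)%VS).
Proof.
rewrite /span_set; case: xgetP => [U _ //|no].
pose Q n := `[< exists U, (forall v, P v -> v \in U) /\ \dim U = n >].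
have exQ : exists n, Q n.
  by exists (\dim {:V}); apply/asboolP; exists fullv; split=> // v _; exact: memvf.
case: (ex_minnP exQ) => n /asboolP[U [PU dU]] nmin.
exfalso; apply: (no U); split=> // W PW.
have /nmin : Q (\dim (U :&: W)%VS).
  apply/asboolP; exists (U :&: W)%VS; split=> // v Pv.
  by rewrite memv_cap PU ?PW.
rewrite -dU => le_dim.
have /eqP <- : (U :&: W)%VS == U by rewrite eqEdim capvSl le_dim.
exact: capvSr.
Qed.

Lemma mem_span_set P v :
    P 0 -> (forall a u w, P u -> P w -> P (a *: u + w)) ->
  v \in span_set P <-> P v.
Proof.
move=> P0 Plin; split; last exact: (span_setP P).1.
pose Q n := `[< exists U, (forall v, v \in U -> P v) /\ \dim U = n >].
have exQ : exists n, Q n.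
  exists 0%N; apply/asboolP; exists 0%VS; split; last by rewrite dimv0.
  by move=> w; rewrite memv0 => /eqP ->.
have Qle n : Q n -> (n <= \dim {:V})%N.
  by move=> /asboolP[U [_ <-]]; rewrite dimvS ?subvf.
case: (ex_maxnP exQ Qle) => n /asboolP[U [UP dU]] nmax.
move=> vP; apply: (UP v); move: v vP; apply/subvP; apply: (span_setP P).2 => w Pw.
have /nmax : Q (\dim (U + <[w]>)%VS).
  apply/asboolP; exists (U + <[w]>)%VS; split=> // x.
  case/memv_addP=> u uU [y /vlineP[k ->] ->].
  by rewrite addrC; apply: Plin Pw (UP u uU).
rewrite -dU => le_dim.
have /eqP -> : U == (U + <[w]>)%VS by rewrite eqEdim addvSl le_dim.
exact: (subvP (addvSr U _)) (memv_line w).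
Qed.

(* The quotient U / W, as the image of U under a linear map whose kernel is
   exactly W ([quot_map_eq0]). *)
Definition quot_map W : 'End(V) := (\1 - projv W)%VF.

Lemma quot_map_eq0 W v : (quot_map W v == 0) = (v \in W).
Proof.
rewrite /quot_map !lfunE /= !lfunE /= subr_eq0.
apply/eqP/idP => [->|/projv_id-> //]; exact: memv_proj.
Qed.

Definition quotv U W : {vspace V} := (quot_map W @: U)%VS.

Lemma dim_quotv U W : (W <= U)%VS -> (\dim (quotv U W) + \dim W = \dim U)%N.
Proof.
move=> sWU; rewrite -(limg_ker_dim (quot_map W) U) addnC; congr (\dim _ + _)%N.
apply/vspaceP => v; rewrite memv_cap memv_ker quot_map_eq0.
by apply/idP/andP => [vW|[]//]; split=> //; exact: (subvP sWU).
Qed.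

(* Columns: the coordinates of the vectors of X in the basis b. *)
Definition coord_mx (b X : seq V) : 'M[F]_(size b, size X) :=
  \matrix_(i, j) coord (in_tuple b) i X`_j.

End LinearAlgebra.

(** * Plane topology *)

Section Topology.
Context {R : realType}.

Definition frontier (A : set (R * R)) : set (R * R) := closure A `\` interior A.

Definition unit_square : set (R * R) :=
  [set p | (0 <= p.1 <= 1) && (0 <= p.2 <= 1)].

Definition path_in (A : set (R * R)) (x y : R * R) (g : R -> R * R) : Prop :=
  [/\ {within `[0, 1], continuous g}, g 0 = x, g 1 = y &
      forall u, 0 <= u <= 1 -> A (g u)].

(* Nonempty, path connected, and every loop contracts rel. its base point. *)
Definition simply_connected (A : set (R * R)) : Prop :=
  [/\ A !=set0,
      forall x y, A x -> A y -> exists g, path_in A x y g &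
      forall x g, path_in A x x g ->
        exists F : R * R -> R * R,
          [/\ {within unit_square, continuous F},
              forall p, unit_square p -> A (F p),
              forall u, 0 <= u <= 1 -> F (u, 0) = g u /\ F (u, 1) = x &
              forall u, 0 <= u <= 1 -> F (0, u) = x /\ F (1, u) = x]].

End Topology.

(** * T-meshes *)

(* [xmin, xmax] x [ymin, ymax] *)
Record rect (R : Type) := Rect { xmin : R; xmax : R; ymin : R; ymax : R }.

(* [lo, hi] x {cor} if horizontal, {cor} x [lo, hi] if vertical. *)
Record seg (R : Type) := Seg { horiz : bool; cor : R; lo : R; hi : R }.

Definition tuple_of_rect (R : Type) (c : rect R) :=
  (xmin c, xmax c, ymin c, ymax c).
Definition rect_of_tuple (R : Type) (x : R * R * R * R) :=
  let: (a, b, c, d) := x in Rect a b c d.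
Lemma tuple_of_rectK (R : Type) : cancel (@tuple_of_rect R) (@rect_of_tuple R).
Proof. by case. Qed.
HB.instance Definition _ (R : choiceType) :=
  Choice.copy (rect R) (can_type (@tuple_of_rectK R)).

Definition tuple_of_seg (R : Type) (e : seg R) := (horiz e, cor e, lo e, hi e).
Definition seg_of_tuple (R : Type) (x : bool * R * R * R) :=
  let: (h, c, a, b) := x in Seg h c a b.
Lemma tuple_of_segK (R : Type) : cancel (@tuple_of_seg R) (@seg_of_tuple R).
Proof. by case. Qed.
HB.instance Definition _ (R : choiceType) :=
  Choice.copy (seg R) (can_type (@tuple_of_segK R)).

Section RectSeg.
Context {R : realType}.

Definition rect_pts (c : rect R) : set (R * R) :=
  [set p | (xmin c <= p.1 <= xmax c) && (ymin c <= p.2 <= ymax c)].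

Definition on_seg (e : seg R) (p : R * R) : bool :=
  if horiz e then (p.2 == cor e) && (lo e <= p.1 <= hi e)
  else (p.1 == cor e) && (lo e <= p.2 <= hi e).

Definition seg_pts (e : seg R) : set (R * R) := [set p | on_seg e p].

Definition seg_lo (e : seg R) : R * R :=
  if horiz e then (lo e, cor e) else (cor e, lo e).
Definition seg_hi (e : seg R) : R * R :=
  if horiz e then (hi e, cor e) else (cor e, hi e).

End RectSeg.

(* The vertices and the domain are determined by the edges and the cells. *)
Record tmesh (R : realType) :=
  TMesh { cells : {fset rect R}; edges : {fset seg R} }.

Section TMesh.
Context {R : realType} (T : tmesh R).
Implicit Types (rho eta : {set edges T}) (g : R * R).

Definition verts : {fset R * R} :=
  ([fset seg_lo e | e in edges T] `|` [fset seg_hi e | e in edges T])%fset.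

Definition domain : set (R * R) :=
  [set p | exists2 c, c \in cells T & rect_pts c p].

Definition is_tmesh : Prop :=
  [/\ [/\ forall c, c \in cells T -> xmin c < xmax c /\ ymin c < ymax c,
          forall c c', c \in cells T -> c' \in cells T -> c != c' ->
            interior (rect_pts c) `&` interior (rect_pts c') = set0,
          simply_connected domain & connected (interior domain)],
      [/\ forall e, e \in edges T -> lo e < hi e,
          forall e p, e \in edges T -> seg_pts e p ->
            exists2 c, c \in cells T & frontier (rect_pts c) p &
          forall e e' p, e \in edges T -> e' \in edges T -> e != e' ->
            seg_pts e p -> seg_pts e' p -> p \in verts],
      forall c, c \in cells T ->
        exists2 E : {fset seg R}, (E `<=` edges T)%fset &
          frontier (rect_pts c) = [set p | exists2 e, e \in E & seg_pts e p] &
      forall c c', c \in cells T -> c' \in cells T -> c != c' ->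
        rect_pts c `&` rect_pts c' =
          frontier (rect_pts c) `&` frontier (rect_pts c') /\
        exists E : {fset seg R}, exists W : {fset R * R},
          [/\ (E `<=` edges T)%fset, (W `<=` verts)%fset &
              rect_pts c `&` rect_pts c' =
                [set p | (exists2 e, e \in E & seg_pts e p) \/ p \in W]]].

Definition interior_edges : {set edges T} :=
  [set e | `[< seg_pts (val e) `&` interior domain !=set0 >]]%SET.
Definition boundary_edges : {set edges T} := (~: interior_edges)%SET.

Definition interior_vertex g : Prop := g \in verts /\ interior domain g.

(** ** Maximal segments *)

(* A segment is encoded by the set of the edges of which it is the union. *)
Definition on_segment g rho : bool := [exists e in rho, on_seg (val e) g].
Definition pts rho : set (R * R) := [set p | on_segment p rho].

Definition horizontal rho : bool := [exists e in rho, horiz (val e)].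
Definition coordinate rho : R :=
  if [pick e in rho] is Some e then cor (val e) else 0.

Definition is_segment rho : Prop :=
  [/\ rho != finset.set0,
      {in rho &, forall e e', horiz (val e) = horiz (val e') /\
                              cor (val e) = cor (val e')} &
      connected (pts rho)].

(* Segments of interior edges that are maximal for inclusion. *)
Definition MS : {set {set edges T}} :=
  [set rho | maxset (fun x : {set edges T} =>
                       `[< is_segment x >] && (x \subset interior_edges)) rho]%SET.
Definition BMS : {set {set edges T}} :=
  [set rho | maxset (fun x : {set edges T} =>
                       `[< is_segment x >] && (x \subset boundary_edges)) rho]%SET.

Definition is_endpoint rho g : Prop :=
  let par q := if horizontal rho then q.1 else q.2 in
  pts rho g /\ ((forall q, pts rho q -> par g <= par q) \/
                (forall q, pts rho q -> par q <= par g)).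

Definition CC : {set {set edges T}} :=
  [set rho in MS |
    `[< forall g, is_endpoint rho g -> frontier domain g >]]%SET.
Definition Ray : {set {set edges T}} :=
  [set rho in MS |
    `[< (exists2 g, is_endpoint rho g & frontier domain g) /\
        (exists2 g, is_endpoint rho g & ~ frontier domain g) >]]%SET.
Definition MIS : {set {set edges T}} :=
  [set rho in MS | `[< pts rho `&` frontier domain = set0 >]]%SET.

Definition MShat : {set {set edges T}} := (CC :|: Ray :|: MIS :|: BMS)%SET.

Definition reduced : Prop :=
  [/\ forall g, g \in verts ->
        ~ exists e1 e2 : seg R,
            [/\ e1 \in edges T, e2 \in edges T, horiz e1 = horiz e2,
                seg_hi e1 = g /\ seg_lo e2 = g &
                forall e, e \in edges T -> on_seg e g -> e = e1 \/ e = e2],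
      forall g, g \in verts -> forall d : bool,
        exists! rho, [/\ rho \in MShat, horizontal rho = d & on_segment g rho] &
      forall e : seg R, lo e < hi e ->
        (e \in edges T <->
         exists rho,
           [/\ rho \in MShat, horizontal rho = horiz e,
               [/\ seg_lo e \in verts, seg_hi e \in verts,
                   on_segment (seg_lo e) rho & on_segment (seg_hi e) rho] &
               forall g, g \in verts -> on_segment g rho -> on_seg e g ->
                 g = seg_lo e \/ g = seg_hi e])].

(** ** Smoothness *)

Definition is_smoothness (r : edges T -> int) : Prop :=
  (forall e, -1 <= r e) /\ (forall e, e \in boundary_edges -> r e = -1).

Definition constant_on_MS (r : edges T -> int) : Prop :=
  forall rho, rho \in MS -> {in rho &, forall e e', r e = r e'}.

End TMesh.

(* r(rho), for r constant on rho *)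
Definition seg_smooth (R : realType) (T : tmesh R) (r : edges T -> int)
    (rho : {set edges T}) : int :=
  if [pick e in rho] is Some e then r e else -1.

(** * Structural classes *)

Section Structural.
Context {R : realType} (T T' : tmesh R).

Definition structural_iso (al : {set edges T} -> {set edges T'}) : Prop :=
  [/\ {in MShat T &, injective al} /\ (al @: MShat T)%SET = MShat T',
      [/\ (al @: CC T)%SET = CC T', (al @: Ray T)%SET = Ray T',
          (al @: MIS T)%SET = MIS T' & (al @: BMS T)%SET = BMS T'],
      {in MShat T &, forall rho eta, rho != eta ->
         (pts rho `&` pts eta !=set0 <->
          pts (al rho) `&` pts (al eta) !=set0)},
      {in MShat T &, forall rho eta,
         (horizontal rho == horizontal eta) =
         (horizontal (al rho) == horizontal (al eta))} &
      {in MShat T &, forall rho eta, horizontal rho = horizontal eta ->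
         (coordinate rho < coordinate eta) =
         (coordinate (al rho) < coordinate (al eta))}].

Definition direction_preserving (al : {set edges T} -> {set edges T'}) : Prop :=
  {in MShat T, forall rho, horizontal (al rho) = horizontal rho}.

Definition induced_on_vertices (al : {set edges T} -> {set edges T'})
    (al0 : R * R -> R * R) : Prop :=
  {in MShat T &, forall rho eta, rho != eta -> forall p,
     pts rho p -> pts eta p -> pts (al rho) (al0 p) /\ pts (al eta) (al0 p)}.

Definition induced_on_edges (al : {set edges T} -> {set edges T'})
    (al0 : R * R -> R * R) (al1 : edges T -> edges T') : Prop :=
  forall rho, rho \in MShat T -> forall e, e \in rho ->
    al1 e \in al rho /\
    [set al0 (seg_lo (val e)); al0 (seg_hi (val e))] =
    [set seg_lo (val (al1 e)); seg_hi (val (al1 e))].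

(* Membership of (T', r') in the structural class of (T, r). *)
Definition struct_class (r : edges T -> int) (r' : edges T' -> int) : Prop :=
  [/\ is_tmesh T', reduced T', is_smoothness r' &
      exists al al0 al1,
        [/\ structural_iso al, direction_preserving al,
            induced_on_vertices al al0, induced_on_edges al al0 al1 &
            forall e, e \in interior_edges T -> r' (al1 e) = r e]].

End Structural.

(** * Polynomials *)

Section BiPoly.
Context {R : realType}.

(* Polynomials in (s, t) are elements of {poly {poly R}} with s = 'X and
   t = 'Y, so that p`_i`_j is the coefficient of s^i t^j.  The degree bounds
   are integers: the space is 0 if a < 0 or b < 0. *)
Definition bideg_le (a b : int) (p : {poly {poly R}}) : Prop :=
  forall i j : nat, p`_i`_j != 0 -> (i%:Z <= a) && (j%:Z <= b).

(* The space R_{m,m'} in coordinates: A i j is the coefficient of s^i t^j. *)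
Definition bipoly m m' (A : 'M[R]_(m.+1, m'.+1)) : {poly {poly R}} :=
  \sum_(i < m.+1) \sum_(j < m'.+1) (A i j)%:P%:P * 'X ^+ i * 'Y ^+ j.

Definition line_poly (h : bool) (c : R) : {poly {poly R}} :=
  if h then 'Y - c%:P%:P else 'X - c%:P%:P.

(* The library's dvdp on {poly {poly R}} is pseudo-divisibility, for which
   every nonzero polynomial in t alone divides everything. *)
Definition poly_dvd (d p : {poly {poly R}}) : Prop := exists q, p = d * q.

Lemma bipoly_linear m m' (k : R) (A B : 'M[R]_(m.+1, m'.+1)) :
  bipoly (k *: A + B) = k%:P%:P * bipoly A + bipoly B.
Proof.
rewrite /bipoly mulr_sumr -big_split /=; apply: eq_bigr => i _.
rewrite mulr_sumr -big_split /=; apply: eq_bigr => j _.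
by rewrite !mxE !polyCD !polyCM !mulrDl !mulrA.
Qed.

Lemma bipoly0 m m' : bipoly (0 : 'M[R]_(m.+1, m'.+1)) = 0.
Proof.
by rewrite /bipoly big1 // => i _; rewrite big1 // => j _; rewrite mxE !mul0r.
Qed.

Lemma bideg_le_linear a b (k : R) p q :
  bideg_le a b p -> bideg_le a b q -> bideg_le a b (k%:P%:P * p + q).
Proof.
move=> hp hq i j; rewrite coefD coefCM coefD coefCM => nz.
have [p0|/hp //] := eqVneq p`_i`_j 0.
by apply: hq; apply: contraNneq nz => q0; rewrite p0 q0 mulr0 addr0.
Qed.

End BiPoly.

(** * Splines and correction spaces *)

Section Spaces.
Context {R : realType} (m m' : nat) (T : tmesh R) (r : edges T -> int).
Implicit Types (rho : {set edges T}) (A : {set {set edges T}}).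

Definition is_spline (f : {ffun cells T -> 'M[R]_(m.+1, m'.+1)}) : Prop :=
  forall (c c' : cells T) (e : edges T), c != c' -> e \in interior_edges T ->
    (forall p, seg_pts (val e) p ->
       rect_pts (val c) p /\ rect_pts (val c') p) ->
    poly_dvd (line_poly (horiz (val e)) (cor (val e)) ^+ absz (r e + 1))
             (bipoly (f c) - bipoly (f c')).

Definition spline_space : {vspace {ffun cells T -> 'M[R]_(m.+1, m'.+1)}} :=
  span_set is_spline.

Lemma mem_spline_space f : f \in spline_space <-> is_spline f.
Proof.
apply: mem_span_set => [c c' e _ _ _|a u w hu hw c c' e ncc' ie sub].
  by rewrite !ffunE bipoly0 subrr; exists 0; rewrite mulr0.
have [q1 e1] := hu c c' e ncc' ie sub; have [q2 e2] := hw c c' e ncc' ie sub.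
exists (a%:P%:P * q1 + q2); rewrite !ffunE !bipoly_linear.
by rewrite mulrDr mulrCA -e1 -e2 mulrBr opprD addrACA.
Qed.

(* All the direct sums are taken inside the space of families of elements of
   R_{m,m'} indexed by the segments: [rho] p is the family with value p at rho
   and 0 elsewhere. *)
Definition corr_family := {ffun {set edges T} -> 'M[R]_(m.+1, m'.+1)}.

(* Membership in B_rho. *)
Definition in_corr_poly rho : {poly {poly R}} -> Prop :=
  if horizontal rho then bideg_le m%:Z (m'%:Z - seg_smooth r rho - 1)
  else bideg_le (m%:Z - seg_smooth r rho - 1) m'%:Z.

Definition in_corr_space A (w : corr_family) : Prop :=
  forall rho, (rho \in A -> in_corr_poly rho (bipoly (w rho))) /\
              (rho \notin A -> w rho = 0).

(* M(A) *)
Definition corr_space A : {vspace corr_family} := span_set (in_corr_space A).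

Lemma mem_corr_space A w : w \in corr_space A <-> in_corr_space A w.
Proof.
apply: mem_span_set => [rho|a u v hu hv rho].
  split=> _; rewrite ffunE // bipoly0 /in_corr_poly.
  by case: ifP => _ i j; rewrite !coef0 eqxx.
split=> rA; rewrite !ffunE.
  have := (hv rho).1 rA; have := (hu rho).1 rA; rewrite bipoly_linear.
  rewrite /in_corr_poly.
  by case: ifP => _ ? ?; exact: bideg_le_linear.
by rewrite (hu rho).2 // (hv rho).2 // scaler0 addr0.
Qed.

Definition ell rho := line_poly (horizontal rho) (coordinate rho).

Definition vertex_relation (w : corr_family) : Prop :=
  exists (g : R * R) (rh rv : {set edges T}) (q : {poly {poly R}}),
    [/\ interior_vertex T g,
        [/\ rh \in MS T, horizontal rh & on_segment g rh],
        [/\ rv \in MS T, ~~ horizontal rv & on_segment g rv],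
        bideg_le (m%:Z - seg_smooth r rv - 1) (m'%:Z - seg_smooth r rh - 1) q &
        forall rho, bipoly (w rho) =
          if (rho == rv) && (rv \in MIS T)
          then ell rh ^+ absz (seg_smooth r rh + 1) * q
          else if (rho == rh) && (rh \in MIS T)
          then - (ell rv ^+ absz (seg_smooth r rv + 1) * q)
          else 0].

Definition relations : {vspace corr_family} := span_set vertex_relation.

Definition relations_in A : {vspace corr_family} :=
  (corr_space A :&: relations)%VS.

(* H(A) *)
Definition corr_quotient A : {vspace corr_family} :=
  quotv (corr_space A) (relations_in A).

(** ** Weights and deletion *)

Definition vertical_smooth_at (g : R * R) : int :=
  if [pick rho in MS T | horizontal rho && on_segment g rho] is Some rho
  then seg_smooth r rho else -1.
Definition horizontal_smooth_at (g : R * R) : int :=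
  if [pick rho in MS T | ~~ horizontal rho && on_segment g rho] is Some rho
  then seg_smooth r rho else -1.

Definition mu_h (g : R * R) : int := Num.max (m%:Z - horizontal_smooth_at g) 0.
Definition mu_v (g : R * R) : int := Num.max (m'%:Z - vertical_smooth_at g) 0.

Definition Mono A rho : {set verts T} :=
  [set g : verts T |
    on_segment (val g) rho &&
    [forall eta in A :\ rho, ~~ on_segment (val g) eta]]%SET.

Definition weight A rho : int :=
  if horizontal rho then \sum_(g in Mono A rho) mu_h (val g)
  else \sum_(g in Mono A rho) mu_v (val g).

Definition threshold rho : int :=
  if horizontal rho then m.+1%:Z else m'.+1%:Z.

Definition diagonalizable_MIS A : {set {set edges T}} :=
  [set rho in A | threshold rho <= weight A rho]%SET.

Definition deletion_pass (st : {set {set edges T}} * {set {set edges T}}) :=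
  (st.1 :\: diagonalizable_MIS st.1, st.2 :|: diagonalizable_MIS st.1)%SET.

(* #|MIS| passes suffice: a pass that deletes nothing changes nothing, and any
   other pass deletes at least one MIS ([CNDC_stop]). *)
Definition CNDC : {set {set edges T}} :=
  (iter #|MIS T| deletion_pass (MIS T, finset.set0)).1.

Lemma CNDC_stop : diagonalizable_MIS CNDC = finset.set0.
Proof.
pose s n := (iter n deletion_pass (MIS T, finset.set0)).1.
have sS n : s n.+1 = (s n :\: diagonalizable_MIS (s n))%SET by rewrite /s iterS.
have stay n : diagonalizable_MIS (s n) = finset.set0 ->
    diagonalizable_MIS (s n.+1) = finset.set0.
  by move=> d0; rewrite sS d0 finset.setD0.
suff key n : diagonalizable_MIS (s n) = finset.set0 \/ (#|s n| + n <= #|MIS T|)%N.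
  have [//|] := key #|MIS T|; rewrite -[X in (_ <= X)%N]add0n leq_add2r leqn0.
  rewrite cards_eq0 => /eqP s0; apply/finset.setP=> x.
  by rewrite inE (_ : CNDC = s #|MIS T|) // s0 !inE.
elim: n => [|n [/stay ? | le_n]]; [by right; rewrite addn0 | by left |].
have [/stay ?|nz] := eqVneq (diagonalizable_MIS (s n)) finset.set0; first by left.
right; apply: leq_trans le_n; rewrite addnS -addSn leq_add2r.
have [x xd] := finset.set0Pn _ nz.
have xs : x \in s n by move: xd; rewrite inE => /andP[].
apply: proper_card; rewrite sS; apply/properP; split; first exact: finset.subsetDl.
by exists x => //; rewrite inE xd.
Qed.

End Spaces.

Definition dimensionally_stable (R : realType) (m m' : nat) (T : tmesh R)
    (r : edges T -> int) : Prop :=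
  forall (T' : tmesh R) (r' : edges T' -> int), struct_class r r' ->
    \dim (spline_space m m' r') = \dim (spline_space m m' r).

(* Main.v *)
(* Reducedness excludes reentrant corners, so the domain is a rectangle.  A
   spline is then determined by its polynomial on the lower left cell, one
   polynomial for each cross-cut, and one polynomial q for each crossing of a
   horizontal and a vertical maximal segment, namely the change of the jumps
   across both segments at that vertex.  Such data come from a spline exactly
   when the jump across every MIS returns to zero at its end, and the vector of
   these total jumps is the sum of the vertex relations of the polynomials q.
   By rank-nullity, dim S + dim R is a sum of dimensions of polynomial spaces
   that depends only on the structural class, and so does dim S - dim H(MIS).
   For a diagonalizable MIS rho, the vertex relations at the vertices in Mono
   fill up B_rho modulo the segments already deleted, because by Hermite
   interpolation the powers ell^(r+1) of the crossing lines generate all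
   polynomials of the degree of rho.  Hence dim H(CNDC) = dim H(MIS), and the
   CNDC itself is preserved by structural isomorphisms. *)

(* A reentrant corner would make an interior segment end on the boundary exactly where a collinear
   boundary segment meets it, against the uniqueness of the member of [MShat] of a given direction
   at a vertex. All computations use the tensor grid of all coordinates of cells and edges, where a
   spline is a function on grid squares and its jumps are finite differences. The mixed second
   difference at a crossing is a change of jump across both lines, hence divisible by a power of
   [s - s0] and by a power of [t - t0]; these are coprime, and the cofactor of their product is the
   polynomial q of the crossing. A ray imposes no condition, since its jump is made to vanish at the
   inner end and is free at the boundary; only an MIS has two ends to satisfy. Constancy of the
   second smoothness along maximal segments has to be derived inside the structural class: counting
   edges through perpendicular segments shows that the induced map of edges is onto on every maximal
   segment, and then degrees, weights and each deletion pass are transported. *)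
From HB Require Import structures.
Require Import Defs.
From mathcomp Require Import all_boot all_order all_algebra.
From mathcomp Require Import finmap all_classical all_reals all_analysis.
From mathcomp Require Import zify ring lra.

Set Implicit Arguments.
Unset Strict Implicit.
Unset Printing Implicit Defensive.

Import Order.TTheory GRing.Theory Num.Theory.
Import numFieldNormedType.Exports.
Local Open Scope ring_scope.
Local Open Scope classical_set_scope.

(** * The grid of a T-mesh *)

(* In a large context, [lia] and [lra] spend most of their time on hypotheses
   of foreign types; these variants clear them first. *)
Ltac nlia := repeat match goal with
  | H : context [@Order.lt _ _ _ _] |- _ => clear H
  | H : context [@Order.le _ _ _ _] |- _ => clear H
  | H : @eq ?A _ _ |- _ => lazymatch eval hnf in A with nat => fail | _ => clear H end
  | H : is_true (negb (@eq_op _ ?x _)) |- _ =>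
      let A := type of x in lazymatch eval hnf in A with nat => fail | _ => clear H end
  | H : ?P |- _ => lazymatch P with
      | is_true (leq _ _) => fail | is_true (andb _ _) => fail
      | is_true (negb _) => fail
      | @eq _ _ _ => fail | or _ _ => fail
      | _ => lazymatch type of P with Prop => clear H | _ => fail end end
  end; lia.

Ltac rlra := repeat match goal with
  | H : ?P |- _ => lazymatch P with
      | context [@Order.lt _ _ _ _] => fail
      | context [@Order.le _ _ _ _] => fail
      | @eq nat _ _ => clear H
      | @eq bool _ _ => clear H
      | @eq _ _ _ => fail | or _ _ => fail
      | _ => lazymatch type of P with Prop => clear H | _ => fail end end
  end; lra.

Section Direction.
Context {A : Type}.
Implicit Types (d : bool) (u v : A) (p : A * A).

(** [d = true] is the horizontal direction. Writing arguments with [d] and [~~ d] treats both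
    directions at once; [A] is arbitrary because the notation serves points, index pairs of grid
    squares, and pairs (horizontal, vertical) of segments. *)
Definition along d p : A := if d then p.1 else p.2.
Definition pt d u v : A * A := if d then (u, v) else (v, u).

Lemma along_pt d u v : along d (pt d u v) = u. Proof. by case: d. Qed.
Lemma cross_pt d u v : along (~~ d) (pt d u v) = v. Proof. by case: d. Qed.
Lemma pt_along d p : pt d (along d p) (along (~~ d) p) = p.
Proof. by case: d p => -[]. Qed.
Lemma ptN d u v : pt (~~ d) u v = pt d v u. Proof. by case: d. Qed.
Lemma allbP (P : bool -> Prop) d : P d -> P (~~ d) -> forall d', P d'.
Proof. by case: d => ? ? []. Qed.
End Direction.

Section Boxes.
Context {R : realType}.
Implicit Types (A : set (R * R)) (p q : R * R) (c : rect R) (e : seg R).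

Definition cmin d c := if d then xmin c else ymin c.
Definition cmax d c := if d then xmax c else ymax c.

Lemma interior_boxP A p : interior A p <->
  exists2 e : R, 0 < e & forall q, (forall d, `|along d q - along d p| < e) -> A q.
Proof.
rewrite /interior -nbhs_ballE; split=> -[e e0 H]; exists e => // q Hq; apply: H.
  by split; rewrite /ball /= distrC; [exact: (Hq true)|exact: (Hq false)].
by case: Hq => /= H1 H2 [] /=; rewrite distrC.
Qed.

Lemma rect_ptsP c p : rect_pts c p <-> forall d, cmin d c <= along d p <= cmax d c.
Proof.
split; first by move=> /andP[? ?] [].
by move=> H; apply/andP; split; [exact: (H true)|exact: (H false)].
Qed.

Lemma interior_rectP c p :
  interior (rect_pts c) p <-> forall d, cmin d c < along d p < cmax d c.
Proof.
rewrite interior_boxP; split.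
  case=> e e0 H d.
  have K (s : R) : `|s| < e -> cmin d c <= along d p + s <= cmax d c.
    move=> hs; have /rect_ptsP/(_ d) : rect_pts c (pt d (along d p + s) (along (~~ d) p)).
      apply: H; apply: (@allbP _ d); first by rewrite along_pt addrC addKr.
      by rewrite cross_pt subrr normr0.
    by rewrite along_pt.
  have := K (e / 2); have := K (- (e / 2)); rewrite normrN gtr0_norm; last by lra.
  move=> /(_ ltac:(lra)) ? /(_ ltac:(lra)) ?; lra.
move=> H.
pose m d := Num.min (along d p - cmin d c) (cmax d c - along d p).
have m0 d : 0 < m d by have := H d; rewrite lt_min; lra.
exists (Num.min (m true) (m false)); first by rewrite lt_min !m0.
move=> q Hq; apply/rect_ptsP => d; have := Hq d.
have : Num.min (m true) (m false) <= m d by case: (d); rewrite ge_min lexx ?orbT.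
rewrite {2}/m; move: (Num.min (m true) _) => M; rewrite le_min.
move=> /andP[? ?]; rewrite ltr_norml => /andP[? ?]; lra.
Qed.

Lemma closure_boxP A p : closure A p <->
  forall e : R, 0 < e -> exists2 q, A q & forall d, `|along d q - along d p| < e.
Proof.
split=> [H e e0|H B].
  have /H[q [Aq Bq]] : nbhs p [set q | forall d, `|along d q - along d p| < e].
    by apply/interior_boxP; exists e.
  by exists q.
by move=> /interior_boxP[e e0 He]; have [q Aq Hq] := H e e0; exists q; split=> //; exact: He.
Qed.

Lemma closed_rect c : closed (rect_pts c).
Proof.
move=> p /closure_boxP H; apply/rect_ptsP => d.
rewrite !leNgt; apply/andP; split; apply/negP => K.
  have [|q /rect_ptsP/(_ d) Hq /(_ d)] := H (cmin d c - along d p); first by lra.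
  by rewrite ltr_norml; lra.
have [|q /rect_ptsP/(_ d) Hq /(_ d)] := H (along d p - cmax d c); first by lra.
by rewrite ltr_norml; lra.
Qed.

Lemma frontier_rectP c p : frontier (rect_pts c) p <->
  rect_pts c p /\ exists d, along d p = cmin d c \/ along d p = cmax d c.
Proof.
rewrite /frontier /setD /= -(closure_id _).1; last exact: closed_rect.
split=> -[Hp H]; split=> //.
  apply: contrapT => K; apply: H; apply/interior_rectP => d.
  have /rect_ptsP/(_ d)/andP[h1 h2] := Hp.
  rewrite !lt_neqAle h1 h2 !andbT; apply/andP; split; apply/eqP => E; apply: K; exists d; rewrite E; by [left|right].
by move=> /interior_rectP K; case: H => d; have := K d; lra.
Qed.

Lemma on_segE e p : on_seg e p =
  (along (~~ horiz e) p == cor e) && (lo e <= along (horiz e) p <= hi e).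
Proof. by rewrite /on_seg; case: (horiz e). Qed.

End Boxes.

(** Moves a point that may lie on a grid line into an open grid interval without leaving a given
    neighbourhood, so that coverage can be tested strictly inside a grid square. *)
Lemma near_open (R : realType) (l h u e : R) : l < h -> l <= u <= h -> 0 < e ->
  exists2 u', l < u' < h & `|u' - u| < e.
Proof.
move=> lh /andP[lu uh] e0; have [uh'|hu] := ltP u h.
  exists ((u + Num.min (u + e) h) / 2); first by case: (lerP (u + e) h) => ?; lra.
  by rewrite ltr_norml; case: (lerP (u + e) h) => ?; lra.
exists ((u + Num.max (u - e) l) / 2); first by case: (lerP (u - e) l) => ?; lra.
by rewrite ltr_norml; case: (lerP (u - e) l) => ?; lra.
Qed.

Section Grid.
Context {R : realType} (T : tmesh R).
Implicit Types (p q : R * R) (c : rect R) (e : seg R) (d : bool) (k : nat * nat).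

(** Since all sides of cells and all ends and lines of edges are listed, none of them, and no
    vertex, has a coordinate strictly between two consecutive entries. [ngrid] counts the intervals,
    so the grid lines have the indices 0 to [ngrid]. *)
Definition crd d : seq R := sort <=%R (undup (
  flatten [seq [:: cmin d c; cmax d c] | c <- enum_fset (cells T)] ++
  flatten [seq (if horiz e == d then [:: lo e; hi e] else [:: cor e]) |
            e <- enum_fset (edges T)])).
Definition grid d i := (crd d)`_i.
Definition ngrid d := (size (crd d)).-1.
Local Notation g := grid.
Local Notation n := ngrid.

Lemma grid_lt d i j : (i < j)%N -> (j <= n d)%N -> g d i < g d j.
Proof.
move=> ij jn; have sz : (j < size (crd d))%N by move: jn; rewrite /n; lia.
have so : sorted <%R (crd d) by rewrite sort_lt_sorted undup_uniq.
apply: (sorted_ltn_nth lt_trans 0 so) => //; rewrite inE //.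
exact: ltn_trans sz.
Qed.

Lemma grid_ltE d i j : (i <= n d)%N -> (j <= n d)%N -> (g d i < g d j) = (i < j)%N.
Proof.
move=> hi hj; apply/idP/idP => [|/grid_lt]; last exact.
apply: contraTT; rewrite -leqNgt -leNgt leq_eqVlt => /orP[/eqP->//|ji].
by apply/ltW/grid_lt.
Qed.

Lemma grid_leE d i j : (i <= n d)%N -> (j <= n d)%N -> (g d i <= g d j) = (i <= j)%N.
Proof. by move=> hi hj; rewrite leNgt grid_ltE // -leqNgt. Qed.

Lemma grid_inj d i j : (i <= n d)%N -> (j <= n d)%N -> g d i = g d j -> i = j.
Proof.
by move=> hi hj E; apply/eqP; rewrite eqn_leq -(grid_leE hi hj) -(grid_leE hj hi) E lexx.
Qed.

Lemma crd_grid d a : a \in crd d -> exists2 i, (i <= n d)%N & a = g d i.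
Proof.
move=> ha; exists (index a (crd d)); last by rewrite /g nth_index.
by move: ha; rewrite -index_mem /n; case: size => // k; rewrite ltnS.
Qed.

Lemma crd_cell c d : c \in cells T -> (cmin d c \in crd d) && (cmax d c \in crd d).
Proof.
move=> hc; rewrite !mem_sort !mem_undup !mem_cat; apply/andP; split; apply/orP; left;
 by apply/flatten_mapP; exists c => //; rewrite !inE eqxx ?orbT.
Qed.

Lemma crd_edge e : e \in edges T ->
  [/\ lo e \in crd (horiz e), hi e \in crd (horiz e) & cor e \in crd (~~ horiz e)].
Proof.
move=> he; rewrite !mem_sort !mem_undup !mem_cat; split; apply/orP; right;
 apply/flatten_mapP; exists e => //; rewrite ?eqxx ?inE ?eqxx ?orbT //.
by case: (horiz e); rewrite /= inE.
Qed.

Lemma crd_open d a i u : a \in crd d -> (i < n d)%N -> g d i < u < g d i.+1 ->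
  (a <= u -> a <= g d i) /\ (u <= a -> g d i.+1 <= a).
Proof.
move=> /crd_grid[j jn ->] hi /andP[h1 h2]; split=> h.
  have : g d j < g d i.+1 by exact: le_lt_trans h h2.
  by rewrite grid_ltE // grid_leE // ltnW.
have : g d i < g d j by exact: lt_le_trans h1 h.
by rewrite grid_ltE ?grid_leE // ltnW.
Qed.

Lemma crd_open_neq d a i u : a \in crd d -> (i < n d)%N -> g d i < u < g d i.+1 -> u != a.
Proof.
move=> ha hi hu; apply/negP => /eqP E; have [/(_ _)] := crd_open ha hi hu.
by rewrite E lexx => /(_ isT) ? _; move: hu; rewrite E; lra.
Qed.

Lemma grid_floor d u : g d 0%N <= u < g d (n d) ->
  exists2 i, (i < n d)%N & g d i <= u < g d i.+1.
Proof.
elim: (n d) => [|m IH]; first by move=> /andP[h1 h2]; have := le_lt_trans h1 h2; rewrite ltxx.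
have [um /andP[u0 _]|mu /andP[_ um]] := ltP u (g d m).
  by have [|i im] := IH; rewrite ?u0 //; exists i => //; rewrite ltnS ltnW.
by exists m => //; rewrite mu um.
Qed.

Lemma grid_first d u : u \in crd d -> g d 0%N <= u.
Proof. by move=> /crd_grid[i hi ->]; rewrite grid_leE. Qed.

Lemma grid_last d u : u \in crd d -> u <= g d (n d).
Proof. by move=> /crd_grid[i hi ->]; rewrite grid_leE. Qed.

Definition mid d i : R := (g d i + g d i.+1) / 2.
Lemma mid_open d i : (i < n d)%N -> g d i < mid d i < g d i.+1.
Proof. by move=> hi; have := @grid_lt d i i.+1 (leqnn _) hi; rewrite /mid; lra. Qed.

Definition grid_spans c d a := (cmin d c <= g d a) && (g d a.+1 <= cmax d c).
Definition incell c k := grid_spans c true k.1 && grid_spans c false k.2.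
Definition cov k := exists2 c, c \in cells T & incell c k.
Definition edge_covers e a := (lo e <= g (horiz e) a) && (g (horiz e) a.+1 <= hi e).
Definition ingrid k := (k.1 < n true)%N && (k.2 < n false)%N.

Lemma incellP c k : incell c k <-> forall d, grid_spans c d (along d k).
Proof. by split=> [/andP[? ?] []//|H]; apply/andP; split; [exact: (H true)|exact: (H false)]. Qed.
Lemma incell_pt c d a b : incell c (pt d a b) = grid_spans c d a && grid_spans c (~~ d) b.
Proof. by case: d; rewrite /incell //= andbC. Qed.
Lemma ingrid_pt d a b : ingrid (pt d a b) = (a < n d)%N && (b < n (~~ d))%N.
Proof. by case: d; rewrite /ingrid //= andbC. Qed.
Lemma ingridP k : ingrid k <-> forall d, (along d k < n d)%N.
Proof. by split=> [/andP[? ?] []//|H]; apply/andP; split; [exact: (H true)|exact: (H false)]. Qed.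

Lemma cell_spans c p d a : c \in cells T -> rect_pts c p -> (a < n d)%N ->
  g d a < along d p < g d a.+1 -> grid_spans c d a.
Proof.
move=> hc /rect_ptsP/(_ d) /andP[h1 h2] ha hp; have /andP[c1 c2] := crd_cell d hc.
by apply/andP; split; [apply: (crd_open c1 ha hp).1|apply: (crd_open c2 ha hp).2].
Qed.

Lemma edge_open e p d a : e \in edges T -> on_seg e p -> (a < n d)%N ->
  g d a < along d p < g d a.+1 -> [/\ horiz e = d, cor e = along (~~ d) p & edge_covers e a].
Proof.
move=> he; rewrite on_segE => /andP[/eqP hc /andP[h1 h2]] ha hp.
have [c1 c2 c3] := crd_edge he.
have [E|E] := eqVneq (horiz e) d.
  subst d; split=> //; apply/andP; split; first exact: (crd_open c1 ha hp).1.
  exact: (crd_open c2 ha hp).2.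
have Ed : d = ~~ horiz e by move: E; case: (horiz e) (d) => -[].
by subst d; have := crd_open_neq c3 ha hp; rewrite hc eqxx.
Qed.

Lemma mid_on_edge e a : edge_covers e a -> (a < n (horiz e))%N ->
  on_seg e (pt (horiz e) (mid (horiz e) a) (cor e)).
Proof.
move=> /andP[h1 h2] /mid_open hm; rewrite on_segE cross_pt along_pt eqxx /=; lra.
Qed.

Section Mesh.
Hypothesis hT : is_tmesh T.

Lemma cell_lt c d : c \in cells T -> cmin d c < cmax d c.
Proof. by case: hT => -[H _ _ _] _ _ _ /H []; case: d. Qed.

Lemma vert_crd p d : p \in verts T -> along d p \in crd d.
Proof.
rewrite in_fsetU => /orP[] /imfsetP[e /= he ->]; have [c1 c2 c3] := crd_edge he;
  rewrite /seg_lo /seg_hi; by case: (horiz e) c1 c2 c3 d => ? ? ? [].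
Qed.

Lemma cell_uniq c c' k : c \in cells T -> c' \in cells T -> ingrid k ->
  incell c k -> incell c' k -> c = c'.
Proof.
move=> hc hc' /ingridP hk /incellP H /incellP H'; apply: contrapT => /eqP ne.
case: hT => -[_ /(_ _ _ hc hc' ne) E _ _] _ _ _.
have : (interior (rect_pts c) `&` interior (rect_pts c')) (mid true k.1, mid false k.2).
  have K b : incell b k -> interior (rect_pts b) (mid true k.1, mid false k.2).
    move=> /incellP Hb; apply/interior_rectP => d; have := Hb d; have := mid_open (hk d).
    by rewrite /grid_spans; case: d => /=; lra.
  by split; apply: K; apply/incellP.
by rewrite E.
Qed.

Lemma edge_uniq e e' p d a : e \in edges T -> e' \in edges T -> on_seg e p -> on_seg e' p ->
  (a < n d)%N -> g d a < along d p < g d a.+1 -> e = e'.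
Proof.
move=> he he' H H' ha hp; apply: contrapT => /eqP ne.
case: hT => _ [_ _ /(_ _ _ _ he he' ne H H')] /(vert_crd d) hv _ _.
by have := crd_open_neq hv ha hp; rewrite eqxx.
Qed.

Lemma ecov_uniq e e' a : e \in edges T -> e' \in edges T -> horiz e = horiz e' ->
  cor e = cor e' -> (a < n (horiz e))%N -> edge_covers e a -> edge_covers e' a -> e = e'.
Proof.
move=> he he' hh hc ha H H'; have K := mid_on_edge H ha.
apply: (edge_uniq he he' K _ ha); last by rewrite along_pt mid_open.
by rewrite hh hc; apply: mid_on_edge; rewrite // -hh.
Qed.

(** By the mesh axioms the midpoint of the grid interval on this side lies on an edge. Its
    coordinate along the side is no grid value, so that edge runs along the side and covers the
    whole interval. *)
Lemma front_cover c d a v : c \in cells T -> (a < n d)%N -> grid_spans c d a ->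
  v = cmin (~~ d) c \/ v = cmax (~~ d) c ->
  exists2 e, e \in edges T & [/\ horiz e = d, cor e = v & edge_covers e a].
Proof.
move=> hc ha Hs hv; pose p := pt d (mid d a) v.
have fp : frontier (rect_pts c) p.
  apply/frontier_rectP; split; last by exists (~~ d); rewrite cross_pt.
  apply/rect_ptsP; apply: (@allbP _ d); rewrite /p.
    by rewrite along_pt; have := mid_open ha; move: Hs; rewrite /grid_spans; lra.
  by rewrite cross_pt; have := cell_lt (~~ d) hc; case: hv => ->; lra.
case: hT => _ _ /(_ _ hc)[E /fsubsetP EE Ef] _; move: fp; rewrite Ef => -[e /EE he Hp].
have [||hh ho hcov] := edge_open (d := d) (a := a) he Hp => //; first by rewrite along_pt mid_open.
by exists e => //; split => //; rewrite ho cross_pt.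
Qed.

(** The intersection of two cells may contain isolated vertices, but vertices have grid coordinates;
    the midpoint of the interval can therefore only lie on one of the common edges. *)
Lemma pair_cover c c' d a v : c \in cells T -> c' \in cells T -> c != c' -> (a < n d)%N ->
  grid_spans c d a -> grid_spans c' d a -> cmin (~~ d) c <= v <= cmax (~~ d) c ->
  cmin (~~ d) c' <= v <= cmax (~~ d) c' ->
  exists2 e, e \in edges T & [/\ horiz e = d, cor e = v, edge_covers e a &
    forall p, on_seg e p -> rect_pts c p /\ rect_pts c' p].
Proof.
move=> hc hc' ne ha Hs Hs' hv hv'; pose p := pt d (mid d a) v.
have K b : grid_spans b d a -> cmin (~~ d) b <= v <= cmax (~~ d) b -> rect_pts b p.
  move=> Hb Hv; apply/rect_ptsP; apply: (@allbP _ d); last by rewrite cross_pt.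
  by rewrite along_pt; have := mid_open ha; move: Hb; rewrite /grid_spans; lra.
have hpc : (rect_pts c `&` rect_pts c') p by split; exact: K.
have hm : g d a < along d p < g d a.+1 by rewrite along_pt mid_open.
case: hT => _ _ _ /(_ _ _ hc hc' ne)[_ [E [W [/fsubsetP EE /fsubsetP WW Ef]]]].
move: (hpc); rewrite Ef => -[[e eE Hp]|/WW /(vert_crd d) hv2]; last first.
  by have := crd_open_neq hv2 ha hm; rewrite eqxx.
have [hh ho hcov] := edge_open (EE _ eE) Hp ha hm.
exists e; first exact: EE.
split=> // [|q Hq]; first by rewrite ho cross_pt.
by suff : (rect_pts c `&` rect_pts c') q by []; rewrite Ef; left; exists e.
Qed.

Lemma edge_cell e a : e \in edges T -> (a < n (horiz e))%N -> edge_covers e a ->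
  exists2 c, c \in cells T & grid_spans c (horiz e) a /\
    (cor e = cmin (~~ horiz e) c \/ cor e = cmax (~~ horiz e) c).
Proof.
move=> he ha H; have K := mid_on_edge H ha.
case: (hT) => _ [_ /(_ _ _ he K) [c hc /frontier_rectP[Hc [d Hd]]] _] _ _.
have hm := mid_open ha.
exists c => //; split; first by apply: (cell_spans hc Hc ha); rewrite along_pt.
have [E|E] := eqVneq d (horiz e).
  subst d; rewrite along_pt in Hd; have /andP[c1 c2] := crd_cell (horiz e) hc.
  by case: Hd => E; [have := crd_open_neq c1 ha hm|have := crd_open_neq c2 ha hm]; rewrite E eqxx.
have Ed : d = ~~ horiz e by move: E; case: (horiz e) (d) => -[].
by subst d; rewrite cross_pt in Hd.
Qed.

Lemma edge_range e : e \in edges T ->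
  exists i0 i1, [/\ (i0 < i1 <= n (horiz e))%N, lo e = g (horiz e) i0, hi e = g (horiz e) i1 &
    forall a, (a < n (horiz e))%N -> edge_covers e a = (i0 <= a < i1)%N].
Proof.
move=> he; have [/crd_grid[i0 h0 E0] /crd_grid[i1 h1 E1] _] := crd_edge he.
exists i0, i1; case: (hT) => _ [/(_ _ he) + _ _] _ _; rewrite E0 E1 grid_ltE // => lt01.
rewrite lt01 h1; split=> // a ha; rewrite /edge_covers E0 E1 !grid_leE //; exact: ltnW.
Qed.

Lemma domain_range p d : domain T p -> g d 0%N <= along d p <= g d (n d).
Proof.
move=> [c hc /rect_ptsP/(_ d) H]; have /andP[/grid_first c1 /grid_last c2] := crd_cell d hc; lra.
Qed.

Lemma interior_strict p d : interior (domain T) p -> g d 0%N < along d p < g d (n d).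
Proof.
move=> /interior_boxP[e e0 H].
have K (s : R) : `|s| < e -> g d 0%N <= along d p + s <= g d (n d).
  move=> hs; have /(domain_range d) : domain T (pt d (along d p + s) (along (~~ d) p)).
    apply: H; apply: (@allbP _ d); first by rewrite along_pt addrC addKr.
    by rewrite cross_pt subrr normr0.
  by rewrite along_pt.
have := K (e / 2); have := K (- (e / 2)); rewrite normrN gtr0_norm; last by lra.
by move=> /(_ ltac:(lra)) ? /(_ ltac:(lra)) ?; lra.
Qed.

(** It suffices that [p] lies in the closed square: points of the open square close to [p] still
    belong to the domain, and a cell containing one of them contains the whole square. *)
Lemma interior_cov p k : interior (domain T) p -> ingrid k ->
  (forall d, g d (along d k) <= along d p <= g d (along d k).+1) -> cov k.
Proof.
move=> /interior_boxP[e e0 H] /ingridP hk hp.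
have N d : exists2 u, g d (along d k) < u < g d (along d k).+1 & `|u - along d p| < e.
  by apply: near_open => //; apply: grid_lt.
have [u1 h1 h1'] := N true; have [u2 h2 h2'] := N false.
have [|c hc Hc] := H (u1, u2); first by case.
exists c => //; apply/incellP => d; apply: (cell_spans hc Hc (hk d)); by case: d.
Qed.

End Mesh.
End Grid.

(** * Connected unions of collinear edges *)

Section Segments.
Context {R : realType} (T : tmesh R).
Implicit Types (p q : R * R) (e : edges T) (d : bool) (rho : {set edges T}).

Lemma continuous_along d : continuous (along d : R * R -> R).
Proof. by case: d => p; [exact: cvg_fst|exact: cvg_snd]. Qed.

Lemma continuous_pt d (c : R) : continuous (fun u : R => pt d u c).
Proof.
move=> u; rewrite /continuous_at; apply/cvg_ballP => e e0.
apply: filterS (nbhsx_ballx u e e0) => v uv.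
by case: d; split => //=; exact: ballxx.
Qed.

Lemma segment_dir rho e : is_segment rho -> e \in rho ->
  horiz (val e) = horizontal rho /\ cor (val e) = coordinate rho.
Proof.
move=> [_ H _] er; split.
  rewrite /horizontal; apply/idP/existsP => [he|[e' /andP[er' he']]]; first by exists e; rewrite er.
  by rewrite (H e e' er er').1.
by rewrite /coordinate; case: pickP => [e' er'|/(_ e)]; rewrite ?er //; apply: (H _ _ er er').2.
Qed.

Lemma on_segmentP p rho : on_segment p rho <-> exists2 e, e \in rho & on_seg (val e) p.
Proof.
by split=> [/existsP[e /andP[? ?]]|[e ? ?]]; [exists e|apply/existsP; exists e; apply/andP].
Qed.

Lemma segment_line rho p : is_segment rho -> on_segment p rho ->
  along (~~ horizontal rho) p = coordinate rho.
Proof.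
move=> H /on_segmentP[e er]; have [<- <-] := segment_dir H er.
by rewrite on_segE => /andP[/eqP].
Qed.

Lemma segment_interval rho p q u : is_segment rho -> on_segment p rho -> on_segment q rho ->
  along (horizontal rho) p <= u <= along (horizontal rho) q ->
  on_segment (pt (horizontal rho) u (coordinate rho)) rho.
Proof.
move=> H hp hq hu; set d := horizontal rho.
have : connected (along d @` pts rho).
  apply: connected_continuous_connected; first by case: H.
  exact/continuous_subspaceT/continuous_along.
move=> /connected_intervalP/(_ (along d p) (along d q)).
case/(_ _ _ u hu) => [||x xr <-]; [by exists p|by exists q|].
by rewrite -(segment_line H xr) pt_along.
Qed.

Lemma connected_seg (s : seg R) : connected (seg_pts s).
Proof.
have -> : seg_pts s = (fun u => pt (horiz s) u (cor s)) @` `[lo s, hi s].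
  apply/seteqP; split=> p; rewrite /seg_pts /= on_segE.
    by move=> /andP[/eqP<- h]; exists (along (horiz s) p); rewrite ?pt_along //= in_itv.
  by move=> [u]; rewrite in_itv /= => h <-; rewrite cross_pt along_pt eqxx.
apply: connected_continuous_connected; first exact: segment_connected.
exact/continuous_subspaceT/continuous_pt.
Qed.

Lemma pts1 e : pts [set e]%SET = seg_pts (val e).
Proof.
apply/seteqP; split=> p; rewrite /pts /=.
  by move=> /on_segmentP[e' /set1P->].
by move=> H; apply/on_segmentP; exists e; rewrite ?inE.
Qed.

Lemma segment1 e : is_segment [set e]%SET.
Proof.
split; first by apply/finset.set0Pn; exists e; rewrite inE.
  by move=> e1 e2; rewrite !inE => /eqP-> /eqP->.
by rewrite pts1; exact: connected_seg.
Qed.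

Lemma segmentU rho e p : is_segment rho -> horiz (val e) = horizontal rho ->
  cor (val e) = coordinate rho -> on_seg (val e) p -> on_segment p rho ->
  is_segment (e |: rho)%SET.
Proof.
move=> H he ce ep rp; split.
- by apply/finset.set0Pn; exists e; rewrite !inE eqxx.
- have K x : x \in (e |: rho)%SET -> horiz (val x) = horizontal rho /\ cor (val x) = coordinate rho.
    by rewrite !inE => /orP[/eqP->|/(segment_dir H)].
  by move=> x y /K[-> ->] /K[-> ->].
have -> : pts (e |: rho)%SET = seg_pts (val e) `|` pts rho.
  apply/seteqP; split=> x; rewrite /pts /=.
    by move=> /on_segmentP[y]; rewrite !inE => /orP[/eqP->|yr yx]; [left|right; apply/on_segmentP; exists y].
  by move=> [ex|/on_segmentP[y yr yx]]; apply/on_segmentP; [exists e|exists y]; rewrite ?inE ?eqxx ?yr ?orbT.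
apply: connectedU; [by exists p|exact: connected_seg|by case: H].
Qed.

(** Common form of [MS] and [BMS], with [E] the interior or the boundary edges. *)
Definition maxseg (E : {set edges T}) rho :=
  maxset (fun x : {set edges T} => `[< is_segment x >] && (x \subset E)) rho.

Lemma maxsegP E rho : maxseg E rho -> is_segment rho /\ rho \subset E.
Proof. by move=> /maxsetp/andP[/asboolP]. Qed.

Lemma maxseg_absorb E rho e p : maxseg E rho -> e \in E -> horiz (val e) = horizontal rho ->
  cor (val e) = coordinate rho -> on_seg (val e) p -> on_segment p rho -> e \in rho.
Proof.
move=> M eE he ce ep rp; have [H sE] := maxsegP M.
have -> : rho = (e |: rho)%SET; last by rewrite !inE eqxx.
apply/esym/(maxsetsup M); last exact: finset.subsetUr.
apply/andP; split; first exact/asboolP/(segmentU H he ce ep rp).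
by apply/fintype.subsetP => x; rewrite !inE => /orP[/eqP->//|/(fintype.subsetP sE)].
Qed.

Lemma maxseg_exists (E : {set edges T}) e : e \in E -> exists2 rho, maxseg E rho & e \in rho.
Proof.
move=> eE; have [|rho M /fintype.subsetP sr] := @maxset_exists _
  (fun x : {set edges T} => `[< is_segment x >] && (x \subset E)) [set e]%SET.
  apply/andP; split; first exact/asboolP/segment1.
  by apply/fintype.subsetP => x; rewrite inE => /eqP->.
by exists rho => //; apply: sr; rewrite inE.
Qed.

Lemma MS_maxseg rho : rho \in MS T = maxseg (interior_edges T) rho.
Proof. by rewrite inE. Qed.
Lemma BMS_maxseg rho : rho \in BMS T = maxseg (boundary_edges T) rho.
Proof. by rewrite inE. Qed.

Lemma MShat_segment rho : rho \in MShat T -> is_segment rho.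
Proof.
rewrite !inE => /orP[/orP[/orP[]|]|]; try by move=> /andP[/maxsegP[]].
by move=> /maxsegP[].
Qed.

End Segments.

(** * The two cells beside an interior edge *)

Section Convex.
Context {R : realType} (T : tmesh R) (hT : is_tmesh T).
Implicit Types (p q : R * R) (c : rect R) (e : seg R) (d : bool) (k : nat * nat).
Local Notation g := (grid T).
Local Notation n := (ngrid T).
Local Notation spans := (grid_spans T).
Local Notation ecov := (edge_covers T).
Local Notation cov := (cov T).

Lemma spans_lt c d j : c \in cells T -> (j < n d)%N -> cmin d c <= g d j -> g d j < cmax d c ->
  spans c d j.
Proof.
move=> hc hj h1 h2; apply/andP; split=> //; have /andP[_ /crd_grid[i hi E]] := crd_cell d hc.
by move: h2; rewrite E grid_ltE ?grid_leE // ltnW.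
Qed.

Lemma spans_gt c d j : c \in cells T -> (0 < j <= n d)%N -> cmin d c < g d j -> g d j <= cmax d c ->
  spans c d j.-1.
Proof.
move=> hc /andP[j0 hj] h1 h2; rewrite /grid_spans prednK // h2 andbT.
have /andP[/crd_grid[i hi E] _] := crd_cell d hc.
by move: h1; rewrite E grid_ltE ?grid_leE //; nlia.
Qed.

Lemma edge_at e q : e \in edges T -> on_seg e q -> exists a, [/\ (a < n (horiz e))%N, ecov e a &
  g (horiz e) a <= along (horiz e) q <= g (horiz e) a.+1].
Proof.
move=> he; rewrite on_segE => /andP[_]; set d := horiz e; set u := along d q.
have [i0 [i1 [/andP[lt01 hi1] E0 E1 Ha]]] := edge_range hT he.
rewrite E0 E1 -/d => /andP[h0 h1].
have [lt|ge] := ltP u (g d i1).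
  have [|a ha /andP[a1 a2]] := @grid_floor _ T d u.
    rewrite (lt_le_trans lt) ?grid_leE // andbT (le_trans _ h0) // grid_leE //; nlia.
  exists a; split=> //; last by rewrite a1 ltW.
  rewrite Ha //; apply/andP; split.
    by rewrite -ltnS -(@grid_ltE _ T d) //; [exact: le_lt_trans h0 a2|nlia].
  by rewrite -(@grid_ltE _ T d) //; [exact: le_lt_trans a1 lt|nlia].
have i1p : (i1.-1.+1 = i1)%N by nlia.
exists i1.-1; split; [nlia| |].
  by rewrite Ha; nlia.
by rewrite i1p h1 andbT (le_trans _ ge) // grid_leE; nlia.
Qed.

(** One interior point of the domain on the edge forces coverage of the grid squares on both sides
    there. The edge that [pair_cover] supplies for the two covering cells is [e] itself, so [e]
    separates the same two cells along its entire length. *)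
Lemma interior_edge_cells e q : e \in edges T -> on_seg e q -> interior (domain T) q ->
  exists j, [/\ (0 < j < n (~~ horiz e))%N, cor e = g (~~ horiz e) j &
  exists c c', [/\ c \in cells T, c' \in cells T, c != c' &
    [/\ spans c (~~ horiz e) j.-1, spans c' (~~ horiz e) j &
    forall p, on_seg e p -> rect_pts c p /\ rect_pts c' p]]].
Proof.
move=> he eq qi; set d := horiz e.
have [_ _ /crd_grid[j hj Ej]] := crd_edge he.
have cq : along (~~ d) q = g (~~ d) j by move: eq; rewrite on_segE Ej => /andP[/eqP].
have hj' : (0 < j < n (~~ d))%N.
  by have := interior_strict (~~ d) qi; rewrite cq !grid_ltE.
exists j; split=> //.
have [a [ha eca qa]] := edge_at he eq.
have /andP[j0 jn] := hj'.
have jp : (j.-1.+1 = j)%N by nlia.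
have [c hc] : cov (pt d a j.-1).
  apply: (interior_cov qi); first by rewrite ingrid_pt ha; nlia.
  apply: (@allbP _ d); first by rewrite !along_pt.
  by rewrite !cross_pt cq jp lexx andbT grid_leE //; nlia.
have [c' hc'] : cov (pt d a j).
  apply: (interior_cov qi); first by rewrite ingrid_pt ha; nlia.
  apply: (@allbP _ d); first by rewrite !along_pt.
  by rewrite !cross_pt cq lexx grid_leE // ltnW.
rewrite !incell_pt => /andP[s1' s2'] /andP[s1 s2].
have g1 : g (~~ d) j.-1 < g (~~ d) j by apply: grid_lt => //; nlia.
have g2 : g (~~ d) j < g (~~ d) j.+1 by apply: grid_lt.
(* Otherwise [c] would extend across the line of [e]. But the cell [c2] that has [e] on its side
   contains one of the two squares, and so would be [c]. *)
have ne : c != c'.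
  apply/negP => /eqP E; subst c'.
  have [c2 hc2 [s3 Hc2]] := edge_cell hT he ha eca.
  have lt2 := cell_lt hT (~~ d) hc2.
  suff E : c2 = c.
    by subst c2; move: Hc2 s2 s2'; rewrite -/d Ej /grid_spans jp => -[] <-; lra.
  case: Hc2; rewrite -/d Ej => E.
    apply: (cell_uniq hT hc2 hc (k := pt d a j)); rewrite ?ingrid_pt ?ha // ?incell_pt ?s1' ?s2' // s3 /=.
    by apply: spans_lt; rewrite ?E.
  apply: (cell_uniq hT hc2 hc (k := pt d a j.-1));
    rewrite ?ingrid_pt ?ha ?incell_pt ?s1 ?s2 //; first by rewrite /=; nlia.
  by rewrite s3 /=; apply: spans_gt; rewrite ?E //; rewrite -?E; nlia.
have [e' he' [hh hcor hcov Hsub]] : exists2 e', e' \in edges T & [/\ horiz e' = d, cor e' = g (~~ d) j, ecov e' a &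
    forall p, on_seg e' p -> rect_pts c p /\ rect_pts c' p].
  apply: (pair_cover hT) => //.
    by move: s2; rewrite /grid_spans jp; lra.
  by move: s2'; rewrite /grid_spans; lra.
have E : e' = e by apply: (ecov_uniq hT he' he hh _ _ hcov eca); rewrite ?hh ?hcor.
by exists c, c'; split=> //; split=> // p; rewrite -E; exact: Hsub.
Qed.

Lemma interior_edge_cov e q a j : e \in edges T -> on_seg e q -> interior (domain T) q ->
  (a < n (horiz e))%N -> ecov e a -> (j <= n (~~ horiz e))%N -> cor e = g (~~ horiz e) j ->
  cov (pt (horiz e) a j.-1) /\ cov (pt (horiz e) a j).
Proof.
move=> he eq qi ha eca hj Ej.
have [j' [hj' Ej' [c [c' [hc hc' _ [s s' Hsub]]]]]] := interior_edge_cells he eq qi.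
have E : j = j' by apply: (@grid_inj _ T (~~ horiz e)) => //; [nlia|rewrite -Ej].
subst j'; have [r1 r2] := Hsub _ (mid_on_edge eca ha).
have hm := mid_open ha.
split; [exists c => //; rewrite incell_pt s andbT|exists c' => //; rewrite incell_pt s' andbT].
  by apply: (cell_spans hc r1 ha); rewrite along_pt.
by apply: (cell_spans hc' r2 ha); rewrite along_pt.
Qed.

Lemma two_cells_interior c c' d a j p : c \in cells T -> c' \in cells T -> (a < n d)%N ->
  (0 < j < n (~~ d))%N ->
  spans c d a -> spans c' d a -> spans c (~~ d) j.-1 -> spans c' (~~ d) j ->
  g d a < along d p < g d a.+1 -> along (~~ d) p = g (~~ d) j -> interior (domain T) p.
Proof.
move=> hc hc' ha /andP[j0 jn] /andP[c1 c2] /andP[c3 c4] /andP[c5 c6] /andP[c7 c8] hp pj.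
have jp : (j.-1.+1 = j)%N by nlia.
have g1 : g (~~ d) j.-1 < g (~~ d) j by apply: grid_lt => //; nlia.
have g2 : g (~~ d) j < g (~~ d) j.+1 by apply: grid_lt.
have [e /and5P[e0 e1 e2 e3 e4]] : exists e : R, [&& 0 < e, e <= along d p - g d a, e <= g d a.+1 - along d p,
  e <= g (~~ d) j - g (~~ d) j.-1 & e <= g (~~ d) j.+1 - g (~~ d) j].
  exists (Num.min (Num.min (along d p - g d a) (g d a.+1 - along d p))
     (Num.min (g (~~ d) j - g (~~ d) j.-1) (g (~~ d) j.+1 - g (~~ d) j))).
  by rewrite !lt_min !ge_min !lexx !orbT /= andbT; lra.
rewrite jp in c6.
apply/interior_boxP; exists e => // q Hq; have := Hq d; have := Hq (~~ d).
rewrite pj !ltr_norml => h1 h2.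
have [qj|jq] := leP (along (~~ d) q) (g (~~ d) j).
  by exists c => //; apply/rect_ptsP; apply: (@allbP _ d); lra.
by exists c' => //; apply/rect_ptsP; apply: (@allbP _ d); lra.
Qed.

End Convex.

(** * The domain is a rectangle *)

Section Reentrant.
Context {R : realType} (T : tmesh R) (hT : is_tmesh T) (hred : reduced T).
Implicit Types (p q : R * R) (c : rect R) (e : seg R) (d : bool) (k : nat * nat).
Local Notation g := (grid T).
Local Notation n := (ngrid T).
Local Notation spans := (grid_spans T).
Local Notation ecov := (edge_covers T).
Local Notation cov := (cov T).
Local Notation incell := (incell T).

Lemma interior_edgeP (e : edges T) : reflect (exists2 q, on_seg (val e) q & interior (domain T) q)
  (e \in interior_edges T).
Proof.
rewrite inE; apply: (equivP (asboolP _)); split=> [[q [? ?]]|[q ? ?]]; by exists q.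
Qed.

Lemma closed_domain : closed (domain T).
Proof.
have -> : domain T = \big[setU/set0]_(c <- enum_fset (cells T)) rect_pts c.
  rewrite -bigcup_seq; apply/seteqP; split=> p [c hc Hc]; exists c => //.
apply: closed_bigsetU => c _; exact: closed_rect.
Qed.

Lemma frontier_domainP p : frontier (domain T) p <-> domain T p /\ ~ interior (domain T) p.
Proof. by rewrite /frontier /setD /= -(closure_id _).1 //; exact: closed_domain. Qed.

Lemma no_collinear (rho rho' : {set edges T}) p : p \in verts T -> rho \in MShat T ->
  rho' \in MShat T -> horizontal rho = horizontal rho' ->
  on_segment p rho -> on_segment p rho' -> rho = rho'.
Proof.
move=> hp h h' hh hr hr'; case: hred => _ /(_ p hp (horizontal rho'))[x [_ ux]] _.
by rewrite -(ux rho) ?(ux rho').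
Qed.

Lemma shared_vertex (e e' : edges T) p : e != e' -> on_seg (val e) p -> on_seg (val e') p ->
  p \in verts T.
Proof.
move=> ne he he'; have ne' : val e != val e' by rewrite (inj_eq val_inj).
by case: hT => _ [_ _ H] _ _; exact: (H _ _ _ (fsvalP e) (fsvalP e') ne' he he').
Qed.

(* The grid vertex is a reentrant corner: both cells meeting along the grid
   edge a1 are present, while over the collinear grid edge a0 only one is. *)
Lemma reentrant_absurd d a0 a1 b0 b1 c1 c2 :
  (a0 = a1.+1 \/ a1 = a0.+1) -> (b0 = b1.+1 \/ b1 = b0.+1) ->
  (a0 < n d)%N -> (a1 < n d)%N -> (b0 < n (~~ d))%N -> (b1 < n (~~ d))%N ->
  c1 \in cells T -> c2 \in cells T -> c1 != c2 ->
  incell c1 (pt d a1 b0) -> incell c2 (pt d a1 b1) -> cov (pt d a0 b1) -> cov (pt d a0 b0).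
Proof.
move=> adja adjb a0n a1n b0n b1n hc1 hc2 ne i1 i2 [c3 hc3 i3]; apply: contrapT => nocov.
move: (i1) (i2) (i3); rewrite !incell_pt => /andP[s1 t1] /andP[s2 t2] /andP[s3 t3].
pose i := maxn a0 a1; pose j := maxn b0 b1.
have [j' [Ej jn']] : exists j', j = j'.+1 /\ (j < n (~~ d))%N by exists j.-1; rewrite /j; nlia.
have jn : (0 < j < n (~~ d))%N by nlia.
have iN : (i < n d)%N by rewrite /i; nlia.
have tt c b : spans c (~~ d) b -> (b = b0 \/ b = b1) -> cmin (~~ d) c <= g (~~ d) j <= cmax (~~ d) c.
  move=> /andP[h1 h2] hb; apply/andP; split.
    by apply: (le_trans h1); rewrite grid_leE // /j; case: hb; nlia.
  by apply: (le_trans _ h2); rewrite grid_leE // /j; case: hb; nlia.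
have [e he [hd ce eca esub]] : exists2 e, e \in edges T & [/\ horiz e = d, cor e = g (~~ d) j, ecov e a1 &
    forall p, on_seg e p -> rect_pts c1 p /\ rect_pts c2 p].
  by apply: (pair_cover hT) => //; [apply: (tt _ _ t1); left|apply: (tt _ _ t2); right].
(* If the line ran strictly inside [c3], this cell would also cover the square assumed to be
   uncovered. *)
have bd3 : g (~~ d) j = cmin (~~ d) c3 \/ g (~~ d) j = cmax (~~ d) c3.
  have /andP[h1 h2] := tt _ _ t3 (or_intror erefl).
  have [E|n1] := eqVneq (g (~~ d) j) (cmin (~~ d) c3); first by left.
  have [E|n2] := eqVneq (g (~~ d) j) (cmax (~~ d) c3); first by right.
  exfalso; apply: nocov; exists c3 => //; rewrite incell_pt s3 /=.
  have h1' : cmin (~~ d) c3 < g (~~ d) j by rewrite lt_neqAle eq_sym n1.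
  have h2' : g (~~ d) j < cmax (~~ d) c3 by rewrite lt_neqAle n2.
  have [E|E] : b0 = j \/ b0 = j.-1 by rewrite /j; nlia.
    by rewrite E; apply: spans_lt => //; nlia.
  by rewrite E; apply: spans_gt => //; nlia.
have [e2 he2 [hd2 ce2 eca2]] := front_cover hT hc3 a0n s3 bd3.
(* An interior point on [e2] would make the squares on both sides covered. So [e2] is a boundary
   edge, while the collinear edge [e] is interior. *)
have e2b : ~ exists2 q, on_seg e2 q & interior (domain T) q.
  move=> [q q1 q2].
  have [] := @interior_edge_cov _ T hT e2 q a0 j he2 q1 q2; rewrite ?hd2 //; first by nlia.
  move=> k1 k2; apply: nocov; suff [->|->] : b0 = j \/ b0 = j.-1 by [].
  by rewrite /j; nlia.
pose e' : edges T := [` he]%fset; pose e2' : edges T := [` he2]%fset.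
have e'i : e' \in interior_edges T.
  apply/interior_edgeP; exists (pt d (mid T d a1) (g (~~ d) j)).
    by have := @mid_on_edge _ T e a1; rewrite hd ce; apply.
  have [E|E] : (b0 = j.-1 /\ b1 = j) \/ (b0 = j /\ b1 = j.-1) by rewrite /j; nlia.
    case: E => E0 E1; rewrite E0 in t1; rewrite E1 in t2.
    by apply: (two_cells_interior hc1 hc2 a1n jn s1 s2 t1 t2); rewrite ?cross_pt ?along_pt ?mid_open.
  case: E => E0 E1; rewrite E0 in t1; rewrite E1 in t2.
  by apply: (two_cells_interior hc2 hc1 a1n jn s2 s1 t2 t1); rewrite ?cross_pt ?along_pt ?mid_open.
have e2'i : e2' \in boundary_edges T.
  by rewrite finset.in_setC; apply/interior_edgeP.
have [rho M er] := maxseg_exists e'i; have [rho2 M2 er2] := maxseg_exists e2'i.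
have [Sr si] := maxsegP M; have [Sr2 sb] := maxsegP M2.
have [hr cr] := segment_dir Sr er; have [hr2 cr2] := segment_dir Sr2 er2.
rewrite /= hd ce in hr cr; rewrite /= hd2 ce2 in hr2 cr2.
pose P := pt d (g d i) (g (~~ d) j).
have ecovP e0 a : e0 \in edges T -> horiz e0 = d -> cor e0 = g (~~ d) j -> ecov e0 a -> (a < n d)%N ->
   (i = a \/ i = a.+1) -> on_seg e0 P.
  move=> he0 hd0 ce0 /andP[]; rewrite hd0 => h1 h2 ha hi; rewrite on_segE hd0 cross_pt along_pt ce0 eqxx /=.
  have := @grid_lt _ T d a a.+1 (leqnn _) ha.
  by clear -h1 h2 hi; case: hi => ->; rlra.
have Pe : on_seg e P by apply: (ecovP e a1) => //; rewrite /i; nlia.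
have Pe2 : on_seg e2 P by apply: (ecovP e2 a0) => //; rewrite /i; nlia.
have ne2 : e' != e2'.
  by apply/negP => /eqP E; move: e2'i; rewrite finset.in_setC -E e'i.
have Pv : P \in verts T by exact: (shared_vertex ne2 Pe Pe2).
have Pr : on_segment P rho by apply/on_segmentP; exists e'.
have Pr2 : on_segment P rho2 by apply/on_segmentP; exists e2'.
have noq q : on_segment q rho -> ~ (g d a0 < along d q < g d a0.+1).
  move=> /on_segmentP[f fr fq] hq.
  have [hf cf ff] := edge_open (fsvalP f) fq a0n hq.
  have [_ cf'] := segment_dir Sr fr.
  have E : val f = e2.
    apply: (ecov_uniq hT (fsvalP f) he2 _ _ _ ff eca2); rewrite ?hf ?hd2 //.
    by rewrite ce2 cf' -cr.
  apply: e2b; rewrite -E; apply/interior_edgeP; exact: (fintype.subsetP si).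
(* By connectedness, a point of [rho] beyond the corner would give a point of [rho] strictly over
   the interval [a0], which [noq] forbids; hence [rho] ends at [P]. *)
have side q : on_segment q rho -> if a0 == i then along d q <= g d i else g d i <= along d q.
  have lt0 := @grid_lt _ T d a0 a0.+1 (leqnn _) a0n.
  move=> qr; case: eqP => [E|NE]; rewrite leNgt; apply/negP => hlt.
    have [u hu _] := near_open (u := g d a0) lt0 (e := 1) ltac:(rlra) ltac:(rlra).
    pose v := Num.min u (along d q).
    have hv : g d a0 < v < g d a0.+1.
      by rewrite /v lt_min gt_min; rewrite -E in hlt; rlra.
    have := @segment_interval _ T rho P q v Sr Pr qr; rewrite -hr along_pt => /(_ _) K.
    have := noq _ (K _); rewrite along_pt; apply => //.
    by rewrite -E /v ge_min lexx orbT andbT; move: hv; rewrite -/v; rlra.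
  have Ei : i = a0.+1 by move: NE; rewrite /i; nlia.
  have [u hu _] := near_open (u := g d a0.+1) lt0 (e := 1) ltac:(rlra) ltac:(rlra).
  pose v := Num.max u (along d q).
  have hv : g d a0 < v < g d a0.+1.
    by rewrite /v lt_max gt_max; rewrite Ei in hlt; rlra.
  have := @segment_interval _ T rho q P v Sr qr Pr; rewrite -hr along_pt => /(_ _) K.
  have := noq _ (K _); rewrite along_pt; apply => //.
  by rewrite Ei /v le_max lexx orbT /=; move: hv; rewrite -/v; rlra.
have Pfr : frontier (domain T) P.
  apply/frontier_domainP; split; first by exists c1 => //; exact: (esub _ Pe).1.
  move=> /interior_cov K; apply: nocov; apply: K; first by rewrite ingrid_pt a0n.
  apply: (@allbP _ d); rewrite !(along_pt, cross_pt).
    by rewrite !grid_leE //; rewrite /i; nlia.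
  by rewrite !grid_leE //; rewrite /j; nlia.
have Pend : is_endpoint rho P.
  split=> //; rewrite -hr.
  have along_if q : (if d then q.1 else q.2) = along d q by [].
  case: (eqVneq a0 i) => E; [right|left] => q /side; rewrite !along_if.
    by rewrite E eqxx /P along_pt.
  by rewrite (negbTE E) /P along_pt.
have rMS : rho \in MS T by rewrite MS_maxseg.
(* [MShat] is built from cross-cuts, rays, MISs and boundary segments, so membership in [MS] is not
   enough by definition. The endpoint [P] on the frontier makes [rho] a cross-cut or a ray,
   according to whether all its endpoints lie there. *)
have rhat : rho \in MShat T.
  rewrite !inE -!(orbA, andbA).
  have [H|/existsNP[q /not_implyP[q1 q2]]] := pselect (forall q, is_endpoint rho q -> frontier (domain T) q).
    by move: rMS; rewrite inE => ->; rewrite (asboolT H).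
  move: rMS; rewrite inE => ->; rewrite [X in _ || (X || _)]asboolT ?orbT //.
  by split; [exists P|exists q].
have r2hat : rho2 \in MShat T.
  by rewrite inE BMS_maxseg M2 orbT.
have E := no_collinear Pv rhat r2hat (etrans (esym hr) hr2) Pr Pr2.
have := fintype.subsetP si _ er; rewrite E in er.
by have := fintype.subsetP sb _ er; rewrite finset.in_setC => /negP.
Qed.

(** If one cell covers the three squares, it covers the fourth, being a product of intervals.
    Otherwise two neighbours among the three lie in different cells, and the corner is excluded in
    the direction of the line between them. *)
Lemma cov_corner d a0 a1 b0 b1 :
  (a0 = a1.+1 \/ a1 = a0.+1) -> (b0 = b1.+1 \/ b1 = b0.+1) ->
  (a0 < n d)%N -> (a1 < n d)%N -> (b0 < n (~~ d))%N -> (b1 < n (~~ d))%N ->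
  cov (pt d a1 b0) -> cov (pt d a1 b1) -> cov (pt d a0 b1) -> cov (pt d a0 b0).
Proof.
move=> ha hb a0n a1n b0n b1n [c1 hc1 i1] [c2 hc2 i2] [c3 hc3 i3].
have [E12|ne] := eqVneq c1 c2; last first.
  by apply: (@reentrant_absurd d a0 a1 b0 b1 c1 c2) => //; exists c3.
have [E23|ne] := eqVneq c3 c2.
  subst c1 c3; exists c2 => //; move: i1 i3; rewrite !incell_pt.
  by move=> /andP[_ ->] /andP[-> _].
rewrite -ptN; apply: (@reentrant_absurd (~~ d) b0 b1 a0 a1 c3 c2) => //; rewrite ?negbK ?ptN //.
by exists c1.
Qed.

End Reentrant.

Section FullGrid.
Context {R : realType} (T : tmesh R) (hT : is_tmesh T) (hred : reduced T).
Implicit Types (p q : R * R) (c : rect R) (e : seg R) (d : bool) (k l h : nat * nat).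
Local Notation g := (grid T).
Local Notation n := (ngrid T).
Local Notation cov := (cov T).

Lemma crd_cellP a d : a \in crd T d -> exists2 c, c \in cells T & cmin d c <= a <= cmax d c.
Proof.
have E d' e p : e \in edges T -> on_seg e p -> exists2 c, c \in cells T & cmin d' c <= along d' p <= cmax d' c.
  case: hT => _ [_ H _] _ _ /H{}H /H[c hc /frontier_rectP[/rect_ptsP/(_ d') ? _]].
  by exists c.
rewrite mem_sort mem_undup mem_cat => /orP[] /flatten_mapP[].
  by move=> c hc; have := cell_lt hT d hc; rewrite !inE => ? /orP[] /eqP->; exists c => //; lra.
move=> e he; case: hT => _ [/(_ _ he) lh _ _] _ _.
have on u : lo e <= u <= hi e -> on_seg e (pt (horiz e) u (cor e)).
  by rewrite on_segE cross_pt along_pt eqxx.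
have [<-|ne] := eqVneq (horiz e) d; rewrite !inE.
  move=> /orP[] /eqP->.
    by have /(E (horiz e) _ _ he) := on (lo e) ltac:(lra); rewrite along_pt.
  by have /(E (horiz e) _ _ he) := on (hi e) ltac:(lra); rewrite along_pt.
have -> : d = ~~ horiz e by move: ne; case: (horiz e) (d) => -[].
by move=> /eqP->; have /(E (~~ horiz e) _ _ he) := on (lo e) ltac:(lra); rewrite cross_pt.
Qed.

Definition inbox l h k := forall d, (along d l <= along d k < along d h)%N.
Definition goodbox l h := (forall d, (along d l < along d h <= n d)%N) /\
  (forall k, inbox l h k -> cov k).

Lemma inbox_pt l h d a b : (along d l <= a < along d h)%N ->
  (along (~~ d) l <= b < along (~~ d) h)%N -> inbox l h (pt d a b).
Proof. by move=> ha hb; apply: (@allbP _ d); rewrite ?along_pt ?cross_pt. Qed.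

(** The box is full up to the strip, so [cov_corner] passes coverage from a square of the strip to
    its neighbours along the side of the box. *)
Lemma strip_cov l h d a0 a1 b b' : goodbox l h -> (a0 = a1.+1 \/ a1 = a0.+1) ->
  (along d l <= a1 < along d h)%N -> (a0 < n d)%N ->
  (along (~~ d) l <= b < along (~~ d) h)%N -> (along (~~ d) l <= b' < along (~~ d) h)%N ->
  cov (pt d a0 b) -> cov (pt d a0 b').
Proof.
move=> [hb H] adj ha1 ha0 hbb hbb' C.
have hd := hb d; have hd' := hb (~~ d).
have step x y : (x = y.+1 \/ y = x.+1) -> (along (~~ d) l <= x < along (~~ d) h)%N ->
   (along (~~ d) l <= y < along (~~ d) h)%N -> cov (pt d a0 y) -> cov (pt d a0 x).
  move=> adj' hx hy; apply: (cov_corner hT hred adj adj'); rewrite //; try nlia.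
    by apply/H/inbox_pt.
  by apply/H/inbox_pt.
have up t : (b + t < along (~~ d) h)%N -> cov (pt d a0 (b + t)%N).
  elim: t => [|t IH] ht; first by rewrite addn0.
  rewrite addnS; apply: (step _ (b + t)%N); [by left|nlia|nlia|apply: IH; nlia].
have down t : (along (~~ d) l <= b - t)%N -> cov (pt d a0 (b - t)%N).
  elim: t => [|t IH] ht; first by rewrite subn0.
  have [E|E] : (b - t.+1 = b - t)%N \/ (b - t = (b - t.+1).+1)%N by nlia.
    by rewrite E; apply: IH; nlia.
  apply: (step _ (b - t)%N); [by right|nlia|nlia|apply: IH; nlia].
have [le|lt] := leqP b b'.
  by rewrite -(subnKC le); apply: up; nlia.
by rewrite -(subKn (ltnW lt)); apply: down; nlia.
Qed.

(** Half the perimeter: it grows when a strip is added along any side. *)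
Definition boxsize l h := ((h.1 - l.1) + (h.2 - l.2))%N.
Lemma boxsizeE d l h : boxsize l h = ((along d h - along d l) + (along (~~ d) h - along (~~ d) l))%N.
Proof. by rewrite /boxsize; case: d; rewrite //= addnC. Qed.

Lemma maxbox_exists : exists l h, goodbox l h /\
  forall l' h', goodbox l' h' -> (boxsize l' h' <= boxsize l h)%N.
Proof.
pose Q s := `[< exists l h, goodbox l h /\ boxsize l h = s >].
have exQ : exists s, Q s.
  case: hT => -[_ _ [[p [c hc _]] _ _] _] _ _ _.
  have K d : exists ab : nat * nat, [/\ (ab.1 < ab.2 <= n d)%N, cmin d c = g d ab.1 & cmax d c = g d ab.2].
    have /andP[/crd_grid[i0 h0 E0] /crd_grid[i1 h1 E1]] := crd_cell d hc.
    exists (i0, i1); split=> //=; rewrite h1 andbT -(@grid_ltE _ T d) //.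
    by rewrite -E0 -E1; exact: (cell_lt hT d hc).
  have [x1 [h1 l1 u1]] := K true; have [x2 [h2 l2 u2]] := K false.
  exists (boxsize (x1.1, x2.1) (x1.2, x2.2)); apply/asboolP.
  exists (x1.1, x2.1), (x1.2, x2.2); split=> //; split.
    by case.
  move=> k hk.
  exists c => //; apply/incellP => d; have := hk d; rewrite /grid_spans.
  by case: d => hk'; rewrite ?l1 ?u1 ?l2 ?u2 !grid_leE; move: hk'; rewrite /along /=; clear -h1 h2; nlia.
have Qle s : Q s -> (s <= n true + n false)%N.
  move=> /asboolP[l [h [[H _] <-]]]; have := H true; have := H false; rewrite /boxsize /=; lia.
case: (ex_maxnP exQ Qle) => s /asboolP[l [h [G E]]] M.
by exists l, h; split=> // l' h' G'; rewrite E; apply: M; apply/asboolP; exists l', h'.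
Qed.

(** A single covered square beside the box would fill the whole strip, and the box enlarged by the
    strip would beat the maximum. *)
Lemma maxbox_side l h d a0 b : goodbox l h ->
  (forall l' h', goodbox l' h' -> (boxsize l' h' <= boxsize l h)%N) ->
  (a0 = along d h \/ a0.+1 = along d l) -> (a0 < n d)%N ->
  (along (~~ d) l <= b < along (~~ d) h)%N -> ~ cov (pt d a0 b).
Proof.
move=> G M ha0 a0n hb C; have [G1 G2] := G.
have hd := G1 d; have hd' := G1 (~~ d).
have S b' : (along (~~ d) l <= b' < along (~~ d) h)%N -> cov (pt d a0 b').
  move=> hb'; case: ha0 => E.
    by apply: (@strip_cov l h d a0 (along d h).-1 b b' G) => //; [left|]; nlia.
  by apply: (@strip_cov l h d a0 (along d l) b b' G) => //; [right|]; nlia.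
have ext l' h' : along (~~ d) l' = along (~~ d) l -> along (~~ d) h' = along (~~ d) h ->
    (along d l' < along d h' <= n d)%N -> (forall a, (along d l' <= a < along d h')%N ->
      (along d l <= a < along d h)%N \/ a = a0) -> goodbox l' h'.
  move=> El Eh hd1 Ha; split=> [|k hk].
    by apply: (@allbP _ d) => //; rewrite El Eh.
  have := hk (~~ d); rewrite El Eh => hk'; have [ka|ka] := Ha _ (hk d).
    by apply: G2; apply: (@allbP _ d).
  by rewrite -(pt_along d k) ka; exact: S.
case: ha0 => E.
  have /M : goodbox l (pt d a0.+1 (along (~~ d) h)).
    apply: ext; rewrite ?cross_pt ?along_pt //; first by nlia.
    by move=> a; nlia.
  rewrite !(boxsizeE d) cross_pt along_pt; nlia.
have /M : goodbox (pt d a0 (along (~~ d) l)) h.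
  apply: ext; rewrite ?cross_pt ?along_pt //; first by nlia.
  by move=> a; nlia.
rewrite !(boxsizeE d) cross_pt along_pt; nlia.
Qed.

Lemma index_in_box l h d u : (along d l < along d h <= n d)%N ->
  g d (along d l) <= u <= g d (along d h) ->
  exists2 b, (along d l <= b < along d h)%N & g d b <= u <= g d b.+1.
Proof.
set x := along d l; set y := along d h => hxy /andP[h0 h1].
have [lt|ge] := ltP u (g d y).
  have [|b hb /andP[b1 b2]] := @grid_floor _ T d u.
    rewrite (lt_le_trans lt) ?grid_leE // ?andbT; try nlia.
    by apply: (le_trans _ h0); rewrite grid_leE; nlia.
  exists b; last by rewrite b1 ltW.
  apply/andP; split.
    by rewrite -ltnS -(@grid_ltE _ T d); [exact: le_lt_trans h0 b2|nlia|nlia].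
  by rewrite -(@grid_ltE _ T d); [exact: le_lt_trans b1 lt|nlia|nlia].
have yp : (y.-1.+1 = y)%N by nlia.
exists y.-1; first by nlia.
by rewrite yp h1 andbT (le_trans _ ge) // grid_leE; nlia.
Qed.

(** The interior of a largest fully covered box is open and closed in the interior of the domain.
    Connectedness identifies the two interiors; hence all cells lie in the box, and the extreme grid
    lines, which meet cells, are its sides. *)
Lemma full_cov k : ingrid T k -> cov k.
Proof.
have [l [h [G M]]] := maxbox_exists; have [G1 G2] := G.
pose c0 := Rect (g true l.1) (g true h.1) (g false l.2) (g false h.2).
have c0l d : cmin d c0 = g d (along d l) by case: d.
have c0h d : cmax d c0 = g d (along d h) by case: d.
have sub : rect_pts c0 `<=` domain T.
  move=> p /rect_ptsP hp.
  have K d : exists2 b, (along d l <= b < along d h)%N & g d b <= along d p <= g d b.+1.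
    by apply: index_in_box => //; rewrite -c0l -c0h; exact: hp.
  have [b1 h1 p1] := K true; have [b2 h2 p2] := K false.
  have [c hc /incellP Hc] : cov (b1, b2) by apply: G2 => -[].
  exists c => //; apply/rect_ptsP => d; have := Hc d; rewrite /grid_spans.
  by case: d => /= ?; lra.
(* At an interior point of the domain on a side of the box, the square beyond that side would be
   covered, against [maxbox_side]. *)
have clopen p : interior (domain T) p -> rect_pts c0 p -> interior (rect_pts c0) p.
  move=> ip /rect_ptsP hp; apply/interior_rectP => d; have := hp d; rewrite c0l c0h => hpd.
  have [b hb pb] := index_in_box (G1 (~~ d)) (u := along (~~ d) p) ltac:(by rewrite -c0l -c0h; exact: hp).
  have bn : (b < n (~~ d))%N by have := G1 (~~ d); clear -hb; lia.
  have /andP[ps0 ps1] := interior_strict d ip.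
  have /andP[gl gn] := G1 d.
  rewrite !lt_neqAle; case/andP: hpd => -> ->; rewrite !andbT; apply/andP; split; apply/negP => /eqP E.
    have l0 : (0 < along d l)%N by rewrite -(@grid_ltE _ T d) // ?E //; nlia.
    apply: (@maxbox_side l h d (along d l).-1 b G M _ _ hb); [right; nlia|nlia|].
    apply: (interior_cov ip); first by rewrite ingrid_pt bn; nlia.
    apply: (@allbP _ d); rewrite ?along_pt ?cross_pt //.
    by rewrite prednK // -E lexx andbT grid_leE; nlia.
  have hn : (along d h < n d)%N by rewrite -(@grid_ltE _ T d) // -?E //; nlia.
  apply: (@maxbox_side l h d (along d h) b G M _ hn hb); [by left|].
  apply: (interior_cov ip); first by rewrite ingrid_pt bn hn.
  apply: (@allbP _ d); rewrite ?along_pt ?cross_pt //.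
  by rewrite E lexx /= grid_leE; nlia.
have QE : interior (rect_pts c0) = interior (domain T).
  case: (hT) => -[_ _ _ conn] _ _ _; apply: conn.
  - exists (mid T true l.1, mid T false l.2); apply/interior_rectP => d; rewrite c0l c0h.
    have /andP[lh hn] := G1 d.
    have hm : (along d l < n d)%N by nlia.
    have := mid_open hm; have : g d (along d l).+1 <= g d (along d h) by rewrite grid_leE //; nlia.
    by case: d {lh hn hm} => /=; lra.
  - exists (interior (rect_pts c0)); first exact: open_interior.
    apply/seteqP; split=> p; last by case.
    by move=> Hp; split=> //; exact: (interiorS sub).
  exists (rect_pts c0); first exact: closed_rect.
  apply/seteqP; split=> p; first by move=> Hp; split; [exact: (interiorS sub)|exact: interior_subset].
  by case=> ip; exact: clopen.
have bound d c : c \in cells T -> g d (along d l) <= cmin d c /\ cmax d c <= g d (along d h).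
  move=> hc.
  have /andP[/crd_grid[i0 h0 E0] /crd_grid[i1 h1 E1]] := crd_cell d hc.
  have lt := cell_lt hT d hc; have i01 : (i0 < i1)%N by rewrite -(@grid_ltE _ T d) // -E0 -E1.
  have lt' := cell_lt hT (~~ d) hc.
  have K u : cmin d c < u < cmax d c -> g d (along d l) < u < g d (along d h).
    move=> hu; have : interior (domain T) (pt d u ((cmin (~~ d) c + cmax (~~ d) c) / 2)).
      have S : rect_pts c `<=` domain T by move=> p hp; exists c.
      apply: (interiorS S); apply/interior_rectP; apply: (@allbP _ d); rewrite ?along_pt ?cross_pt //.
      by lra.
    by rewrite -QE => /interior_rectP/(_ d); rewrite along_pt c0l c0h.
  split; rewrite leNgt; apply/negP => hlt.
    have := K ((cmin d c + Num.min (g d (along d l)) (cmax d c)) / 2).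
    by case: (lerP (g d (along d l)) (cmax d c)) => ? /(_ ltac:(rlra)); rlra.
  have := K ((cmax d c + Num.max (g d (along d h)) (cmin d c)) / 2).
  by case: (lerP (g d (along d h)) (cmin d c)) => ? /(_ ltac:(rlra)); rlra.
have full d : along d l = 0%N /\ along d h = n d.
  have /andP[lh hn] := G1 d.
  have mem i : (i <= n d)%N -> g d i \in crd T d.
    by move=> hi; apply: mem_nth; move: hi lh hn; rewrite /ngrid; case: size => //; nlia.
  have [c hc h0] := crd_cellP (mem 0%N (leq0n _)); have [c' hc' h1] := crd_cellP (mem _ (leqnn _)).
  have [b1 _] := bound d c hc; have [_ b2] := bound d c' hc'.
  split.
    apply/eqP; rewrite -leqn0 -(@grid_leE _ T d) //; last by nlia.
    by rlra.
  apply/eqP; rewrite eqn_leq hn -(@grid_leE _ T d) //.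
  by rlra.
move=> /ingridP hk; apply: G2 => d; have [-> ->] := full d.
exact: hk.
Qed.

End FullGrid.

(** * Maximal segments on the grid *)

Section Lines.
Context {R : realType} (T : tmesh R).
Implicit Types (p q : R * R) (c : rect R) (d : bool) (k : nat * nat) (rho eta : {set edges T}).
Local Notation g := (grid T).
Local Notation n := (ngrid T).
Local Notation ecov := (edge_covers T).
Local Notation incell := (incell T).

(** Formulated by cells because a spline cannot jump inside a cell; [sep_edge] and [edge_sep] show
    that it holds exactly where an edge covers the grid interval. It is meaningful for [j > 0] only,
    since [j.-1] is truncated. *)
Definition sep d a j : bool :=
  ~~ [exists c : cells T, incell (val c) (pt d a j.-1) && incell (val c) (pt d a j)].

(* The maximal segment rho occupies the grid indices lo, ..., hi of the line j. *)
Definition ms_at rho (t : nat * nat * nat) : Prop :=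
  let: (i0, i1, j) := t in let d := horizontal rho in
  [/\ (i0 < i1 <= n d)%N && (0 < j < n (~~ d))%N, coordinate rho = g (~~ d) j,
      forall p, on_segment p rho =
        (along (~~ d) p == g (~~ d) j) && (g d i0 <= along d p <= g d i1),
      forall e : edges T, e \in rho <-> [/\ horiz (val e) = d, cor (val e) = g (~~ d) j &
        exists2 a, (i0 <= a < i1)%N & ecov (val e) a] &
      (forall a, (i0 <= a < i1)%N -> sep d a j) /\
      ((0 < i0)%N -> ~~ sep d i0.-1 j) /\ ((i1 < n d)%N -> ~~ sep d i1 j)].

Definition ms_ix rho := xget (0, 0, 0)%N [set t | ms_at rho t].
Definition ms_lo rho : nat := (ms_ix rho).1.1.
Definition ms_hi rho : nat := (ms_ix rho).1.2.
Definition ms_line rho : nat := (ms_ix rho).2.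

Hypotheses (hT : is_tmesh T) (hred : reduced T).

Lemma ngrid_gt0 d : (0 < n d)%N.
Proof.
case: (hT) => -[_ _ [[p [c hc _]] _ _] _] _ _ _.
have /andP[/crd_grid[i0 h0 E0] /crd_grid[i1 h1 E1]] := crd_cell d hc.
have := cell_lt hT d hc; rewrite E0 E1 grid_ltE //; nlia.
Qed.

Lemma domainP p : domain T p <-> forall d, g d 0%N <= along d p <= g d (n d).
Proof.
split=> [hp d|hp]; first exact: domain_range.
have K d : exists2 b, (0 <= b < n d)%N & g d b <= along d p <= g d b.+1.
  have := @index_in_box R T (0, 0)%N (n true, n false) d (along d p).
  by case: d => /=; apply; rewrite ?leqnn ?ngrid_gt0 //; exact: hp.
have [b1 h1 p1] := K true; have [b2 h2 p2] := K false.
have [|c hc /incellP Hc] := full_cov hT hred (k := (b1, b2)).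
  by apply/andP; split => /=; nlia.
exists c => //; apply/rect_ptsP => d; have := Hc d; rewrite /grid_spans.
by case: d => /= ?; lra.
Qed.

Lemma interior_domainP p :
  interior (domain T) p <-> forall d, g d 0%N < along d p < g d (n d).
Proof.
split=> [hp d|hp]; first exact: interior_strict.
pose c0 := Rect (g true 0%N) (g true (n true)) (g false 0%N) (g false (n false)).
have c0l d : cmin d c0 = g d 0%N by case: d.
have c0h d : cmax d c0 = g d (n d) by case: d.
have sub : rect_pts c0 `<=` domain T.
  by move=> q /rect_ptsP hq; apply/domainP => d; rewrite -c0l -c0h.
by apply: (interiorS sub); apply/interior_rectP => d; rewrite c0l c0h.
Qed.

Lemma cell_at k : ingrid T k -> exists c : cells T, incell (val c) k.
Proof. by move=> /(full_cov hT hred)[c hc Hc]; exists [` hc]%fset. Qed.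

Lemma sep_cells d a j (c c' : cells T) : (a < n d)%N -> (0 < j < n (~~ d))%N ->
  incell (val c) (pt d a j.-1) -> incell (val c') (pt d a j) -> sep d a j = (c != c').
Proof.
move=> ha hj H H'; rewrite /sep; congr (~~ _); apply/existsP/eqP => [[c2 /andP[h h']]|E].
  apply: val_inj; have -> : val c = val c2.
    by apply: (cell_uniq hT (fsvalP c) (fsvalP c2) _ H h); rewrite ingrid_pt ha /=; nlia.
  by apply: (cell_uniq hT (fsvalP c2) (fsvalP c') _ h' H'); rewrite ingrid_pt ha /=; nlia.
by exists c; rewrite H E H'.
Qed.

Lemma sep_edge d a j : (a < n d)%N -> (0 < j < n (~~ d))%N -> sep d a j ->
  exists (c c' : cells T) (e : edges T), [/\ c != c', incell (val c) (pt d a j.-1), incell (val c') (pt d a j) &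
   [/\ horiz (val e) = d, cor (val e) = g (~~ d) j, ecov (val e) a &
      forall p, on_seg (val e) p -> rect_pts (val c) p /\ rect_pts (val c') p]].
Proof.
move=> ha hj hs.
have [|c hc] := cell_at (k := pt d a j.-1); first by rewrite ingrid_pt ha /=; nlia.
have [|c' hc'] := cell_at (k := pt d a j); first by rewrite ingrid_pt ha /=; nlia.
have ne : c != c' by rewrite -(sep_cells ha hj hc hc').
have ne' : val c != val c' by rewrite (inj_eq val_inj).
move: (hc) (hc'); rewrite !incell_pt => /andP[s t] /andP[s' t'].
have jp : (j.-1.+1 = j)%N by nlia.
have g1 : g (~~ d) j.-1 < g (~~ d) j by apply: grid_lt; nlia.
have g2 : g (~~ d) j < g (~~ d) j.+1 by apply: grid_lt; nlia.
have [e he [h1 h2 h3 h4]] := pair_cover (v := g (~~ d) j) hT (fsvalP c) (fsvalP c') ne' ha s s'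
  ltac:(move: t; rewrite /grid_spans jp; rlra) ltac:(move: t'; rewrite /grid_spans; rlra).
by exists c, c', [` he]%fset.
Qed.

Lemma edge_sep (e : edges T) a j : (a < n (horiz (val e)))%N -> (0 < j < n (~~ horiz (val e)))%N ->
  cor (val e) = g (~~ horiz (val e)) j -> ecov (val e) a -> sep (horiz (val e)) a j.
Proof.
set d := horiz _ => ha hj Ej eca.
have [|c hc] := cell_at (k := pt d a j.-1); first by rewrite ingrid_pt ha /=; nlia.
have [|c' hc'] := cell_at (k := pt d a j); first by rewrite ingrid_pt ha /=; nlia.
rewrite (sep_cells ha hj hc hc'); apply/negP => /eqP E; subst c'.
move: hc hc'; rewrite !incell_pt => /andP[s t] /andP[_ t'].
have jp : (j.-1.+1 = j)%N by nlia.
have [c2 hc2 [s2 Hc2]] := edge_cell hT (fsvalP e) ha eca.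
have lt2 := cell_lt hT (~~ d) hc2.
have g1 : g (~~ d) j.-1 < g (~~ d) j by apply: grid_lt; nlia.
have g2 : g (~~ d) j < g (~~ d) j.+1 by apply: grid_lt; nlia.
suff E : c2 = val c.
  subst c2; move: Hc2 t t'; rewrite -/d Ej /grid_spans jp => -[] <-; clear -g1 g2; lra.
case: Hc2; rewrite -/d Ej => E.
  apply: (cell_uniq hT hc2 (fsvalP c) (k := pt d a j)); rewrite ?ingrid_pt ?incell_pt ?ha ?s ?t' ?s2 //=; try nlia.
  by apply: spans_lt; rewrite ?E //; nlia.
apply: (cell_uniq hT hc2 (fsvalP c) (k := pt d a j.-1)); rewrite ?ingrid_pt ?incell_pt ?ha ?s ?t ?s2 //=; try nlia.
by apply: spans_gt; rewrite ?E //; rewrite -?E //; nlia.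
Qed.

(** As the domain is a rectangle, boundary edges lie only on the outermost grid lines and interior
    edges only off them. *)
Lemma interior_edge_line (e : edges T) : e \in interior_edges T <->
  exists2 j, (0 < j < n (~~ horiz (val e)))%N & cor (val e) = g (~~ horiz (val e)) j.
Proof.
split=> [/interior_edgeP[q q1 q2]|[j hj Ej]].
  by have [j [? ? _]] := interior_edge_cells hT (fsvalP e) q1 q2; exists j.
have [i0 [i1 [/andP[lt01 hi1] E0 E1 _]]] := edge_range hT (fsvalP e).
set d := horiz (val e) in hj Ej lt01 hi1 E0 E1 *.
have lt := @grid_lt _ T d i0 i1 lt01 hi1.
apply/interior_edgeP; exists (pt d ((lo (val e) + hi (val e)) / 2) (cor (val e))).
  by rewrite on_segE cross_pt along_pt eqxx /= E0 E1; rlra.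
apply/interior_domainP; apply: (@allbP _ d); rewrite ?along_pt ?cross_pt.
  have : g d 0%N <= g d i0 by rewrite grid_leE //; nlia.
  have : g d i1 <= g d (n d) by rewrite grid_leE //; nlia.
  by rewrite E0 E1; rlra.
by rewrite Ej !grid_ltE //; nlia.
Qed.

(** The ends of [rho] are the least [lo] and the greatest [hi] of its edges. Connectedness fills the
    stretch between them, and maximality excludes an edge directly beyond either end. *)
Lemma ms_at_exists rho : rho \in MS T -> exists t, ms_at rho t.
Proof.
move=> M; have := M; rewrite MS_maxseg => Mx; have [S sI] := maxsegP Mx.
set d := horizontal rho.
have [e0 er0] : exists e0, e0 \in rho by case: (S) => /finset.set0Pn.
have [h0 c0] := segment_dir S er0.
have /interior_edge_line[j hj Ej] := fintype.subsetP sI _ er0.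
rewrite h0 -/d in hj Ej.
case: (@Order.TotalTheory.arg_minP _ _ _ e0 [in rho] (fun e => lo (val e)) er0) => em emr hm'.
case: (@Order.TotalTheory.arg_maxP _ _ _ e0 [in rho] (fun e => hi (val e)) er0) => eM eMr hM'.
have hm e : e \in rho -> lo (val em) <= lo (val e) by exact: hm'.
have hM e : e \in rho -> hi (val e) <= hi (val eM) by exact: hM'.
have dir e : e \in rho -> horiz (val e) = d /\ cor (val e) = g (~~ d) j.
  by move=> er; have [-> ->] := segment_dir S er; rewrite -c0.
have rng e : e \in rho -> exists i0 i1, [/\ (i0 < i1 <= n d)%N, lo (val e) = g d i0, hi (val e) = g d i1 &
    forall a, (a < n d)%N -> ecov (val e) a = (i0 <= a < i1)%N].
  by move=> er; have := edge_range hT (fsvalP e); have [-> _] := dir e er.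
have [i0 [x0 [hx0 E0 E0' _]]] := rng em emr.
have [x1 [i1 [hx1 E1' E1 _]]] := rng eM eMr.
have lt01 : (i0 < i1)%N.
  rewrite -(@grid_ltE _ T d); try nlia.
  have := hM em emr; rewrite E0' E1; have : g d i0 < g d x0 by apply: grid_lt; nlia.
  by rlra.
have onP p : on_segment p rho = (along (~~ d) p == g (~~ d) j) && (g d i0 <= along d p <= g d i1).
  apply/idP/andP => [pr|[/eqP pc pa]].
    split; first by rewrite (segment_line S pr) -c0 Ej.
    have /on_segmentP[e er] := pr; have [he ce] := dir e er.
    rewrite on_segE he => /andP[_]; have := hm e er; have := hM e er; rewrite E0 E1; rlra.
  rewrite -(pt_along d p) pc -Ej c0; apply: (@segment_interval _ T rho
    (pt d (g d i0) (g (~~ d) j)) (pt d (g d i1) (g (~~ d) j))) => //.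
  - apply/on_segmentP; exists em => //; have [he ce] := dir em emr.
    rewrite on_segE he cross_pt along_pt ce eqxx E0 E0' lexx /= grid_leE; nlia.
  - apply/on_segmentP; exists eM => //; have [he ce] := dir eM eMr.
    rewrite on_segE he cross_pt along_pt ce eqxx E1 E1' lexx andbT /= grid_leE; nlia.
  - by rewrite !along_pt.
have memP e : e \in rho <-> [/\ horiz (val e) = d, cor (val e) = g (~~ d) j &
        exists2 a, (i0 <= a < i1)%N & ecov (val e) a].
  split=> [er|[he ce [a ha eca]]].
    have [he ce] := dir e er; have [y0 [y1 [hy F0 F1 Fc]]] := rng e er.
    split=> //; exists y0; last by rewrite Fc; nlia.
    have := hm e er; have := hM e er; rewrite E0 E1 F0 F1 !grid_leE //; try nlia.
  have an : (a < n d)%N by nlia.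
  have hma := mid_open an.
  apply: (maxseg_absorb Mx (p := pt d (mid T d a) (g (~~ d) j))) => //.
  - by apply/interior_edge_line; exists j; rewrite he.
  - by rewrite ce -c0 Ej.
  - by have := @mid_on_edge _ T (val e) a; rewrite he ce; apply.
  rewrite onP cross_pt along_pt eqxx /=.
  have : g d i0 <= g d a by rewrite grid_leE; nlia.
  have : g d a.+1 <= g d i1 by rewrite grid_leE; nlia.
  by rlra.
have far a (e : edges T) : (a < n d)%N -> horiz (val e) = d -> ecov (val e) a ->
    cor (val e) = g (~~ d) j -> (a.+1 = i0 \/ a = i1) -> False.
  move=> an he eca ce ai.
  have lta : g d a < g d a.+1 by apply: grid_lt.
  have er : e \in rho.
    have hlt : g d i0 <= g d i1 by rewrite grid_leE; nlia.
    move: (eca); rewrite /edge_covers he => eca'.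
    case: ai => E.
      apply: (maxseg_absorb Mx (p := pt d (g d i0) (g (~~ d) j))) => //.
      - by apply/interior_edge_line; exists j; rewrite he.
      - by rewrite ce -c0 Ej.
      - by rewrite on_segE he cross_pt along_pt ce eqxx /= -E; rlra.
      - by rewrite onP cross_pt along_pt eqxx lexx.
    apply: (maxseg_absorb Mx (p := pt d (g d i1) (g (~~ d) j))) => //.
    - by apply/interior_edge_line; exists j; rewrite he.
    - by rewrite ce -c0 Ej.
    - by rewrite on_segE he cross_pt along_pt ce eqxx /= -E; rlra.
    - by rewrite onP cross_pt along_pt eqxx lexx andbT.
  move: eca; rewrite /edge_covers he => eca'.
  have := hm e er; have := hM e er; rewrite E0 E1.
  by case: ai => E; subst; rlra.
exists (i0, i1, j); rewrite /ms_at -/d; split=> //.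
- by rewrite lt01 hj andbT; nlia.
- by rewrite -c0 Ej.
split; last split.
- move=> a ha; have an : (a < n d)%N by nlia.
  have hma := mid_open an.
  have : on_segment (pt d (mid T d a) (g (~~ d) j)) rho.
    rewrite onP cross_pt along_pt eqxx /=.
    have : g d i0 <= g d a by rewrite grid_leE; nlia.
    have : g d a.+1 <= g d i1 by rewrite grid_leE; nlia.
    by rlra.
  move=> /on_segmentP[e er ep]; have [he ce] := dir e er.
  have [|_ _ eca] := edge_open (d := d) (fsvalP e) ep an; first by rewrite along_pt.
  by have := @edge_sep e a j; rewrite he; apply.
- move=> i0p; apply/negP => hs.
  have [||c [c' [e [_ _ _ [he ce eca _]]]]] := sep_edge _ _ hs; try nlia.
  by apply: (far i0.-1 e) => //; [|left]; nlia.
- move=> i1n; apply/negP => hs.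
  have [||c [c' [e [_ _ _ [he ce eca _]]]]] := sep_edge _ _ hs; try nlia.
  by apply: (far i1 e) => //; right.
Qed.

Lemma ms_atP rho : rho \in MS T -> ms_at rho (ms_lo rho, ms_hi rho, ms_line rho).
Proof.
move=> /ms_at_exists[t Ht]; rewrite /ms_lo /ms_hi /ms_line -!surjective_pairing.
exact: (@xgetPex _ _ [set t | ms_at rho t] (ex_intro _ t Ht)).
Qed.

Lemma ms_range rho : rho \in MS T -> (ms_lo rho < ms_hi rho <= n (horizontal rho))%N /\
  (0 < ms_line rho < n (~~ horizontal rho))%N.
Proof. by move=> /ms_atP[/andP[]]. Qed.

Lemma ms_coordinate rho : rho \in MS T -> coordinate rho = g (~~ horizontal rho) (ms_line rho).
Proof. by move=> /ms_atP[]. Qed.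

Lemma ms_on rho p : rho \in MS T -> on_segment p rho =
  (along (~~ horizontal rho) p == g (~~ horizontal rho) (ms_line rho)) &&
  (g (horizontal rho) (ms_lo rho) <= along (horizontal rho) p <= g (horizontal rho) (ms_hi rho)).
Proof. by move=> /ms_atP[]. Qed.

Lemma ms_mem rho (e : edges T) : rho \in MS T -> e \in rho <->
  [/\ horiz (val e) = horizontal rho, cor (val e) = g (~~ horizontal rho) (ms_line rho) &
    exists2 a, (ms_lo rho <= a < ms_hi rho)%N & ecov (val e) a].
Proof. by move=> /ms_atP[]. Qed.

Lemma ms_sep rho a : rho \in MS T -> (ms_lo rho <= a < ms_hi rho)%N ->
  sep (horizontal rho) a (ms_line rho).
Proof. by move=> /ms_atP[_ _ _ _ [H _]]; exact: H. Qed.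

Lemma ms_sep_lo rho : rho \in MS T -> (0 < ms_lo rho)%N ->
  ~~ sep (horizontal rho) (ms_lo rho).-1 (ms_line rho).
Proof. by move=> /ms_atP[_ _ _ _ [_ [H _]]]. Qed.

Lemma ms_sep_hi rho : rho \in MS T -> (ms_hi rho < n (horizontal rho))%N ->
  ~~ sep (horizontal rho) (ms_hi rho) (ms_line rho).
Proof. by move=> /ms_atP[_ _ _ _ [_ [_ H]]]. Qed.

(** If the ranges differed, one segment would end at a place still inside the range of the other:
    the first denies separation there and the second demands it. *)
Lemma ms_eq rho eta i : rho \in MS T -> eta \in MS T -> horizontal rho = horizontal eta ->
  ms_line rho = ms_line eta -> (ms_lo rho <= i <= ms_hi rho)%N ->
  (ms_lo eta <= i <= ms_hi eta)%N -> rho = eta.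
Proof.
move=> Mr Me hd hl hr he.
have [rr _] := ms_range Mr; have [re _] := ms_range Me.
have half x y : x \in MS T -> y \in MS T -> horizontal x = horizontal y ->
    ms_line x = ms_line y -> (ms_lo x <= i <= ms_hi x)%N -> (ms_lo y <= i <= ms_hi y)%N ->
    (ms_lo y <= ms_lo x)%N /\ (ms_hi x <= ms_hi y)%N.
  move=> Mx My h l ix iy; have [rx _] := ms_range Mx; have [ry _] := ms_range My.
  split; rewrite leqNgt; apply/negP => lt.
    have /negP[] : ~~ sep (horizontal y) (ms_lo y).-1 (ms_line y) by apply: ms_sep_lo => //; nlia.
    by rewrite -h -l; apply: ms_sep => //; nlia.
  have /negP[] : ~~ sep (horizontal y) (ms_hi y) (ms_line y) by apply: ms_sep_hi => //; rewrite -h; nlia.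
  by rewrite -h -l; apply: ms_sep => //; nlia.
have [a1 a2] := half _ _ Mr Me hd hl hr he.
have [b1 b2] := half _ _ Me Mr (esym hd) (esym hl) he hr.
have E0 : ms_lo rho = ms_lo eta by apply/eqP; rewrite eqn_leq a1 b1.
have E1 : ms_hi rho = ms_hi eta by apply/eqP; rewrite eqn_leq a2 b2.
apply/finset.setP => e; apply/idP/idP => /ms_mem -/(_ _) H; apply/ms_mem => //.
  by rewrite -hd -hl -E0 -E1; exact: H.
by rewrite hd hl E0 E1; exact: H.
Qed.

Lemma ms_edge_a rho (e : edges T) a : rho \in MS T -> e \in rho -> (a < n (horizontal rho))%N ->
  ecov (val e) a -> (ms_lo rho <= a < ms_hi rho)%N.
Proof.
move=> M er an eca; have [he ce _] := (ms_mem e M).1 er.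
have hma := mid_open an.
have : on_segment (pt (horizontal rho) (mid T (horizontal rho) a) (g (~~ horizontal rho) (ms_line rho))) rho.
  by apply/on_segmentP; exists e => //; have := @mid_on_edge _ T (val e) a; rewrite he ce; apply.
rewrite ms_on // cross_pt along_pt eqxx /= => /andP[h1 h2].
have [r _] := ms_range M.
apply/andP; split.
  by rewrite -ltnS -(@grid_ltE _ T (horizontal rho)); [rlra|nlia|nlia].
by rewrite -(@grid_ltE _ T (horizontal rho)); [rlra|nlia|nlia].
Qed.

Lemma ms_of_sep d a j : (a < n d)%N -> (0 < j < n (~~ d))%N -> sep d a j ->
  exists rho, [/\ rho \in MS T, horizontal rho = d, ms_line rho = j & (ms_lo rho <= a < ms_hi rho)%N].
Proof.
move=> an hj hs; have [c [c' [e [_ _ _ [he ce eca _]]]]] := sep_edge an hj hs.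
have ei : e \in interior_edges T by apply/interior_edge_line; exists j; rewrite he.
have [rho Mx er] := maxseg_exists ei.
have M : rho \in MS T by rewrite MS_maxseg.
have [he' ce' _] := (ms_mem e M).1 er.
have hd : horizontal rho = d by rewrite -he'.
have [_ hl] := ms_range M.
exists rho; split=> //; last by apply: ms_edge_a er _ eca; rewrite ?hd.
rewrite hd in hl; rewrite hd ce in ce'.
by apply/esym/(@grid_inj _ T (~~ d)) => //; nlia.
Qed.

Definition crosses rho eta : bool := `[< pts rho `&` pts eta !=set0 >].

(** The bounds are non-strict, so a T-junction counts as a crossing. *)
Lemma crossesP rho eta : rho \in MS T -> eta \in MS T -> horizontal eta = ~~ horizontal rho ->
  crosses rho eta = (ms_lo rho <= ms_line eta <= ms_hi rho)%N && (ms_lo eta <= ms_line rho <= ms_hi eta)%N.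
Proof.
move=> Mr Me hd; have [rr lr] := ms_range Mr; have [re le] := ms_range Me.
rewrite hd negbK in re le.
apply/asboolP/andP => [[p []]|[h1 h2]].
  rewrite /pts /= ms_on // ms_on // hd negbK => /andP[/eqP c1 h1] /andP[/eqP c2 h2].
  by move: h1 h2; rewrite c1 c2 !grid_leE //; nlia.
exists (pt (horizontal rho) (g (horizontal rho) (ms_line eta)) (g (~~ horizontal rho) (ms_line rho))).
split.
  by rewrite /pts /= ms_on // cross_pt along_pt eqxx /= !grid_leE //; nlia.
by rewrite /pts /= ms_on // hd negbK along_pt cross_pt eqxx /= !grid_leE //; nlia.
Qed.

End Lines.

(** * Cross-cuts, rays and MISs read off the grid ranges *)

Section Types.
Context {R : realType} (T : tmesh R).
Implicit Types (p q : R * R) (c : rect R) (d : bool) (k : nat * nat) (rho eta : {set edges T}).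
Local Notation g := (grid T).
Local Notation n := (ngrid T).
Hypotheses (hT : is_tmesh T) (hred : reduced T).

Lemma ms_frontier rho p : rho \in MS T -> on_segment p rho -> frontier (domain T) p <->
  along (horizontal rho) p = g (horizontal rho) 0%N \/
  along (horizontal rho) p = g (horizontal rho) (n (horizontal rho)).
Proof.
move=> M; set d := horizontal rho; rewrite (ms_on hT hred p M) -/d => /andP[/eqP cp ap].
have [r1 r2] := ms_range hT hred M; rewrite -/d in r1 r2.
have h1 : g d 0%N <= g d (ms_lo rho) by rewrite grid_leE //; nlia.
have h2 : g d (ms_hi rho) <= g d (n d) by rewrite grid_leE //; nlia.
have h3 : g (~~ d) 0%N < along (~~ d) p < g (~~ d) (n (~~ d)).
  by rewrite cp !grid_ltE //; nlia.
have dp : domain T p by apply/(domainP hT hred); apply: (@allbP _ d); rlra.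
split=> [/(frontier_domainP) [_ np]|H]; last first.
  apply/frontier_domainP; split=> // /(interior_domainP hT hred)/(_ d).
  by case: H => ->; rewrite ltxx ?andbF.
apply: contrapT => /not_orP[n1 n2]; apply: np; apply/(interior_domainP hT hred).
apply: (@allbP _ d) => //.
rewrite !lt_neqAle; apply/andP; split; apply/andP; split; try (clear -ap h1 h2; lra).
  by apply/eqP => E; apply: n1.
by apply/eqP.
Qed.

Lemma ms_endpoint rho p : rho \in MS T -> is_endpoint rho p <-> on_segment p rho /\
  (along (horizontal rho) p = g (horizontal rho) (ms_lo rho) \/
   along (horizontal rho) p = g (horizontal rho) (ms_hi rho)).
Proof.
move=> M; set d := horizontal rho.
have [r1 r2] := ms_range hT hred M; rewrite -/d in r1 r2.
have E i : i = ms_lo rho \/ i = ms_hi rho ->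
    on_segment (pt d (g d i) (g (~~ d) (ms_line rho))) rho.
  move=> hi; rewrite (ms_on hT hred _ M) -/d cross_pt along_pt eqxx /= !grid_leE //;
    nlia.
rewrite /is_endpoint -/d /pts /=; split=> -[pr H]; split=> //.
  have ap : g d (ms_lo rho) <= along d p <= g d (ms_hi rho).
    by move: pr; rewrite (ms_on hT hred _ M) => /andP[].
  case: H => H.
    have := H _ (E _ (or_introl erefl)); rewrite -!/(along d _) along_pt; left.
    by apply/eqP; rewrite eq_le; apply/andP; split; [|rlra].
  have := H _ (E _ (or_intror erefl)); rewrite -!/(along d _) along_pt; right.
  by apply/eqP; rewrite eq_le; apply/andP; split; [rlra|].
case: H => H; [left|right] => q; rewrite (ms_on hT hred _ M) -/d => /andP[_ aq].
  by rewrite -!/(along d _) H; rlra.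
by rewrite -!/(along d _) H; rlra.
Qed.

Lemma ms_point rho i : rho \in MS T -> (ms_lo rho <= i <= ms_hi rho)%N ->
  on_segment (pt (horizontal rho) (g (horizontal rho) i) (g (~~ horizontal rho) (ms_line rho))) rho.
Proof.
move=> M hi; have [r1 r2] := ms_range hT hred M.
by rewrite (ms_on hT hred _ M) cross_pt along_pt eqxx /= !grid_leE //; nlia.
Qed.

Lemma ms_end_frontier rho i : rho \in MS T -> i = ms_lo rho \/ i = ms_hi rho ->
  exists p, [/\ is_endpoint rho p, along (horizontal rho) p = g (horizontal rho) i &
    frontier (domain T) p <-> i = 0%N \/ i = n (horizontal rho)].
Proof.
move=> M hi; have [r1 r2] := ms_range hT hred M.
have pr := @ms_point rho i M ltac:(nlia).
exists (pt (horizontal rho) (g (horizontal rho) i) (g (~~ horizontal rho) (ms_line rho))).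
split; [apply/(ms_endpoint _ M); split=> // | by rewrite along_pt | ].
  by rewrite along_pt; case: hi => ->; [left|right].
apply: (iff_trans (ms_frontier M pr)); rewrite along_pt.
by split=> -[] E; [left|right|left|right]; rewrite ?E //; apply: grid_inj E; nlia.
Qed.

Lemma ms_CC rho : rho \in MS T ->
  (rho \in CC T) = (ms_lo rho == 0%N) && (ms_hi rho == n (horizontal rho)).
Proof.
move=> M; have [r1 r2] := ms_range hT hred M; rewrite inE M /=.
apply/asboolP/andP => [H|[/eqP h1 /eqP h2] p /(ms_endpoint _ M)[pr H]].
  have [p [/H pf _ /iffLR/(_ pf) pe]] := ms_end_frontier M (or_introl erefl).
  have [q [/H qf _ /iffLR/(_ qf) qe]] := ms_end_frontier M (or_intror erefl).
  by split; nlia.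
by apply/(ms_frontier M pr); case: H => ->; rewrite ?h1 ?h2; [left|right].
Qed.

Lemma ms_MIS rho : rho \in MS T ->
  (rho \in MIS T) = (0 < ms_lo rho)%N && (ms_hi rho < n (horizontal rho))%N.
Proof.
move=> M; have [r1 r2] := ms_range hT hred M; rewrite inE M /=.
apply/asboolP/andP => [H|[h1 h2]].
  have [p [/(ms_endpoint _ M)[pr _] _ pe]] := ms_end_frontier M (or_introl erefl).
  have [q [/(ms_endpoint _ M)[qr _] _ qe]] := ms_end_frontier M (or_intror erefl).
  split; rewrite ltnNge; apply/negP => h.
    by have : (pts rho `&` frontier (domain T)) p; [split=> //; apply/pe; left; nlia|rewrite H].
  by have : (pts rho `&` frontier (domain T)) q; [split=> //; apply/qe; right; nlia|rewrite H].
apply/seteqP; split=> p //= [pr /(ms_frontier M pr) E].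
have : on_segment p rho by []; rewrite (ms_on hT hred _ M) => /andP[_ /andP[a1 a2]].
by case: E => E; move: a1 a2; rewrite E !grid_leE //; nlia.
Qed.

Lemma ms_Ray rho : rho \in MS T ->
  (rho \in Ray T) = (ms_lo rho == 0%N) (+) (ms_hi rho == n (horizontal rho)).
Proof.
move=> M; have [r1 r2] := ms_range hT hred M; rewrite inE M /=.
have [p [pe pa pf]] := ms_end_frontier M (or_introl erefl).
have [q [qe qa qf]] := ms_end_frontier M (or_intror erefl).
have alt x : is_endpoint rho x -> (frontier (domain T) x <-> frontier (domain T) p) \/
   (frontier (domain T) x <-> frontier (domain T) q).
  move=> /(ms_endpoint _ M)[xr H]; move: pe qe => /(ms_endpoint _ M)[pr _] /(ms_endpoint _ M)[qr _].
  have [f1 f2 f3] := And3 (ms_frontier M xr) (ms_frontier M pr) (ms_frontier M qr).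
  by case: H => E; [left|right]; rewrite E -?pa -?qa in f1; rewrite f1 ?f2 ?f3.
apply/asboolP/idP => [[[x xe xf] [y ye yf]]|].
  case: (alt x xe) (alt y ye) => ax [] ay.
  - by case: yf; apply/ay/ax.
  - have /pf h1 : frontier (domain T) p by apply/ax.
    have h2 : ~ frontier (domain T) q by move/ay.
    have {}h2 : ms_hi rho <> n (horizontal rho) by move=> E; apply: h2; apply/qf; right.
    by move/eqP/negbTE: h2 => ->; rewrite addbF; apply/eqP; nlia.
  - have /qf h1 : frontier (domain T) q by apply/ax.
    have h2 : ~ frontier (domain T) p by move/ay.
    have {}h2 : ms_lo rho <> 0%N by move=> E; apply: h2; apply/pf; left.
    by move/eqP/negbTE: h2 => ->; rewrite addFb; apply/eqP; nlia.
  - by case: yf; apply/ay/ax.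
have nn : ~ (ms_lo rho = n (horizontal rho)) by nlia.
have n0 : ~ (ms_hi rho = 0%N) by nlia.
case: eqP => h1; case: eqP => h2 //= _.
  by split; [exists p => //; apply/pf; left|exists q => // /qf[]].
by split; [exists q => //; apply/qf; right|exists p => // /pf[]].
Qed.

(** Each end of a maximal segment either is or is not on an outermost grid line, which exhausts the
    cases. This is what puts every member of [MS] into [MShat]. *)
Lemma MS_types : MS T = (CC T :|: Ray T :|: MIS T)%SET.
Proof.
apply/finset.setP => rho; rewrite !finset.in_setU; apply/idP/idP => [M|].
  have [r1 r2] := ms_range hT hred M.
  by rewrite ms_CC // ms_Ray // ms_MIS //; nlia.
by rewrite /CC /Ray /MIS !inE => /orP[/orP[]|] /andP[].
Qed.

Lemma MS_MShat rho : rho \in MS T -> rho \in MShat T.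
Proof. by rewrite MS_types /MShat !finset.in_setU => ->. Qed.

Lemma MShat_MS_BMS rho : rho \in MShat T -> rho \in MS T \/ rho \in BMS T.
Proof. by rewrite MS_types /MShat !finset.in_setU => /orP[]; [left|right]. Qed.

Lemma MIS_MS rho : rho \in MIS T -> rho \in MS T.
Proof. by rewrite MS_types !finset.in_setU => ->; rewrite orbT. Qed.
Lemma CC_MS rho : rho \in CC T -> rho \in MS T.
Proof. by rewrite MS_types !finset.in_setU => ->. Qed.

Lemma ms_uniq_at rho eta p : p \in verts T -> rho \in MS T -> eta \in MS T ->
  horizontal rho = horizontal eta -> on_segment p rho -> on_segment p eta -> rho = eta.
Proof. by move=> hp /MS_MShat h1 /MS_MShat h2; exact: (no_collinear hred hp h1 h2). Qed.

Lemma ms_interior rho p : rho \in MIS T -> on_segment p rho -> interior (domain T) p.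
Proof.
move=> M pr; have Ms := MIS_MS M; move: M; rewrite ms_MIS // => /andP[m1 m2].
have [r1 r2] := ms_range hT hred Ms.
move: pr; rewrite (ms_on hT hred _ Ms) => /andP[/eqP c1 /andP[a1 a2]].
apply/(interior_domainP hT hred); apply: (@allbP _ (horizontal rho)); last first.
  by rewrite c1 !grid_ltE //; nlia.
apply/andP; split.
  by apply: (lt_le_trans _ a1); rewrite grid_ltE //; nlia.
by apply: (le_lt_trans a2); rewrite grid_ltE //; nlia.
Qed.

(** Reducedness supplies a perpendicular member of [MShat]. It cannot consist of boundary edges,
    since an edge through an interior point of the domain is interior. *)
Lemma cross_at_MIS rho p : rho \in MIS T -> p \in verts T -> on_segment p rho ->
  exists eta, [/\ eta \in MS T, horizontal eta = ~~ horizontal rho & on_segment p eta].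
Proof.
move=> M hp pr; case: hred => _ /(_ p hp (~~ horizontal rho))[eta [[h1 h2 h3] _]] _.
exists eta; split=> //; case: (MShat_MS_BMS h1) => //.
rewrite BMS_maxseg => /maxsegP[_ sB]; have /on_segmentP[e er ep] := h3.
have := fintype.subsetP sB _ er; rewrite finset.in_setC => /negP[].
by apply/interior_edgeP; exists p => //; exact: ms_interior pr.
Qed.

Definition vertex rho eta : R * R := pt (horizontal rho) (coordinate eta) (coordinate rho).

Lemma vertex_unique rho eta p : is_segment rho -> is_segment eta ->
  horizontal eta = ~~ horizontal rho -> on_segment p rho -> on_segment p eta -> p = vertex rho eta.
Proof.
move=> Sr Se hd /(segment_line Sr) h1 /(segment_line Se); rewrite hd negbK => h2.
by rewrite /vertex -h1 -h2 pt_along.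
Qed.

Lemma crossing_vert rho eta p : is_segment rho -> is_segment eta ->
  horizontal eta = ~~ horizontal rho -> on_segment p rho -> on_segment p eta -> p \in verts T.
Proof.
move=> Sr Se hd /on_segmentP[e er ep] /on_segmentP[f fr fp].
apply: (shared_vertex hT (e := e) (e' := f)) => //; apply/negP => /eqP E.
have [h1 _] := segment_dir Sr er; have [h2 _] := segment_dir Se fr.
by move: hd; rewrite -h1 -h2 E; case: (horiz _).
Qed.

Lemma crosses_vertex rho eta : rho \in MS T -> eta \in MS T -> horizontal eta = ~~ horizontal rho ->
  crosses rho eta -> [/\ on_segment (vertex rho eta) rho, on_segment (vertex rho eta) eta,
    vertex rho eta \in verts T & interior (domain T) (vertex rho eta)].
Proof.
move=> Mr Me hd /asboolP[p [pr pe]].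
have Sr := MShat_segment (MS_MShat Mr); have Se := MShat_segment (MS_MShat Me).
rewrite -(vertex_unique Sr Se hd pr pe); split=> //; first exact: crossing_vert pr pe.
have [_ r1] := ms_range hT hred Mr; have [_ r2] := ms_range hT hred Me.
move: pr pe; rewrite /pts /= !(ms_on hT hred) // hd negbK => /andP[/eqP c1 _] /andP[/eqP c2 _].
rewrite hd negbK in r2.
by apply/(interior_domainP hT hred); apply: (@allbP _ (horizontal rho));
  rewrite ?c1 ?c2 !grid_ltE //; nlia.
Qed.

Lemma crosses_sym rho eta : crosses rho eta = crosses eta rho.
Proof. by rewrite /crosses classical_sets.setIC. Qed.

End Types.

(** * Bivariate polynomials *)

Section BiPolynomials.
Context {R : realType}.
Implicit Types (p q : {poly {poly R}}) (a b : int) (h : bool) (c : R) (k : nat).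

Lemma line_poly_true c : line_poly true c = ('X - c%:P)%:P.
Proof. by rewrite /line_poly /= polyCB. Qed.

Lemma line_poly_neq0 h c k : line_poly h c ^+ k != 0.
Proof.
rewrite expf_neq0 //; case: h; last by rewrite /line_poly polyXsubC_eq0.
by rewrite line_poly_true polyC_eq0 polyXsubC_eq0.
Qed.

Lemma swapXY_line h c : swapXY (line_poly h c) = line_poly (~~ h) c.
Proof.
case: h; first by rewrite /line_poly raddfB /= swapXY_Y swapXY_polyC map_polyC.
by rewrite /line_poly raddfB /= swapXY_X swapXY_polyC map_polyC.
Qed.

Lemma swapXY_lineM h c k q :
  swapXY (line_poly h c ^+ k * q) = line_poly (~~ h) c ^+ k * swapXY q.
Proof. by rewrite rmorphM rmorphXn /= swapXY_line. Qed.

Lemma size_line_exp h c k : size (line_poly h c ^+ k) = (if h then 1 else k.+1)%N.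
Proof.
case: h; last by rewrite size_exp_XsubC.
by rewrite line_poly_true -polyC_exp size_polyC expf_neq0 // polyXsubC_eq0.
Qed.

Lemma size_bideg q a : q != 0 ->
  (forall i j, q`_i`_j != 0 -> i%:Z <= a) <-> (size q)%:Z <= a + 1.
Proof.
move=> q0; split=> [H|H i j qij].
  have l0 : lead_coef q != 0 by rewrite lead_coef_eq0.
  have := H (size q).-1 (size (lead_coef q)).-1; rewrite -!lead_coefE lead_coef_eq0.
  move=> /(_ l0); move: q0; rewrite -size_poly_gt0; lia.
have : (i < size q)%N.
  by rewrite ltnNge; apply: contraNN qij => /leq_sizeP/(_ i (leqnn i))->; rewrite coef0.
lia.
Qed.

Lemma bideg_leE q a b : q != 0 ->
  bideg_le a b q <-> (size q)%:Z <= a + 1 /\ (size (swapXY q))%:Z <= b + 1.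
Proof.
move=> q0; have s0 : swapXY q != 0 by rewrite swapXY_eq0.
rewrite -(size_bideg a q0) -(size_bideg b s0); split=> [H|[H1 H2] i j qij].
  split=> i j qij; first by case/andP: (H i j qij).
  by rewrite coef_swapXY in qij; case/andP: (H j i qij).
by rewrite (H1 i j qij) (H2 j i) // coef_swapXY.
Qed.

(** The shift is exact because sizes add up in either variable over an integral domain. The case
    [q = 0] is separate, as the bounds may be negative. *)
Lemma bideg_le_line h c k q a b :
  bideg_le (a + (if h then 0 else k%:Z)) (b + (if h then k%:Z else 0)) (line_poly h c ^+ k * q) <->
  bideg_le a b q.
Proof.
have [->|q0] := eqVneq q 0.
  by rewrite mulr0; split=> _ i j; rewrite !coef0 eqxx.
have l0 := line_poly_neq0 h c k.
have S1 : size (line_poly h c ^+ k * q) = ((if h then 0 else k) + size q)%N.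
  by rewrite size_mul // size_line_exp; case: (h); rewrite ?add0n ?addSn.
have S2 : size (swapXY (line_poly h c ^+ k * q)) = ((if h then k else 0) + size (swapXY q))%N.
  rewrite rmorphM rmorphXn /= swapXY_line size_mul ?swapXY_eq0 ?line_poly_neq0 //.
  by rewrite size_line_exp; case: (h); rewrite ?add0n ?addSn.
rewrite !bideg_leE ?mulf_neq0 // S1 S2.
have := q0; rewrite -size_poly_gt0; have := q0; rewrite -swapXY_eq0 -size_poly_gt0.
by move: (size q) (size _) => s1 s2; case: (h) => /=; lia.
Qed.

Lemma bideg_leW a b a' b' q : a <= a' -> b <= b' -> bideg_le a b q -> bideg_le a' b' q.
Proof. by move=> ha hb H i j /H; lia. Qed.

(** Induction on [k], gaining one linear factor at a time: a power of [t - c'] is a nonzero constant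
    in [s], so [s = c] must be a root of the remaining cofactor [q'']. *)
Lemma line_coprime c c' k k' p q q' :
  p = line_poly false c ^+ k * q -> p = line_poly true c' ^+ k' * q' ->
  exists q'', p = line_poly false c ^+ k * (line_poly true c' ^+ k' * q'').
Proof.
elim: k q => [|k IH] q Eq Eq'; first by exists q'; rewrite mul1r.
have [q'' E] := IH (line_poly false c * q) ltac:(by rewrite Eq exprS mulrCA mulrA) Eq'.
have {}E : line_poly false c * q = line_poly true c' ^+ k' * q''.
  by apply: (mulfI (line_poly_neq0 false c k)); rewrite -E Eq exprSr mulrA.
have r0 : root (line_poly true c' ^+ k' * q'') c%:P.
  by rewrite -E /root /line_poly hornerM hornerXsubC subrr mul0r.
have rq : root q'' c%:P.
  move: r0; rewrite rootM => /orP[|//].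
  by rewrite /root line_poly_true -polyC_exp hornerC expf_eq0 polyXsubC_eq0 andbF.
have /factor_theorem[w Ew] := rq.
exists w; rewrite Eq exprSr -mulrA E Ew /line_poly; ring.
Qed.

End BiPolynomials.

Section Matrices.
Context {R : realType} (m m' : nat).
Local Notation P := 'M[R]_(m.+1, m'.+1).
Implicit Types (p q : {poly {poly R}}) (A B : P).

Definition mxof p : P := \matrix_(i, j) p`_i`_j.

Lemma coef_monomial (x : R) i0 j0 i j :
  (x%:P%:P * 'X ^+ i0 * 'Y ^+ j0 : {poly {poly R}})`_i`_j = x *+ ((i == i0) && (j == j0)).
Proof.
rewrite -polyC_exp mulrAC -polyCM coefCM coefXn.
by case: eqP => _; rewrite ?mulr0 ?coef0 // mulr1 coefCM coefXn mulr_natr.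
Qed.

Lemma coef_bipoly A (i : 'I_m.+1) (j : 'I_m'.+1) : (bipoly A)`_i`_j = A i j.
Proof.
rewrite /bipoly coef_sum coef_sum (bigD1 i) //= [X in _ + X]big1 ?addr0; last first.
  move=> i' ne; rewrite coef_sum coef_sum big1 // => j' _.
  by rewrite coef_monomial (negbTE (_ : (i : nat) != i')) // eq_sym.
rewrite coef_sum coef_sum (bigD1 j) //= [X in _ + X]big1 ?addr0.
  by rewrite coef_monomial !eqxx.
by move=> j' ne; rewrite coef_monomial eqxx (negbTE (_ : (j : nat) != j')) // eq_sym.
Qed.

Lemma bideg_bipoly A : bideg_le m%:Z m'%:Z (bipoly A).
Proof.
have K i j : (m < i)%N || (m' < j)%N -> (bipoly A)`_i`_j = 0.
  move=> H; rewrite /bipoly coef_sum coef_sum big1 // => i' _.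
  rewrite coef_sum coef_sum big1 // => j' _.
  rewrite coef_monomial (_ : _ && _ = false) //.
  by have := ltn_ord i'; have := ltn_ord j'; lia.
by move=> i j; apply: contraNT => H; rewrite K //; lia.
Qed.

Lemma bipolyK A : mxof (bipoly A) = A.
Proof. by apply/matrixP => i j; rewrite mxE coef_bipoly. Qed.

Lemma bipoly_inj : injective (@bipoly R m m').
Proof. exact: can_inj bipolyK. Qed.

Lemma mxofK p : bideg_le m%:Z m'%:Z p -> bipoly (mxof p) = p.
Proof.
move=> H; apply/polyP => i; apply/polyP => j.
have [/andP[hi hj]|out] := boolP ((i < m.+1)%N && (j < m'.+1)%N).
  by have := coef_bipoly (mxof p) (Ordinal hi) (Ordinal hj); rewrite mxE.
have Z q : bideg_le m%:Z m'%:Z q -> q`_i`_j = 0.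
  by move=> /(_ i j) Hq; apply/eqP; apply: contraNT out => /Hq; lia.
by rewrite !Z //; exact: bideg_bipoly.
Qed.

Lemma bipolyZ (k : R) A : bipoly (k *: A) = k%:P%:P * bipoly A.
Proof. by rewrite -[k *: A]addr0 bipoly_linear bipoly0 addr0. Qed.

Lemma bipolyD A B : bipoly (A + B) = bipoly A + bipoly B.
Proof. by rewrite -[A]scale1r bipoly_linear !scale1r mul1r. Qed.

Lemma bipolyN A : bipoly (- A) = - bipoly A.
Proof. by rewrite -scaleN1r bipolyZ !polyCN mulN1r. Qed.

Lemma bipolyB A B : bipoly (A - B) = bipoly A - bipoly B.
Proof. by rewrite bipolyD bipolyN. Qed.

Lemma bipoly_sum I (r : seq I) (Q : pred I) (F : I -> P) :
  bipoly (\sum_(i <- r | Q i) F i) = \sum_(i <- r | Q i) bipoly (F i).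
Proof. by rewrite (big_morph _ bipolyD (bipoly0 _ _)). Qed.

(* Multiplication by l, truncated to the bidegree (m, m'). *)
Definition mulpoly (l : {poly {poly R}}) A : P := mxof (l * bipoly A).

Lemma mulpoly_is_linear l : linear (mulpoly l).
Proof.
move=> k A B; apply/matrixP => i j; rewrite !mxE bipoly_linear mulrDr mulrCA.
by rewrite coefD coefCM coefD coefCM.
Qed.
HB.instance Definition _ l := GRing.isLinear.Build R P P *:%R (mulpoly l) (mulpoly_is_linear l).

Lemma mulpoly0 l : mulpoly l 0 = 0.
Proof. by rewrite /mulpoly bipoly0 mulr0; apply/matrixP => i j; rewrite !mxE !coef0. Qed.

Definition Rspace (a b : int) : {vspace P} := span_set (fun A => bideg_le a b (bipoly A)).

Lemma mem_Rspace a b A : A \in Rspace a b <-> bideg_le a b (bipoly A).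
Proof.
apply: mem_span_set; first by rewrite bipoly0 => i j; rewrite !coef0 eqxx.
by move=> k u w hu hw; rewrite bipoly_linear; exact: bideg_le_linear.
Qed.

Lemma bipoly_mulpoly h c k a b A : A \in Rspace a b ->
  a + (if h then 0 else k%:Z) <= m%:Z -> b + (if h then k%:Z else 0) <= m'%:Z ->
  bipoly (mulpoly (line_poly h c ^+ k) A) = line_poly h c ^+ k * bipoly A.
Proof.
move=> /mem_Rspace HA ha hb; apply: mxofK; apply: (bideg_leW ha hb).
exact/bideg_le_line.
Qed.

End Matrices.

(** * Linear algebra *)

Section ProductSpace.
Context {F : fieldType} {V : vectType F} {I : finType}.
Implicit Types (U : I -> {vspace V}) (f : {ffun I -> V}).

Lemma ffun_linE (a : F) f1 f2 i : (a *: f1 + f2 : {ffun I -> V}) i = a *: f1 i + f2 i.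
Proof. by rewrite !ffunE. Qed.

Lemma ffun_subE f1 f2 i : (f1 - f2 : {ffun I -> V}) i = f1 i - f2 i.
Proof. by rewrite !ffunE. Qed.

Definition prodv U : {vspace {ffun I -> V}} := span_set (fun f => forall i, f i \in U i).

Lemma mem_prodv U f : f \in prodv U <-> forall i, f i \in U i.
Proof.
apply: mem_span_set => [i|a u w hu hw i]; first by rewrite ffunE mem0v.
by rewrite !ffunE memvD ?memvZ.
Qed.

Definition inject_at (i : I) (v : V) : {ffun I -> V} := [ffun j => if j == i then v else 0].

Lemma inject_at_linear i : linear (inject_at i).
Proof.
by move=> a u v; apply/ffunP => j; rewrite !ffunE; case: eqP => // _; rewrite scaler0 addr0.
Qed.
HB.instance Definition _ i := GRing.isLinear.Build F V {ffun I -> V} *:%R (inject_at i) (inject_at_linear i).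

Lemma dim_prodv U : \dim (prodv U) = (\sum_i \dim (U i))%N.
Proof.
pose E i := (linfun (inject_at i) @: U i)%VS.
have memE i f : f \in E i -> exists2 v, v \in U i & f = inject_at i v.
  by move=> /memv_imgP[v vU ->]; exists v; rewrite ?lfunE.
have -> : prodv U = (\sum_i E i)%VS.
  apply/vspaceP => f; apply/idP/idP => [/mem_prodv H|/memv_sumP[u uE ->]].
    have -> : f = \sum_i inject_at i (f i).
      apply/ffunP => j; rewrite sum_ffunE (bigD1 j) //= big1 ?addr0; first by rewrite ffunE eqxx.
      by move=> i ne; rewrite ffunE eq_sym (negbTE ne).
    by apply: memv_suml => i _; apply: (subvP (sumv_sup i _ (subvv _))) => //;
      rewrite -[inject_at i _]lfunE memv_img.
  apply/mem_prodv => j; rewrite sum_ffunE; apply: memv_suml => i _.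
  by have [v vU ->] := memE i _ (uE i isT); rewrite ffunE; case: eqP => [->|_]; rewrite ?mem0v.
have dx : directv (\sum_i E i)%VS.
  apply/directv_sum_independent => u uE u0 i _.
  have [v vU Ev] := memE i _ (uE i isT).
  have := congr1 (fun f : {ffun I -> V} => f i) u0; rewrite sum_ffunE (bigD1 i) //= big1 ?addr0.
    by rewrite Ev !ffunE eqxx => ->; apply/ffunP => j; rewrite !ffunE; case: eqP.
  move=> j ne; have [w wU ->] := memE j _ (uE j isT).
  by rewrite ffunE eq_sym (negbTE ne).
rewrite (directvP dx) /=; apply: eq_bigr => i _; apply: limg_dim_eq.
apply/eqP; rewrite -subv0; apply/subvP => v; rewrite memv_cap memv_ker memv0 => /andP[_].
rewrite lfunE /= => /eqP/(congr1 (fun f : {ffun I -> V} => f i)).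
by rewrite !ffunE eqxx => ->.
Qed.

End ProductSpace.

Section LinearCombinators.
Context {F : fieldType} {U V W : vectType F}.

Lemma lin_sum (I : finType) (Q : pred I) (t : I -> U -> V) :
  (forall i, linear (t i)) -> linear (fun u => \sum_(i | Q i) t i u).
Proof.
move=> H a u w; rewrite scaler_sumr -big_split /=; apply: eq_bigr => i _; exact: H.
Qed.

Lemma lin_ffun (I : finType) (t : I -> U -> V) :
  (forall i, linear (t i)) -> linear (fun u => [ffun i => t i u] : {ffun I -> V}).
Proof. by move=> H a u w; apply/ffunP => i; rewrite !ffunE H. Qed.

Lemma lin_if (b : bool) (f g : U -> V) : linear f -> linear g -> linear (fun u => if b then f u else g u).
Proof. by case: b. Qed.

Lemma lin_opp (f : U -> V) : linear f -> linear (fun u => - f u).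
Proof. by move=> H a u w; rewrite H opprD scalerN. Qed.

Lemma lin_0 : linear (fun _ : U => 0 : V).
Proof. by move=> a u w; rewrite scaler0 addr0. Qed.

Lemma lin_add (f g : U -> V) : linear f -> linear g -> linear (fun u => f u + g u).
Proof. by move=> Hf Hg a u w; rewrite Hf Hg scalerDr addrACA. Qed.

Lemma lin_scale (k : F) (f : U -> V) : linear f -> linear (fun u => k *: f u).
Proof. by move=> Hf a u w; rewrite Hf scalerDr !scalerA mulrC. Qed.

Lemma lin_at (I : finType) (f : U -> V) (i : I) : linear f -> linear (fun z : {ffun I -> U} => f (z i)).
Proof. by move=> H a u w; rewrite !ffunE H. Qed.

End LinearCombinators.

Section LinearMaps.
Context {F : fieldType} {U V : vectType F} (f : U -> V).
Hypothesis f_lin : linear f.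
HB.instance Definition _ := GRing.isLinear.Build F U V *:%R f f_lin.

(** Image and kernel are given by membership criteria, so that spaces introduced as spans of
    predicates can be inserted directly. *)
Lemma rank_nullity (A K : {vspace U}) (B : {vspace V}) :
  (forall v, v \in B <-> exists2 u, u \in A & f u = v) ->
  (forall u, u \in K <-> u \in A /\ f u = 0) ->
  (\dim K + \dim B = \dim A)%N.
Proof.
move=> HB HK; rewrite -(limg_ker_dim (linfun f) A).
have -> : K = (A :&: lker (linfun f))%VS; last (congr (_ + _)%N; congr (\dim _)).
  apply/vspaceP => u; rewrite memv_cap memv_ker lfunE /=.
  by apply/idP/andP => [/HK[-> ->]|[uA /eqP fu]]; [rewrite eqxx|apply/HK].
apply/vspaceP => v; apply/idP/idP => [/HB[u uA <-]|/memv_imgP[u uA ->]].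
  by rewrite -[f u]lfunE memv_img.
by rewrite lfunE; apply/HB; exists u.
Qed.

Lemma linear_image (A : {vspace U}) :
  exists B : {vspace V}, forall v, v \in B <-> exists2 u, u \in A & f u = v.
Proof.
exists (linfun f @: A)%VS => v; split=> [/memv_imgP[u uA ->]|[u uA <-]].
  by exists u; rewrite ?lfunE.
by rewrite -[f u]lfunE memv_img.
Qed.

Lemma linear_bij_dim (A : {vspace U}) (B : {vspace V}) :
  (forall u, u \in A -> f u \in B) -> (forall v, v \in B -> exists2 u, u \in A & f u = v) ->
  (forall u, u \in A -> f u = 0 -> u = 0) -> \dim A = \dim B.
Proof.
move=> H1 H2 H3; have <- : (\dim (0 : {vspace U}) + \dim B = \dim A)%N.
  apply: rank_nullity => [v|u]; first by split=> [/H2//|[u /H1 uB <-]].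
  rewrite memv0; split=> [/eqP->|[uA fu]]; last by rewrite (H3 u).
  by split; [exact: mem0v|exact: linear0].
by rewrite dimv0.
Qed.

End LinearMaps.

(** * Splines as functions on grid squares *)

Definition jump (V : zmodType) (F : nat * nat -> V) d a j := F (pt d a j) - F (pt d a j.-1).

Section SplineGrid.
Context {R : realType} (m m' : nat) (T : tmesh R) (r : edges T -> int).
Local Notation P := 'M[R]_(m.+1, m'.+1).
Implicit Types (d : bool) (k : nat * nat) (rho eta : {set edges T}).
Local Notation g := (grid T).
Local Notation n := (ngrid T).
Local Notation incell := (incell T).
Local Notation S := {ffun cells T -> P}.
Hypotheses (hT : is_tmesh T) (hred : reduced T) (hr : is_smoothness r) (hc : constant_on_MS r).

Definition ms_order rho : nat := absz (seg_smooth r rho + 1).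
Definition ms_poly rho : {poly {poly R}} := ell rho ^+ ms_order rho.

Lemma seg_smooth_ge rho : -1 <= seg_smooth r rho.
Proof. by rewrite /seg_smooth; case: pickP => // e _; exact: hr.1. Qed.

Lemma ms_orderE rho : (ms_order rho)%:Z = seg_smooth r rho + 1.
Proof. by have := seg_smooth_ge rho; rewrite /ms_order; nlia. Qed.

Lemma seg_smooth_edge rho e : rho \in MS T -> e \in rho -> seg_smooth r rho = r e.
Proof.
move=> M er; rewrite /seg_smooth; case: pickP => [e' er'|/(_ e)]; last by rewrite er.
exact: (hc M).
Qed.

Lemma poly_dvdN (l p : {poly {poly R}}) : poly_dvd l p -> poly_dvd l (- p).
Proof. by move=> [q ->]; exists (- q); rewrite mulrN. Qed.
Lemma poly_dvdD (l p q : {poly {poly R}}) : poly_dvd l p -> poly_dvd l q -> poly_dvd l (p + q).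
Proof. by move=> [x ->] [y ->]; exists (x + y); rewrite mulrDr. Qed.
Lemma poly_dvd0 (l : {poly {poly R}}) : poly_dvd l 0.
Proof. by exists 0; rewrite mulr0. Qed.
Lemma poly_dvd_sum I (s : seq I) (Q : pred I) (F : I -> {poly {poly R}}) l :
  (forall i, Q i -> poly_dvd l (F i)) -> poly_dvd l (\sum_(i <- s | Q i) F i).
Proof. by move=> H; elim/big_ind: _ => //; [exact: poly_dvd0|exact: poly_dvdD]. Qed.

Definition value_at (f : S) k : P :=
  if [pick c : cells T | incell (val c) k] is Some c then f c else 0.

Lemma value_atE (f : S) k c : ingrid T k -> incell (val c) k -> value_at f k = f c.
Proof.
move=> hk ck; rewrite /value_at; case: pickP => [c' ck'|/(_ c)]; last by rewrite ck.
by congr (f _); apply: val_inj; apply: (cell_uniq hT (fsvalP c') (fsvalP c) hk ck' ck).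
Qed.

Lemma value_atB (f h : S) k : value_at (f - h) k = value_at f k - value_at h k.
Proof. by rewrite /value_at; case: pickP => *; rewrite ?ffunE ?subr0. Qed.

Lemma value_at_nosep (f : S) d a j : (a < n d)%N -> (0 < j < n (~~ d))%N -> ~~ sep T d a j ->
  value_at f (pt d a j.-1) = value_at f (pt d a j).
Proof.
move=> ha hj; rewrite /sep negbK => /existsP[c /andP[h h']].
by rewrite (value_atE _ _ h) ?(value_atE _ _ h') // ingrid_pt ha /=; nlia.
Qed.

Lemma value_at_eq0 (f : S) : (forall k, ingrid T k -> value_at f k = 0) -> f = 0.
Proof.
move=> H; apply/ffunP => c; rewrite ffunE.
have K d : exists2 i, (i < n d)%N & grid_spans T (val c) d i.
  have /andP[/crd_grid[i hi Ei] /crd_grid[j hj Ej]] := crd_cell d (fsvalP c).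
  have := cell_lt hT d (fsvalP c); rewrite Ei Ej grid_ltE // => lij.
  by exists i; [nlia|rewrite /grid_spans Ei Ej lexx grid_leE //; nlia].
have [i1 h1 s1] := K true; have [i2 h2 s2] := K false.
have hk : ingrid T (i1, i2) by rewrite /ingrid h1 h2.
by rewrite -(H _ hk) (@value_atE f _ c) // /incell s1 s2.
Qed.

(** Over each grid interval a maximal segment separates exactly two cells, so conditions on pairs of
    cells turn into conditions on single jumps; constancy of [r] gives them all the same
    exponent. *)
Lemma is_spline_grid (f : S) : is_spline r f <->
  forall rho a, rho \in MS T -> (ms_lo rho <= a < ms_hi rho)%N ->
    poly_dvd (ms_poly rho) (bipoly (jump (value_at f) (horizontal rho) a (ms_line rho))).
Proof.
split=> [H rho a M ha|H c c' e ne ei sub].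
  have [r1 r2] := ms_range hT hred M; set d := horizontal rho; set j := ms_line rho.
  have an : (a < n d)%N by rewrite /d; nlia.
  have [c [c' [e [ne ic ic' [he ce eca sub]]]]] := sep_edge hT hred an r2 (ms_sep hT hred M ha).
  have er : e \in rho by apply/(ms_mem hT hred) => //; split=> //; exists a.
  have ei : e \in interior_edges T by apply/(interior_edge_line hT hred); exists j; rewrite he.
  have := H c c' e ne ei sub; rewrite -(seg_smooth_edge M er) => /poly_dvdN.
  have k1 : ingrid T (pt d a j.-1) by rewrite ingrid_pt an /=; nlia.
  have k2 : ingrid T (pt d a j) by rewrite ingrid_pt an /=; nlia.
  rewrite opprB -bipolyB /jump (value_atE _ k2 ic') (value_atE _ k1 ic).
  by rewrite /ms_poly /ell he ce -/d (ms_coordinate hT hred M).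
have [rho Mx er] := maxseg_exists ei.
have M : rho \in MS T by rewrite MS_maxseg.
have [he ce [a ha eca]] := (ms_mem hT hred e M).1 er.
have := H rho a M ha; rewrite /ms_poly /ell /ms_order (seg_smooth_edge M er).
have Ec : coordinate rho = cor (val e) by rewrite (ms_coordinate hT hred M) ce.
rewrite Ec; set d := horizontal rho; set j := ms_line rho => K.
have [r1 r2] := ms_range hT hred M; rewrite -/d -/j in r1 r2.
have an : (a < n d)%N by nlia.
have hm := mid_open an.
(* A cell containing the whole edge has the line of the edge as a side or extends across it; either
   way it covers one of the two squares beside the interval [a]. *)
have side (b : cells T) : (forall p, seg_pts (val e) p -> rect_pts (val b) p) ->
    incell (val b) (pt d a j.-1) \/ incell (val b) (pt d a j).
  move=> sb; have /sb bp : seg_pts (val e) (pt d (mid T d a) (cor (val e))).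
    by have := @mid_on_edge _ T (val e) a; rewrite he; apply.
  have sd : grid_spans T (val b) d a.
    have := @cell_spans _ T _ _ d a (fsvalP b) bp an; rewrite along_pt => K2. exact: (K2 hm).
  move/rect_ptsP/(_ (~~ d)): bp; rewrite cross_pt ce -/d -/j => /andP[b1 b2].
  have lt := cell_lt hT (~~ d) (fsvalP b).
  rewrite !incell_pt sd /=.
  have [E|n1] := eqVneq (g (~~ d) j) (cmax (~~ d) (val b)).
    by left; apply: (spans_gt (fsvalP b)); rewrite ?E //; nlia.
  right; apply: (spans_lt (fsvalP b)) => //; first by nlia.
  by rewrite lt_neqAle n1.
have uniq (b b' : cells T) k : ingrid T k -> incell (val b) k -> incell (val b') k -> b = b'.
  by move=> hk i1 i2; apply: val_inj; apply: (cell_uniq hT (fsvalP b) (fsvalP b') hk).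
have k1 : ingrid T (pt d a j.-1) by rewrite ingrid_pt an /=; nlia.
have k2 : ingrid T (pt d a j) by rewrite ingrid_pt an /=; nlia.
rewrite -bipolyB; case: (side c (fun p h => (sub p h).1)) (side c' (fun p h => (sub p h).2)) => [i1|i1] [i2|i2].
- by case/eqP: ne; apply: uniq i1 i2.
- move/poly_dvdN: K; rewrite -bipolyN /jump opprB he.
  by rewrite (value_atE _ k1 i1) (value_atE _ k2 i2).
- by move: K; rewrite /jump he (value_atE _ k2 i1) (value_atE _ k1 i2).
- by case/eqP: ne; apply: uniq i1 i2.
Qed.

End SplineGrid.

(** * Jumps of a spline *)

Lemma mul_along (A : Type) (K : comPzRingType) d (f : A -> K) (x : A * A) q :
  f x.1 * (f x.2 * q) = f (along d x) * (f (along (~~ d) x) * q).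
Proof. by case: d => //=; exact: mulrCA. Qed.

Lemma sum_if_opp (V : zmodType) (I : finType) (Q Q' : pred I) (b : bool) (t t' : I -> V) :
  \sum_(i | Q i) (if Q' i then (if b then - t i else t' i) else 0) = 0 ->
  \sum_(i | Q i && Q' i) (if b then t i else t' i) = 0.
Proof.
rewrite -big_mkcondr /=; case: b => //.
by rewrite sumrN => /eqP; rewrite oppr_eq0 => /eqP.
Qed.

Section Expansion.
Context {R : realType} (T : tmesh R) {V : lmodType R}.
Local Notation Sg := {set edges T}.
Implicit Types (d : bool) (k : nat * nat) (rho eta : Sg) (x : Sg * Sg).
Local Notation n := (ngrid T).

Definition crossing x := [&& x.1 \in MS T, x.2 \in MS T, horizontal x.1, ~~ horizontal x.2 &
  crosses x.1 x.2].
Definition past rho k : bool := (ms_line rho <= along (~~ horizontal rho) k)%N.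
Definition lowray rho : bool := (ms_lo rho == 0%N) && (ms_hi rho != n (horizontal rho)).
(** The first term alone makes the jump across a segment at position [a] a sum over the crossings up
    to [a], which vanishes before the low end. The correction for [lowray] changes it into minus the
    sum over the later crossings, which vanishes past the high end. *)
Definition chi x k : R :=
  (past x.1 k && past x.2 k)%:R - (lowray x.1 && past x.1 k)%:R - (lowray x.2 && past x.2 k)%:R.

(* A family of jumps, one per cross-cut and one per crossing, summed over the
   lower left quadrant of k; the terms in [lowray] make the sum vanish beyond
   the end of a ray that starts on the lower or left side. *)
Definition seg_expansion (p : V) (c : Sg -> V) (D : Sg * Sg -> V) k : V :=
  p + \sum_(rho in CC T) (past rho k)%:R *: c rho
  + \sum_(x | crossing x) chi x k *: D x.

Definition seg_expansion_jump (c : Sg -> V) (D : Sg * Sg -> V) rho a : V :=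
  (if rho \in CC T then c rho else 0) +
  \sum_(x | crossing x && (along (horizontal rho) x == rho))
    ((ms_line (along (~~ horizontal rho) x) <= a)%N%:R - (lowray rho)%:R) *: D x.

Hypotheses (hT : is_tmesh T) (hred : reduced T).

Lemma crossing_along x d : crossing x ->
  [/\ along d x \in MS T, along (~~ d) x \in MS T, horizontal (along d x) = d,
      horizontal (along (~~ d) x) = ~~ d & crosses (along d x) (along (~~ d) x)].
Proof.
by case: d => /and5P[? ? ? /negbTE ? ?]; split => //=; rewrite crosses_sym.
Qed.

Lemma chi_jump x d a j : crossing x -> (0 < j)%N ->
  chi x (pt d a j) - chi x (pt d a j.-1) =
  (if ms_line (along d x) == j
   then (ms_line (along (~~ d) x) <= a)%N%:R - (lowray (along d x))%:R else 0).
Proof.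
move=> /and5P[_ _ h1 /negbTE h2 _] j0; rewrite /chi /past h1 h2.
have K u : (u <= j)%N = (u == j) || (u <= j.-1)%N by lia.
have K' u : u == j -> (u <= j.-1)%N = false by lia.
case: d => /=; [rewrite (K (ms_line x.1)); move: (K' (ms_line x.1))|
                rewrite (K (ms_line x.2)); move: (K' (ms_line x.2))];
  (case: eqP => _ K2; [rewrite K2 //= ?andbT !andbF | by rewrite subrr]).
  by rewrite subr0 sub0r opprK subrK.
by rewrite !subr0 sub0r opprK addrAC subrK.
Qed.

(** All other terms agree on the two squares; the remaining crossings are regrouped by the segment
    of direction [d] on which they lie. *)
Lemma seg_expansionB p c D d a j : (0 < j)%N ->
  jump (seg_expansion p c D) d a j =
  \sum_(rho in MS T | (horizontal rho == d) && (ms_line rho == j)) seg_expansion_jump c D rho a.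
Proof.
move=> j0; rewrite /jump /seg_expansion opprD addrACA opprD [X in X + _]addrACA subrr add0r.
rewrite -!sumrB /seg_expansion_jump [RHS]big_split /=; congr (_ + _).
  rewrite big_mkcond [RHS]big_mkcond; apply: eq_bigr => rho _.
  have [C|_] := boolP (rho \in CC T); last by rewrite if_same.
  rewrite (CC_MS hT hred C) /= -scalerBl /past.
  have [<-|ne] := eqVneq (horizontal rho) d.
    rewrite !cross_pt; case: eqP => [->|ne]; first by rewrite leqnn (_ : (j <= j.-1)%N = false) ?subr0 ?scale1r //; lia.
    by rewrite (_ : (ms_line rho <= j)%N = (ms_line rho <= j.-1)%N) ?subrr ?scale0r //; lia.
  have -> : ~~ horizontal rho = d by move: ne; case: (horizontal rho) d => -[].
  by rewrite !along_pt subrr scale0r.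
under eq_bigr => x vx do rewrite -scalerBl (chi_jump d a vx j0).
rewrite (bigID (fun x => ms_line (along d x) == j)) /= [X in _ + X]big1 ?addr0; last first.
  by move=> x /andP[_ /negbTE->]; rewrite scale0r.
rewrite (partition_big (along d) (fun rho => [&& rho \in MS T, horizontal rho == d & ms_line rho == j])) /=; last first.
  by move=> x /andP[/(crossing_along d)[-> _ -> _ _] ->]; rewrite eqxx.
apply: eq_bigr => rho /and3P[M /eqP hd /eqP hl].
apply: eq_big => [x|x /andP[/andP[_ hj] /eqP E]].
  rewrite hd; case: (eqVneq (along d x) rho) => [->|_]; last by rewrite !andbF.
  by rewrite hl eqxx !andbT.
by rewrite hj E hd.
Qed.

End Expansion.

Section Decomposition.
Context {R : realType} (m m' : nat) (T : tmesh R) (r : edges T -> int).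
Local Notation P := 'M[R]_(m.+1, m'.+1).
Local Notation Sg := {set edges T}.
Implicit Types (d : bool) (k : nat * nat) (rho eta : Sg) (x : Sg * Sg).
Local Notation n := (ngrid T).
Local Notation L := (ms_poly r).

(* Coordinates of a spline: its value on the bottom-left cell, one polynomial
   for every cross-cut and one for every crossing of maximal segments. *)
Local Notation Ix := (unit + (Sg + Sg * Sg))%type.
Definition icst : Ix := inl tt.
Definition iseg rho : Ix := inr (inl rho).
Definition ipair x : Ix := inr (inr x).
Local Notation Fam := {ffun Ix -> P}.
Implicit Types (z : Fam).

Definition corr_poly_space rho : {vspace P} :=
  if horizontal rho then Rspace m m' m%:Z (m'%:Z - seg_smooth r rho - 1)
  else Rspace m m' (m%:Z - seg_smooth r rho - 1) m'%:Z.
Definition vertex_poly_space x : {vspace P} :=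
  Rspace m m' (m%:Z - seg_smooth r x.2 - 1) (m'%:Z - seg_smooth r x.1 - 1).
Definition coord_space (i : Ix) : {vspace P} := match i with
  | inl _ => fullv
  | inr (inl rho) => if rho \in CC T then corr_poly_space rho else 0%VS
  | inr (inr x) => if crossing x then vertex_poly_space x else 0%VS
  end.

(** The share of the crossing [x] in the total jump across an MIS [rho], with the power of [ell rho]
    divided out. The minus sign on the horizontal segment is that of the vertex relations; it is
    common to all crossings of [rho] and does not change when the total vanishes. *)
Definition phi_term z x rho : P :=
  if (rho == x.2) && (x.2 \in MIS T) then mulpoly (L x.1) (z (ipair x))
  else if (rho == x.1) && (x.1 \in MIS T) then - mulpoly (L x.2) (z (ipair x))
  else 0.
Definition phi z : {ffun Sg -> P} := [ffun rho => \sum_(x | crossing x) phi_term z x rho].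

Lemma phi_term_linear x rho : linear (fun z => phi_term z x rho).
Proof.
apply: lin_if; first by apply: lin_at; exact: mulpoly_is_linear.
apply: lin_if; last exact: lin_0.
by apply: lin_opp; apply: lin_at; exact: mulpoly_is_linear.
Qed.

Lemma phi_term0 z x rho : z (ipair x) = 0 -> phi_term z x rho = 0.
Proof. by rewrite /phi_term => ->; rewrite !mulpoly0 oppr0 !if_same. Qed.

Lemma phiE z rho : phi z rho = \sum_(x | crossing x) phi_term z x rho.
Proof. by rewrite /phi ffunE. Qed.

Lemma phi_linear : linear phi.
Proof.
by apply: lin_ffun => rho; apply: lin_sum => x; exact: phi_term_linear.
Qed.

Definition dterm z x : P := mulpoly (L x.1 * L x.2) (z (ipair x)).
Definition cterm z rho : P := mulpoly (L rho) (z (iseg rho)).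

Definition spline_at z k : P := seg_expansion (z icst) (cterm z) (dterm z) k.
Definition seg_jump z rho a : P := seg_expansion_jump (cterm z) (dterm z) rho a.

Hypotheses (hT : is_tmesh T) (hred : reduced T) (hr : is_smoothness r) (hc : constant_on_MS r).

Lemma bipoly_cterm rho (A : P) : A \in corr_poly_space rho -> bipoly (mulpoly (L rho) A) = L rho * bipoly A.
Proof.
rewrite /corr_poly_space /ms_poly /ell; have := ms_orderE hr rho => E.
by case: ifP => h HA; apply: (bipoly_mulpoly _ HA) => /=; clear HA; lia.
Qed.

Lemma bipoly_qterm x d (A : P) : crossing x -> A \in vertex_poly_space x ->
  bipoly (mulpoly (L (along d x)) A) = L (along d x) * bipoly A.
Proof.
move=> vx HA; have [_ _ hd _ _] := crossing_along d vx.
have E1 := ms_orderE hr x.1; have E2 := ms_orderE hr x.2.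
have G1 := seg_smooth_ge hr x.1; have G2 := seg_smooth_ge hr x.2.
rewrite /ms_poly /ell hd; apply: (bipoly_mulpoly _ HA); clear HA;
  by case: (d) => /=; lia.
Qed.

Lemma bipoly_dterm x (A : P) : crossing x -> A \in vertex_poly_space x ->
  bipoly (mulpoly (L x.1 * L x.2) A) = L x.1 * (L x.2 * bipoly A).
Proof.
move=> vx /mem_Rspace HA; case/and5P: vx => _ _ h1 /negbTE h2 _.
have E1 := ms_orderE hr x.1; have E2 := ms_orderE hr x.2.
rewrite /mulpoly mxofK; first by rewrite mulrA.
rewrite -mulrA /ms_poly /ell h1 h2.
have := (bideg_le_line false (coordinate x.2) (ms_order r x.2) (bipoly A) _ _).2 HA.
move=> /(bideg_le_line true (coordinate x.1) (ms_order r x.1) _ _ _).2.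
by apply: bideg_leW; clear HA; lia.
Qed.

Lemma spline_at_jump z d a j : (0 < j)%N -> jump (spline_at z) d a j =
  \sum_(rho in MS T | (horizontal rho == d) && (ms_line rho == j)) seg_jump z rho a.
Proof. exact: seg_expansionB. Qed.

Definition admissible z := (forall i, z i \in coord_space i) /\ phi z = 0.

Lemma admissible_pair z x : admissible z -> crossing x -> z (ipair x) \in vertex_poly_space x.
Proof. by move=> [H _] vx; have := H (ipair x); rewrite /= vx. Qed.

Lemma phi_term_MIS z x rho : crossing x -> rho \in MIS T -> phi_term z x rho =
  if along (horizontal rho) x == rho then
    (if horizontal rho then - mulpoly (L x.2) (z (ipair x)) else mulpoly (L x.1) (z (ipair x)))
  else 0.
Proof.
move=> /and5P[_ _ h1 h2 _] M; rewrite /phi_term; case hd: (horizontal rho) => /=.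
  have -> : (rho == x.2) = false by apply/eqP => E; rewrite -E hd in h2.
  by rewrite andFb eq_sym; case: eqP => [E|//]; rewrite E M.
have -> : (rho == x.1) = false by apply/eqP => E; rewrite -E hd in h1.
by rewrite andFb eq_sym; case: eqP => [E|//]; rewrite E M.
Qed.

(** Multiplying the component of [phi] at [rho] by [L rho] restores the terms [dterm], up to a sign
    common to all crossings of [rho]. *)
Lemma admissible_sum z rho : admissible z -> rho \in MIS T ->
  \sum_(x | crossing x && (along (horizontal rho) x == rho)) dterm z x = 0.
Proof.
move=> Z M; set d := horizontal rho; apply: bipoly_inj; rewrite bipoly_sum bipoly0.
have := congr1 (fun w : {ffun Sg -> P} => w rho) Z.2; rewrite phiE ffunE.
under eq_bigr => x vx do rewrite (phi_term_MIS z vx M).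
move/sum_if_opp => /(congr1 (@bipoly R m m')); rewrite bipoly_sum bipoly0.
move/(congr1 (fun q => L rho * q)); rewrite mulr0 big_distrr /= => H.
rewrite -[RHS]H; apply: eq_bigr => x /andP[vx /eqP E].
have HA := admissible_pair Z vx.
rewrite /dterm (bipoly_dterm vx HA) (mul_along d (fun eta => L eta)) /= {1}E; congr (_ * _).
by rewrite /d; case: (horizontal rho); rewrite -(bipoly_qterm _ vx HA).
Qed.

Lemma dterm_dvd z x d : admissible z -> crossing x -> poly_dvd (L (along d x)) (bipoly (dterm z x)).
Proof.
move=> Z vx; rewrite /dterm bipoly_dterm //; last exact: admissible_pair.
rewrite (mul_along d (fun eta => L eta)).
by exists (L (along (~~ d) x) * bipoly (z (ipair x))).
Qed.

Lemma poly_dvdZ l (a : R) (A : P) : poly_dvd l (bipoly A) -> poly_dvd l (bipoly (a *: A)).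
Proof. by move=> [q E]; exists (a%:P%:P * q); rewrite bipolyZ E mulrCA. Qed.

Lemma seg_jump_dvd z rho a : admissible z -> rho \in MS T -> poly_dvd (L rho) (bipoly (seg_jump z rho a)).
Proof.
move=> Z M; rewrite /seg_jump bipolyD; apply: poly_dvdD.
  case: ifP => [C|_]; last by rewrite bipoly0; exact: poly_dvd0.
  rewrite /cterm bipoly_cterm; first by exists (bipoly (z (iseg rho))).
  by have := Z.1 (iseg rho); rewrite /= C.
rewrite bipoly_sum; apply: poly_dvd_sum => x /andP[vx /eqP E]; apply: poly_dvdZ.
by rewrite -{1}E; exact: dterm_dvd.
Qed.

Lemma crossing_line x d : crossing x ->
  (ms_lo (along d x) <= ms_line (along (~~ d) x) <= ms_hi (along d x))%N.
Proof.
move=> vx; have [M1 M2 h1 h2] := crossing_along d vx.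
by rewrite (crossesP hT hred M1 M2) ?h1 ?h2 // => /andP[].
Qed.

(** Before the low end all coefficients are 0; past the high end all equal 1 minus the indicator of
    [lowray]. For a ray starting at index 0 this is 0; otherwise [rho] is an MIS and the total of
    its terms vanishes by admissibility. *)
Lemma seg_jump0 z rho a : admissible z -> rho \in MS T -> (a < n (horizontal rho))%N ->
  ~~ (ms_lo rho <= a < ms_hi rho)%N -> seg_jump z rho a = 0.
Proof.
move=> Z M an out; have [r1 _] := ms_range hT hred M; set d := horizontal rho in an r1 *.
have -> : seg_jump z rho a = \sum_(x | crossing x && (along d x == rho))
    ((ms_lo rho <= a)%N%:R - (lowray rho)%:R) *: dterm z x.
  rewrite /seg_jump /seg_expansion_jump (ms_CC hT hred M) ifF ?add0r; last by rewrite -/d; nlia.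
  apply: eq_bigr => x /andP[vx /eqP E]; have := crossing_line d vx; rewrite E => hl.
  congr ((_%:R - _) *: _); rewrite -/d; apply: congr1.
  by move: hl out; clear; move: (ms_line _) (ms_lo rho) (ms_hi rho) => u v w; lia.
rewrite -scaler_sumr /lowray -/d.
have [lo_a|a_lo] := leqP (ms_lo rho) a; last first.
  by rewrite (_ : ms_lo rho == 0%N = false) ?subrr ?scale0r //; nlia.
have hn : (ms_hi rho != n d)%N by nlia.
rewrite hn andbT; have [_|l0] := eqVneq (ms_lo rho) 0%N; first by rewrite subrr scale0r.
by rewrite admissible_sum ?scaler0 // (ms_MIS hT hred M) -/d; nlia.
Qed.

Lemma spline_at_jump_on z rho a : admissible z -> rho \in MS T -> (ms_lo rho <= a < ms_hi rho)%N ->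
  jump (spline_at z) (horizontal rho) a (ms_line rho) = seg_jump z rho a.
Proof.
move=> Z M ha; have [r1 r2] := ms_range hT hred M.
rewrite spline_at_jump; last by nlia.
rewrite (bigD1 rho) /=; last by rewrite M !eqxx.
rewrite big1 ?addr0 // => eta /andP[/and3P[Me /eqP hd /eqP hl] ne].
apply: seg_jump0 => //; first by rewrite hd; nlia.
apply: contraNN ne => ha'; apply/eqP; apply: (@ms_eq _ T hT hred eta rho a) => //; nlia.
Qed.

Lemma spline_at_nosep z d a j : admissible z -> (a < n d)%N -> (0 < j < n (~~ d))%N ->
  ~~ sep T d a j -> jump (spline_at z) d a j = 0.
Proof.
move=> Z an hj ns; rewrite spline_at_jump; last by nlia.
apply: big1 => rho /and3P[M /eqP hd /eqP hl]; apply: seg_jump0 => //; first by rewrite hd.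
by apply: contraNN ns => ha; rewrite -hd -hl; apply: (ms_sep hT hred).
Qed.

End Decomposition.

(** The change, at the grid vertex with indices [a] and [j], of the jump across the line [j]; by
    [mixedC] it is equally the change of the jump across the other line. *)
Definition mixed (V : zmodType) (F : nat * nat -> V) d a j := jump F d a j - jump F d a.-1 j.

Lemma mixedC (V : zmodType) (F : nat * nat -> V) d a j : mixed F (~~ d) j a = mixed F d a j.
Proof.
by rewrite /mixed /jump !ptN !opprB addrACA [RHS]addrACA [- F (pt d a.-1 j) + _]addrC.
Qed.

Lemma jumpB (V : zmodType) (F G H : nat * nat -> V) d a j : (forall k, H k = F k - G k) ->
  jump H d a j = jump F d a j - jump G d a j.
Proof.
move=> E; rewrite /jump !E !opprB addrACA [RHS]addrACA; congr (_ + _); exact: addrC.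
Qed.

Lemma mixedB (V : zmodType) (F G H : nat * nat -> V) d a j : (forall k, H k = F k - G k) ->
  mixed H d a j = mixed F d a j - mixed G d a j.
Proof.
move=> E; rewrite /mixed !(jumpB _ _ _ E) !opprB addrACA [RHS]addrACA.
congr (_ + _); exact: addrC.
Qed.

(** * Grid functions without jumps inside cells *)

Section GridFunctions.
Context {R : realType} (T : tmesh R) {V : zmodType}.
Implicit Types (d : bool) (k : nat * nat) (rho eta : {set edges T}) (x : {set edges T} * {set edges T}).
Local Notation n := (ngrid T).
Hypotheses (hT : is_tmesh T) (hred : reduced T).
Variable F : nat * nat -> V.
Hypothesis F_nosep : forall d a j, (a < n d)%N -> (0 < j < n (~~ d))%N -> ~~ sep T d a j ->
  jump F d a j = 0.

Lemma spans_between c d a a' i : (a <= i <= a')%N -> (a' < n d)%N -> grid_spans T c d a -> grid_spans T c d a' ->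
  grid_spans T c d i.
Proof.
move=> hi a'n /andP[h1 h2] /andP[h3 h4]; apply/andP; split.
  by apply: (le_trans h1); rewrite grid_leE; nlia.
by apply: (le_trans _ h4); rewrite grid_leE; nlia.
Qed.

Lemma cell_constant (c : cells T) k k' : ingrid T k -> ingrid T k' -> incell T (val c) k ->
  incell T (val c) k' -> F k = F k'.
Proof.
have step d a b t : (a < n d)%N -> (b + t < n (~~ d))%N -> incell T (val c) (pt d a b) ->
    incell T (val c) (pt d a (b + t)%N) -> F (pt d a b) = F (pt d a (b + t)%N).
  move=> an; elim: t => [|t IH]; first by rewrite addn0.
  rewrite addnS => btn; rewrite !incell_pt => /andP[sa sb] /andP[_ sbt].
  have sbt' : grid_spans T (val c) (~~ d) (b + t)%N by apply: spans_between sb sbt; nlia.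
  rewrite IH ?incell_pt ?sa ?sb ?sbt' //; last by nlia.
  have /eqP : jump F d a (b + t).+1 = 0.
    apply: F_nosep => //; rewrite /sep negbK; apply/existsP; exists c.
    by rewrite /= !incell_pt sa sbt sbt'.
  by rewrite subr_eq0 => /eqP.
have move_ d a b b' : (a < n d)%N -> (b < n (~~ d))%N -> (b' < n (~~ d))%N -> incell T (val c) (pt d a b) ->
    incell T (val c) (pt d a b') -> F (pt d a b) = F (pt d a b').
  move=> an bn b'n i1 i2; have [le|/ltnW le] := leqP b b'.
    by move: i2; rewrite -(subnKC le) => i2; apply: step => //; nlia.
  by move: i1; rewrite -(subnKC le) => i1; apply/esym; apply: step => //; nlia.
move=> /andP[k1 k2] /andP[k1' k2'] /andP[s1 s2] /andP[s1' s2'].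
case: k k' k1 k2 k1' k2' s1 s2 s1' s2' => [a b] [a' b'] /= k1 k2 k1' k2' s1 s2 s1' s2'.
transitivity (F (a, b')).
  by apply: (move_ true a b b') => //; rewrite /incell /= ?s1 ?s2 ?s2'.
by apply: (move_ false b' a a') => //; rewrite /incell /= ?s1 ?s1' ?s2'.
Qed.

Lemma jump_near0 rho a : rho \in MS T -> (a < n (horizontal rho))%N ->
  (a.+1 = ms_lo rho \/ a = ms_hi rho) -> jump F (horizontal rho) a (ms_line rho) = 0.
Proof.
move=> M an ha; have [r1 r2] := ms_range hT hred M; apply: F_nosep => //.
case: ha => E; last by rewrite E; apply: (ms_sep_hi hT hred) => //; rewrite -E.
by have := ms_sep_lo hT hred M; rewrite -E; apply.
Qed.

(** If no maximal segment of one direction reaches the grid vertex, both jumps in that direction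
    vanish; by the symmetry of the mixed difference either direction may be the missing one. *)
Lemma mixed_no_crossing d a j : (0 < a < n d)%N -> (0 < j < n (~~ d))%N ->
  (forall x, crossing x -> ms_line (along d x) = j -> ms_line (along (~~ d) x) = a -> False) ->
  mixed F d a j = 0.
Proof.
move=> ha hj nox.
have K d' a' j' : (0 < a' < n d')%N -> (0 < j' < n (~~ d'))%N ->
    (~ exists rho, [/\ rho \in MS T, horizontal rho = d', ms_line rho = j' & (ms_lo rho <= a' <= ms_hi rho)%N]) ->
    mixed F d' a' j' = 0.
  move=> ha' hj' no; rewrite /mixed !F_nosep ?subrr //; try nlia.
    apply/negP => /(ms_of_sep hT hred _ hj')[|rho [M hd hl h]]; first by nlia.
    by apply: no; exists rho; split=> //; nlia.
  apply/negP => /(ms_of_sep hT hred _ hj')[|rho [M hd hl h]]; first by nlia.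
  by apply: no; exists rho; split=> //; nlia.
have [[rho [M hd hl h]]|/K->//] := pselect (exists rho, [/\ rho \in MS T,
   horizontal rho = d, ms_line rho = j & (ms_lo rho <= a <= ms_hi rho)%N]).
rewrite -mixedC.
have [[eta [M' hd' hl' h']]|no] := pselect (exists rho, [/\ rho \in MS T,
   horizontal rho = ~~ d, ms_line rho = a & (ms_lo rho <= j <= ms_hi rho)%N]);
  last by apply: K; rewrite ?negbK.
exfalso; apply: (nox (pt d rho eta)); rewrite ?along_pt ?cross_pt //.
have cr : crosses rho eta by rewrite (crossesP hT hred) ?hd ?hd' // hl hl' h h'.
by rewrite /crossing; case: d hd hd' {ha hj nox h h' hl hl'} => /= hd hd'; rewrite M M' hd hd' //= crosses_sym.
Qed.

Lemma crossing_range x d : crossing x -> (0 < ms_line (along (~~ d) x) < n d)%N.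
Proof.
move=> vx; have [M1 M2 h1 h2 _] := crossing_along d vx.
by have [_] := ms_range hT hred M2; rewrite h2 negbK.
Qed.

Lemma crossing_inj x x' d : crossing x -> crossing x' -> along d x = along d x' ->
  ms_line (along (~~ d) x) = ms_line (along (~~ d) x') -> x = x'.
Proof.
move=> vx vx' E El.
have [M1 M2 h1 h2 _] := crossing_along d vx; have [M1' M2' h1' h2' _] := crossing_along d vx'.
have E2 : along (~~ d) x = along (~~ d) x'.
  apply: (@ms_eq _ T hT hred _ _ (ms_line (along d x))) => //; first by rewrite h2 h2'.
    by have := crossing_line hT hred (~~ d) vx; rewrite negbK.
  by have := crossing_line hT hred (~~ d) vx'; rewrite negbK E.
by rewrite -(pt_along d x) -(pt_along d x') E E2.
Qed.

(** The mixed differences telescope along [rho] to the jump past its high end minus the jump before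
    its low end, and both are 0. Grid vertices without a crossing add nothing. *)
Lemma mixed_sum_MIS rho : rho \in MIS T ->
  \sum_(x | crossing x && (along (horizontal rho) x == rho))
     mixed F (horizontal rho) (ms_line (along (~~ horizontal rho) x)) (ms_line rho) = 0.
Proof.
move=> Mi; have M := MIS_MS hT hred Mi; set d := horizontal rho; set j := ms_line rho.
have [r1 r2] := ms_range hT hred M; rewrite -/d -/j in r1 r2.
move: Mi; rewrite (ms_MIS hT hred M) => /andP[lo0 hin].
set lo := ms_lo rho in r1 lo0; set hi := ms_hi rho in r1 hin; rewrite -/d in hin.
transitivity (\sum_(lo <= a < hi.+1) mixed F d a j); last first.
  have jlo : jump F d lo.-1 j = 0.
    apply: jump_near0 => //; rewrite -/d -/lo -/hi; first by nlia.
    by left; rewrite prednK.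
  have jhi : jump F d hi j = 0 by apply: jump_near0 => //; right.
  transitivity (\sum_(lo <= a < hi.+1) (jump F d a.+1.-1 j - jump F d a.-1 j)); first by [].
  rewrite (telescope_sumr (fun a => jump F d a.-1 j)); last by nlia.
  by rewrite jlo [X in X - _]jhi subrr.
transitivity (\sum_(x | crossing x && (along d x == rho))
   \sum_(lo <= a < hi.+1) if ms_line (along (~~ d) x) == a then mixed F d a j else 0).
  apply: eq_bigr => x /andP[vx /eqP E].
  have := crossing_line hT hred d vx; rewrite E -/lo -/hi => hl.
  rewrite -big_mkcond /= (big_nat_widenl _ 0) // big_mkord.
  have hlt : (ms_line (along (~~ d) x) < hi.+1)%N by case/andP: hl; rewrite ltnS.
  rewrite (bigD1 (Ordinal hlt)) /=; last by rewrite eqxx /=; case/andP: hl.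
  rewrite [X in _ + X]big1 ?addr0 // => i /andP[/andP[/eqP E1 _] /eqP ne].
  by case: ne; apply: val_inj.
rewrite exchange_big /= big_nat_cond [RHS]big_nat_cond; apply: eq_bigr => a /andP[ha _].
have [[x [vx E1 E2]]|no] := pselect (exists x, [/\ crossing x, along d x = rho & ms_line (along (~~ d) x) = a]).
  rewrite (bigD1 x) /=; last by rewrite vx E1 eqxx.
  rewrite E2 eqxx big1 ?addr0 // => y /andP[/andP[vy /eqP E3] ne]; case: eqP => // E4.
  by case/eqP: ne; apply: (crossing_inj (d := d)) => //; rewrite ?E1 ?E3 ?E2 ?E4.
rewrite big1 => [|x /andP[vx /eqP E]]; last by case: eqP => // E'; case: no; exists x.
apply/esym/mixed_no_crossing; [nlia|exact: r2|] => x vx E1 E2; apply: no; exists x; split=> //.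
have [M1 M2 h1 h2 _] := crossing_along d vx.
apply: (@ms_eq _ T hT hred _ _ a) => //.
by rewrite -E2; exact: crossing_line.
Qed.

(** Without mixed differences the jump across a line is the same at every position. It is 0
    somewhere: by hypothesis if a cross-cut lies on the line, at position 0 if no segment starts
    there, and otherwise just past the inner end of the segment that starts there. *)
Lemma grid_function_eq0 : F (0, 0)%N = 0 ->
  (forall rho, rho \in CC T -> jump F (horizontal rho) 0%N (ms_line rho) = 0) ->
  (forall x, crossing x -> mixed F true (ms_line x.2) (ms_line x.1) = 0) ->
  forall k, ingrid T k -> F k = 0.
Proof.
move=> F0 FC FX.
have mix d a j : (0 < a < n d)%N -> (0 < j < n (~~ d))%N -> mixed F d a j = 0.
  move=> ha hj; have [[x [vx E1 E2]]|no] := pselect (exists x,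
    [/\ crossing x, ms_line (along d x) = j & ms_line (along (~~ d) x) = a]).
    by have := FX x vx; rewrite -E1 -E2; case: (d) => //=; rewrite -(mixedC _ false).
  by apply: mixed_no_crossing => // x vx E1 E2; apply: no; exists x.
have J0 d a j : (a < n d)%N -> (0 < j < n (~~ d))%N -> jump F d a j = jump F d 0%N j.
  move=> an hj; elim: a an => // a IH an.
  rewrite -IH; last by nlia.
  by apply/eqP; rewrite -subr_eq0; apply/eqP; apply: (mix d a.+1 j) => //; nlia.
have J d a j : (a < n d)%N -> (0 < j < n (~~ d))%N -> jump F d a j = 0.
  move=> an hj; rewrite J0 //; have n0 := ngrid_gt0 hT d.
  have [/(ms_of_sep hT hred n0 hj)[rho [M hd hl hr]]|ns] := boolP (sep T d 0 j); last exact: F_nosep.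
  have [r1 r2] := ms_range hT hred M; rewrite hd in r1 r2.
  have [E|ne] := eqVneq (ms_hi rho) (n d).
    by rewrite -hd -hl; apply: FC; rewrite (ms_CC hT hred M) hd E eqxx andbT; nlia.
  rewrite -(@J0 d (ms_hi rho) j) //; last by nlia.
  by rewrite -hd -hl; apply: jump_near0 => //; [rewrite hd; nlia|right].
have line d a j : (a < n d)%N -> (j < n (~~ d))%N -> F (pt d a j) = F (pt d a 0%N).
  move=> an; elim: j => // j IH jn; rewrite -IH; last by nlia.
  by apply/eqP; rewrite -subr_eq0; apply/eqP; apply: (J d a j.+1).
move=> [a b] /andP[/= an bn].
rewrite (line true a b an bn) (line false 0%N a) //=.
exact: ngrid_gt0.
Qed.

End GridFunctions.

(** * Splines as the kernel and relations as the image of [phi] *)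

Section Dimension.
Context {R : realType} (m m' : nat) (T : tmesh R) (r : edges T -> int).
Local Notation P := 'M[R]_(m.+1, m'.+1).
Local Notation Sg := {set edges T}.
Implicit Types (d : bool) (k : nat * nat) (rho eta : Sg) (x : Sg * Sg).
Local Notation g := (grid T).
Local Notation n := (ngrid T).
Local Notation S := {ffun cells T -> P}.
Local Notation L := (ms_poly r).
Local Notation Ix := (unit + (Sg + Sg * Sg))%type.
Local Notation Fam := {ffun Ix -> P}.
Local Notation coord_space := (coord_space m m' r).
Local Notation bspace := (corr_poly_space m m' r).
Local Notation qspace := (vertex_poly_space m m' r).
Implicit Types (z : Fam).
Hypotheses (hT : is_tmesh T) (hred : reduced T) (hr : is_smoothness r) (hc : constant_on_MS r).

Definition cell_rep (c : cells T) : nat * nat :=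
  xget (0, 0)%N [set k | ingrid T k /\ incell T (val c) k].

Lemma cell_repP c : ingrid T (cell_rep c) /\ incell T (val c) (cell_rep c).
Proof.
suff [k Hk] : exists k, ingrid T k /\ incell T (val c) k.
  exact: (@xgetPex _ _ [set k | ingrid T k /\ incell T (val c) k] (ex_intro _ k Hk)).
have K d : exists2 i, (i < n d)%N & grid_spans T (val c) d i.
  have /andP[/crd_grid[i hi Ei] /crd_grid[j hj Ej]] := crd_cell d (fsvalP c).
  have := cell_lt hT d (fsvalP c); rewrite Ei Ej grid_ltE // => lij.
  by exists i; [nlia|rewrite /grid_spans Ei Ej lexx grid_leE //; nlia].
have [i1 h1 s1] := K true; have [i2 h2 s2] := K false.
by exists (i1, i2); rewrite /ingrid /incell h1 h2 s1 s2.
Qed.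

(** Defined for all [z] in order to be linear; only for admissible [z] is the value independent of
    the square chosen in the cell, as in [value_at_psi]. *)
Definition psi z : S := [ffun c => spline_at r z (cell_rep c)].

Lemma spline_at_linear k : linear (fun z => spline_at r z k).
Proof.
apply: lin_add; last first.
  apply: lin_sum => x; apply: lin_scale; apply: lin_at; exact: mulpoly_is_linear.
apply: lin_add; first by move=> a u v; exact: ffun_linE.
apply: lin_sum => rho; apply: lin_scale; apply: lin_at; exact: mulpoly_is_linear.
Qed.

Lemma psi_linear : linear psi.
Proof. by apply: lin_ffun => c; exact: spline_at_linear. Qed.

Lemma value_at_psi z k : admissible r z -> ingrid T k -> value_at (psi z) k = spline_at r z k.
Proof.
move=> Z hk; have [c ck] := cell_at hT hred hk.
rewrite (value_atE hT _ hk ck) ffunE; have [h1 h2] := cell_repP c.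
apply: (cell_constant _ h1 hk h2 ck) => d a j an hj ns.
exact: (spline_at_nosep hT hred hr Z an hj ns).
Qed.

Lemma jump_psi z d a j : admissible r z -> (a < n d)%N -> (0 < j < n (~~ d))%N ->
  jump (value_at (psi z)) d a j = jump (spline_at r z) d a j.
Proof. by move=> Z an hj; rewrite /jump !value_at_psi // ingrid_pt an /=; nlia. Qed.

Lemma psi_spline z : admissible r z -> is_spline r (psi z).
Proof.
move=> Z; apply/(is_spline_grid hT hred hc) => rho a M ha.
have [r1 r2] := ms_range hT hred M.
rewrite jump_psi //; last by nlia.
by rewrite (spline_at_jump_on hT hred hr Z M ha); exact: seg_jump_dvd.
Qed.

Lemma spline_at_origin z : spline_at r z (0, 0)%N = z (icst T).
Proof.
have P0 rho : rho \in MS T -> past rho (0, 0)%N = false.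
  move=> M; have [_ /andP[l0 _]] := ms_range hT hred M.
  by rewrite /past; case: (~~ _); rewrite /= leqn0; apply/negbTE; rewrite -lt0n.
rewrite /spline_at /seg_expansion big1 ?addr0 => [|rho /(CC_MS hT hred)/P0->]; last by rewrite scale0r.
rewrite big1 ?addr0 // => x /and5P[/P0 h1 /P0 h2 _ _ _].
by rewrite /chi h1 h2 !andbF !subr0 scale0r.
Qed.

Lemma seg_jump_CC z rho : rho \in CC T -> seg_jump r z rho 0 = cterm r z rho.
Proof.
move=> C; have M := CC_MS hT hred C; rewrite /seg_jump /seg_expansion_jump C big1 ?addr0 //.
move=> x /andP[vx /eqP E].
have /andP[l0 _] := crossing_range hT hred (horizontal rho) vx.
move: C; rewrite (ms_CC hT hred M) /lowray => /andP[_ ->]; rewrite andbF leqn0.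
by rewrite -(negbK (_ == 0%N)) -lt0n l0 subrr scale0r.
Qed.

Lemma jump_spline_at z rho a : admissible r z -> rho \in MS T -> (a < n (horizontal rho))%N ->
  (ms_lo rho <= a.+1)%N -> (a <= ms_hi rho)%N ->
  jump (spline_at r z) (horizontal rho) a (ms_line rho) = seg_jump r z rho a.
Proof.
move=> Z M an h1 h2.
have [ha|out] := boolP (ms_lo rho <= a < ms_hi rho)%N; first exact: spline_at_jump_on.
rewrite seg_jump0 //; apply: (jump_near0 hT hred (fun d b j => @spline_at_nosep _ _ _ _ _ hT hred hr z d b j Z) M an).
by nlia.
Qed.

Lemma mixed_spline_at z x : admissible r z -> crossing x ->
  mixed (spline_at r z) true (ms_line x.2) (ms_line x.1) = dterm r z x.
Proof.
move=> Z vx; have [M1 M2 h1 h2 cr] := crossing_along true vx; rewrite /= in M1 M2 h1 h2 cr.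
have hl := crossing_line hT hred true vx; rewrite /= in hl.
have rg := crossing_range hT hred true vx; rewrite /= in rg.
rewrite /mixed -h1 !jump_spline_at //; rewrite ?h1; try nlia.
rewrite /seg_jump /seg_expansion_jump h1 opprD addrACA subrr add0r -sumrB (bigD1 x) /=; last by rewrite vx eqxx.
rewrite leqnn (_ : (ms_line x.2 <= (ms_line x.2).-1)%N = false); last by nlia.
rewrite -scalerBl opprB addrA subrK subr0 scale1r big1 ?addr0 //.
move=> y /andP[/andP[vy /eqP E] ne]; rewrite -scalerBl.
have ne2 : ms_line y.2 != ms_line x.2.
  by apply: contraNN ne => /eqP E2; apply/eqP; apply: (crossing_inj hT hred (d := true)).
rewrite (_ : (ms_line y.2 <= (ms_line x.2).-1)%N = (ms_line y.2 <= ms_line x.2)%N) ?subrr ?scale0r //.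
by move: ne2 rg; clear; move: (ms_line _) (ms_line _) => u v; lia.
Qed.

Lemma dvd_bspace rho (A : P) : poly_dvd (L rho) (bipoly A) ->
  exists2 B, B \in bspace rho & mulpoly (L rho) B = A.
Proof.
move=> [q E]; have := @bideg_bipoly R m m' A; rewrite E => HA.
have Eo := ms_orderE hr rho.
have Hq : (if horizontal rho then bideg_le m%:Z (m'%:Z - seg_smooth r rho - 1) q
           else bideg_le (m%:Z - seg_smooth r rho - 1) m'%:Z q).
  move: HA; rewrite /ms_poly /ell; case: (horizontal rho) => HA;
    apply: (bideg_le_line _ (coordinate rho) (ms_order r rho) _ _ _).1; apply: bideg_leW HA; move: Eo; clear; lia.
have Gs := seg_smooth_ge hr rho.
have Kq : bipoly (mxof m m' q) = q.
  by apply: mxofK; move: Hq; case: ifP => _; apply: bideg_leW; move: Gs; clear; lia.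
have Bq : mxof m m' q \in bspace rho.
  by rewrite /corr_poly_space; move: Hq; case: ifP => _ Hq; apply/mem_Rspace; rewrite Kq.
by exists (mxof m m' q) => //; apply: bipoly_inj; rewrite (bipoly_cterm hr Bq) Kq E.
Qed.

(** Powers of perpendicular lines are coprime, so [A] is divisible by their product; the exact
    degree shift then bounds the cofactor. *)
Lemma dvd_qspace x (A : P) : crossing x -> poly_dvd (L x.1) (bipoly A) -> poly_dvd (L x.2) (bipoly A) ->
  exists2 B, B \in qspace x & mulpoly (L x.1 * L x.2) B = A.
Proof.
move=> vx [q1 E1] [q2 E2]; have /and5P[_ _ h1 /negbTE h2 _] := vx.
have Eo1 := ms_orderE hr x.1; have Eo2 := ms_orderE hr x.2.
have Gs1 := seg_smooth_ge hr x.1; have Gs2 := seg_smooth_ge hr x.2.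
have [q E] : exists q, bipoly A = L x.2 * (L x.1 * q).
  move: E1 E2; rewrite /ms_poly /ell h1 h2 => E1 E2.
  exact: (line_coprime E2 E1).
have := @bideg_bipoly R m m' A; rewrite E => HA.
have Hq : bideg_le (m%:Z - seg_smooth r x.2 - 1) (m'%:Z - seg_smooth r x.1 - 1) q.
  move: HA; rewrite /ms_poly /ell h1 h2 => HA.
  apply: (bideg_le_line true (coordinate x.1) (ms_order r x.1) _ _ _).1.
  apply: (bideg_le_line false (coordinate x.2) (ms_order r x.2) _ _ _).1.
  by apply: bideg_leW HA; move: Eo1 Eo2; clear; lia.
have Kq : bipoly (mxof m m' q) = q by apply: mxofK; apply: bideg_leW Hq; move: Gs1 Gs2; clear; lia.
have Bq : mxof m m' q \in qspace x by apply/mem_Rspace; rewrite Kq.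
exists (mxof m m' q) => //; apply: bipoly_inj; rewrite (bipoly_dterm hr vx Bq) Kq E.
exact: mulrCA.
Qed.

Section Surjectivity.
Variable f : S.
Hypothesis f_spline : is_spline r f.
Let F := value_at f.

Lemma F_nosep d a j : (a < n d)%N -> (0 < j < n (~~ d))%N -> ~~ sep T d a j -> jump F d a j = 0.
Proof. by move=> an hj ns; rewrite /jump /F (value_at_nosep hT f an hj ns) subrr. Qed.

Lemma jump_dvd rho a : rho \in MS T -> (a < n (horizontal rho))%N -> (ms_lo rho <= a.+1)%N ->
  (a <= ms_hi rho)%N -> poly_dvd (L rho) (bipoly (jump F (horizontal rho) a (ms_line rho))).
Proof.
move=> M an h1 h2.
have [ha|out] := boolP (ms_lo rho <= a < ms_hi rho)%N; first exact: ((is_spline_grid hT hred hc f).1 f_spline _ _ M ha).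
rewrite (jump_near0 hT hred F_nosep M an) ?bipoly0; first exact: poly_dvd0.
by nlia.
Qed.

(** The mixed difference is a difference of two consecutive jumps across [along d x]. A jump just
    beyond an end of that segment is 0, so T-junctions are no exception. *)
Lemma mixed_dvd x d : crossing x ->
  poly_dvd (L (along d x)) (bipoly (mixed F true (ms_line x.2) (ms_line x.1))).
Proof.
move=> vx; have [M1 M2 h1 h2 cr] := crossing_along d vx.
have -> : mixed F true (ms_line x.2) (ms_line x.1) = mixed F d (ms_line (along (~~ d) x)) (ms_line (along d x)).
  by case: (d) => //=; rewrite -(mixedC F true).
have hl := crossing_line hT hred d vx; have rg := crossing_range hT hred d vx.
rewrite /mixed bipolyB; apply: poly_dvdD; last apply: poly_dvdN;
  rewrite -{2}h1; apply: jump_dvd => //; rewrite ?h1; nlia.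
Qed.

(** The coordinates are the cofactors of the first jumps across cross-cuts and of the mixed
    differences at crossings; the telescoping sum along each MIS makes the family admissible. *)
Lemma spline_coordinates : exists2 z, admissible r z &
  [/\ z (icst T) = F (0, 0)%N,
      forall rho, rho \in CC T -> cterm r z rho = jump F (horizontal rho) 0%N (ms_line rho) &
      forall x, crossing x -> dterm r z x = mixed F true (ms_line x.2) (ms_line x.1)].
Proof.
pose Q (i : Ix) (B : P) := B \in coord_space i /\ match i with
  | inl _ => B = F (0, 0)%N
  | inr (inl rho) => rho \in CC T -> mulpoly (L rho) B = jump F (horizontal rho) 0%N (ms_line rho)
  | inr (inr x) => crossing x -> mulpoly (L x.1 * L x.2) B = mixed F true (ms_line x.2) (ms_line x.1)
  end.
have [z0 Hz0] : exists z0 : Ix -> P, forall i, Q i (z0 i).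
  suff /choice[z0 Hz0] : forall i, exists B, Q i B by exists z0.
  case=> [[]|[rho|x]]; rewrite /Q /=.
  - by exists (F (0, 0)%N); rewrite memvf.
  - case: ifP => [C|_]; last by exists 0; rewrite mem0v.
    have M := CC_MS hT hred C; have := C; rewrite (ms_CC hT hred M) => /andP[/eqP lo0 /eqP hin].
    have := ngrid_gt0 hT (horizontal rho) => n0.
    have [|B HB EB] := @dvd_bspace rho (jump F (horizontal rho) 0%N (ms_line rho)); last by exists B.
    by apply: jump_dvd; rewrite ?lo0.
  case: ifP => [vx|_]; last by exists 0; rewrite mem0v.
  have [B HB EB] := dvd_qspace vx (mixed_dvd true vx) (mixed_dvd false vx).
  by exists B.
pose z : Fam := [ffun i => z0 i].
have E1 rho : rho \in CC T -> cterm r z rho = jump F (horizontal rho) 0%N (ms_line rho).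
  by move=> C; rewrite /cterm /z ffunE; exact: (Hz0 (iseg rho)).2.
have E2 x : crossing x -> dterm r z x = mixed F true (ms_line x.2) (ms_line x.1).
  by move=> C; rewrite /dterm /z ffunE; exact: (Hz0 (ipair x)).2.
have zU i : z i \in coord_space i by rewrite /z ffunE; exact: (Hz0 i).1.
exists z; last by split=> //; rewrite /z ffunE; exact: (Hz0 (icst T)).2.
split=> //; apply/ffunP => rho; rewrite phiE ffunE.
have [Mi|nMi] := boolP (rho \in MIS T); last first.
  apply: big1 => x _; rewrite /phi_term.
  by case: eqP => [<-|_] /=; rewrite ?(negbTE nMi) /=; case: eqP => [<-|_] //=; rewrite ?(negbTE nMi).
set d := horizontal rho.
under eq_bigr => x vx do rewrite (phi_term_MIS r z vx Mi).
suff H : \sum_(x | crossing x && (along d x == rho)) (mulpoly (L (along (~~ d) x)) (z (ipair x))) = 0.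
  rewrite -big_mkcondr /=; rewrite -/d; move: H; case: (d) => /= H; last exact: H.
  by rewrite sumrN H oppr0.
(* Multiplication by the nonzero [L rho] turns the terms into mixed differences, to which
   [mixed_sum_MIS] applies. *)
apply: bipoly_inj; rewrite bipoly0; apply: (mulfI (line_poly_neq0 (horizontal rho) (coordinate rho) (ms_order r rho))).
rewrite -[_ ^+ _]/(L rho) mulr0 bipoly_sum big_distrr /=.
have := mixed_sum_MIS hT hred F_nosep Mi => /(congr1 (@bipoly R m m')).
rewrite bipoly_sum bipoly0 => H; rewrite -[RHS]H; apply: eq_bigr => x /andP[vx /eqP E].
have HA : z (ipair x) \in qspace x by have := zU (ipair x); rewrite /= vx.
have -> : mixed F d (ms_line (along (~~ d) x)) (ms_line rho) = dterm r z x.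
  rewrite E2 // -E; case: (d) => //=; by rewrite -(mixedC F true).
rewrite /dterm (bipoly_dterm hr vx HA) (mul_along d (fun eta => L eta)) E; congr (_ * _).
exact: (bipoly_qterm hr (~~ d) vx HA).
Qed.

End Surjectivity.

Lemma spline_data_inj (f : S) : is_spline r f ->
  value_at f (0, 0)%N = 0 ->
  (forall rho, rho \in CC T -> jump (value_at f) (horizontal rho) 0%N (ms_line rho) = 0) ->
  (forall x, crossing x -> mixed (value_at f) true (ms_line x.2) (ms_line x.1) = 0) -> f = 0.
Proof.
move=> fs f0 fC fX; apply: (value_at_eq0 hT) => k hk.
exact: (grid_function_eq0 hT hred (F_nosep f)).
Qed.

Lemma origin_ingrid : ingrid T (0, 0)%N.
Proof. by rewrite /ingrid /= !(ngrid_gt0 hT). Qed.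

Lemma psi_data z : admissible r z ->
  [/\ value_at (psi z) (0, 0)%N = z (icst T),
      forall rho, rho \in CC T -> jump (value_at (psi z)) (horizontal rho) 0%N (ms_line rho) = cterm r z rho &
      forall x, crossing x -> mixed (value_at (psi z)) true (ms_line x.2) (ms_line x.1) = dterm r z x].
Proof.
move=> Z; split=> [|rho C|x vx].
- by rewrite value_at_psi ?spline_at_origin //; exact: origin_ingrid.
- have M := CC_MS hT hred C; have [r1 r2] := ms_range hT hred M.
  have n0 := ngrid_gt0 hT (horizontal rho).
  have := C; rewrite (ms_CC hT hred M) => /andP[/eqP lo0 /eqP hin].
  by rewrite jump_psi // jump_spline_at ?lo0 // seg_jump_CC.
have rg := crossing_range hT hred true vx; have rg2 := crossing_range hT hred false vx.
rewrite /= in rg rg2.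
rewrite -(mixed_spline_at Z vx) /mixed !jump_psi //; nlia.
Qed.

Definition admissible_space : {vspace Fam} := span_set (admissible r).

Lemma mem_admissible z : z \in admissible_space <-> admissible r z.
Proof.
apply: mem_span_set => [|a u w [hu eu] [hw ew]].
  split=> [i|]; first by rewrite ffunE mem0v.
  by apply/ffunP => rho; rewrite phiE ffunE; apply: big1 => x _; rewrite phi_term0 ?ffunE.
split=> [i|]; first by rewrite ffun_linE memvD ?memvZ.
by rewrite (phi_linear r a u w) eu ew scaler0 addr0.
Qed.

Lemma dim_spline_space : \dim (spline_space m m' r) = \dim admissible_space.
Proof.
apply/esym/(linear_bij_dim psi_linear).
- by move=> z /mem_admissible Z; apply/mem_spline_space; exact: psi_spline.
- move=> f /mem_spline_space fs; have [z Z [e1 e2 e3]] := spline_coordinates fs.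
  exists z; first exact/mem_admissible.
  have [p1 p2 p3] := psi_data Z.
  apply/eqP; rewrite -subr_eq0; apply/eqP; apply: spline_data_inj.
  + apply/mem_spline_space; rewrite memvB //; apply/mem_spline_space => //; exact: psi_spline.
  + by rewrite value_atB p1 e1 subrr.
  + by move=> rho C; rewrite (jumpB _ _ _ (value_atB (psi z) f)) p2 // e2 // subrr.
  by move=> x vx; rewrite (mixedB _ _ _ (value_atB (psi z) f)) p3 // e3 // subrr.
move=> z /mem_admissible Z pz; have [p1 p2 p3] := psi_data Z; rewrite pz in p1 p2 p3.
have v0 k : value_at (0 : S) k = 0 by rewrite /value_at; case: pickP => // c _; rewrite ffunE.
have zU := Z.1.
apply/ffunP => i; rewrite [RHS]ffunE; case: i => [[]|[rho|x]].
- by rewrite -[inl tt]/(icst T) -p1 v0.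
- have := zU (iseg rho); rewrite /=; case: ifP => [C HA|_]; last by rewrite memv0 => /eqP.
  have := p2 rho C; rewrite /jump !v0 subrr /cterm => /esym/(congr1 (@bipoly R m m')).
  rewrite (bipoly_cterm hr HA) bipoly0 => /eqP; rewrite mulf_eq0 (negbTE (line_poly_neq0 _ _ _)) /=.
  by rewrite -(bipoly0 m m') => /eqP/bipoly_inj.
have := zU (ipair x); rewrite /=; case: ifP => [vx HA|_]; last by rewrite memv0 => /eqP.
have := p3 x vx; rewrite /mixed /jump !v0 !subrr /dterm => /esym/(congr1 (@bipoly R m m')).
rewrite (bipoly_dterm hr vx HA) bipoly0 => /eqP; rewrite !mulf_eq0 !(negbTE (line_poly_neq0 _ _ _)) /=.
by rewrite -(bipoly0 m m') => /eqP/bipoly_inj.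
Qed.

(** A vertex relation is the image under [phi] of a family supported at one crossing, and crossings
    are the same as interior vertices with a horizontal and a vertical member of [MS] through
    them. *)
Lemma mem_relations w : w \in relations m m' r <-> exists2 z, z \in prodv coord_space & phi r z = w.
Proof.
have term z x rho : crossing x -> z \in prodv coord_space -> bipoly (phi_term r z x rho) =
    if (rho == x.2) && (x.2 \in MIS T) then L x.1 * bipoly (z (ipair x))
    else if (rho == x.1) && (x.1 \in MIS T) then - (L x.2 * bipoly (z (ipair x))) else 0.
  move=> vx /mem_prodv zU; have HA : z (ipair x) \in qspace x by have := zU (ipair x); rewrite /= vx.
  rewrite /phi_term; case: ifP => _; first exact: (bipoly_qterm hr true vx HA).
  case: ifP => _; last by rewrite bipoly0.
  by rewrite bipolyN; congr (- _); exact: (bipoly_qterm hr false vx HA).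
split; last first.
  move=> [z zU <-]; have -> : phi r z = \sum_(x | crossing x) [ffun rho => phi_term r z x rho].
    by apply/ffunP => rho; rewrite phiE sum_ffunE; apply: eq_bigr => x _; rewrite ffunE.
  apply: memv_suml => x vx; apply: (span_setP _).1.
  have /and5P[M1 M2 h1 h2 cr] := vx.
  have [|g1 g2 g3 g4] := crosses_vertex hT hred M1 M2 _ cr; first by rewrite h1 (negbTE h2).
  exists (vertex x.1 x.2), x.1, x.2, (bipoly (z (ipair x))); split=> //.
    by apply/mem_Rspace; move/mem_prodv: zU => /(_ (ipair x)); rewrite /= vx.
  by move=> rho; rewrite ffunE term.
have [W HW] : exists W : {vspace corr_family m m' T},
    forall w, w \in W <-> exists2 z, z \in prodv coord_space & phi r z = w.
  exact: (linear_image (phi_linear r) (prodv coord_space)).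
suff sub : (relations m m' r <= W)%VS by move=> /(subvP sub)/HW.
apply: (span_setP _).2 => {}w [p [rh [rv [q [gi [M1 h1 o1] [M2 h2 o2] Hq Hw]]]]].
apply/HW; pose x := (rh, rv).
have vx : crossing x.
  by rewrite /crossing M1 M2 h1 h2 /=; apply/asboolP; exists p.
have Gs1 := seg_smooth_ge hr rh; have Gs2 := seg_smooth_ge hr rv.
have Kq : bipoly (mxof m m' q) = q.
  by apply: mxofK; apply: bideg_leW Hq; move: Gs1 Gs2; clear; lia.
pose z : Fam := inject_at (ipair x) (mxof m m' q).
have zx : z (ipair x) = mxof m m' q by rewrite ffunE eqxx.
have z0 i : i != ipair x -> z i = 0 by rewrite ffunE => /negbTE->.
have zU : z \in prodv coord_space.
  apply/mem_prodv => i; have [->|/z0->] := eqVneq i (ipair x); last exact: mem0v.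
  by rewrite zx /= vx; apply/mem_Rspace; rewrite Kq.
exists z => //; apply/ffunP => rho; apply: bipoly_inj; rewrite phiE (bigD1 x) //= big1 => [|y /andP[vy ne]].
  by rewrite addr0 Hw term // zx Kq.
apply: bipoly_inj; rewrite term // z0 ?bipoly0 ?mulr0 ?oppr0 ?if_same //.
Qed.

(** Rank-nullity for [phi]: [psi] identifies its kernel with the spline space, and its image is the
    space of relations. *)
Lemma spline_dim : (\dim (spline_space m m' r) + \dim (relations m m' r) = \sum_i \dim (coord_space i))%N.
Proof.
rewrite dim_spline_space -dim_prodv; apply: (rank_nullity (phi_linear r)).
  by move=> w; exact: mem_relations.
by move=> z; split=> [/mem_admissible[/mem_prodv]|[/mem_prodv zU e]]; [|apply/mem_admissible].
Qed.

End Dimension.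

(** * Hermite spanning *)

Section Hermite.
Context {F : numFieldType}.
Implicit Types (p u : {poly F}) (a b y : F).

Lemma poly_eq_values p u : (forall y, p.[y] = u.[y]) -> p = u.
Proof.
move=> H; apply/eqP; rewrite -subr_eq0; apply/eqP.
apply: (@roots_geq_poly_eq0 _ _ [seq i%:R | i <- iota 0 (size (p - u))]).
- by apply/allP => y _; rewrite /root hornerD hornerN H subrr.
- rewrite map_inj_uniq ?iota_uniq // => i j /eqP; rewrite eqr_nat => /eqP //.
- by rewrite size_map size_iota.
Qed.

Lemma coprimep_prod_XsubC (I : finType) (s : I -> F) (k : I -> nat) (l : seq I) i :
  i \notin l -> {in i :: l &, injective s} ->
  coprimep (('X - (s i)%:P) ^+ k i) (\prod_(j <- l) ('X - (s j)%:P) ^+ k j).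
Proof.
elim: l => [|j l IH]; first by rewrite big_nil coprimep1.
rewrite inE negb_or => /andP[ij il] inj; rewrite big_cons coprimepMr; apply/andP; split.
  apply: coprimep_expl; apply: coprimep_expr; apply: coprimep_XsubC2.
  rewrite subr_eq0; apply: contraNneq ij => E.
  by apply/eqP/inj; rewrite ?inE ?eqxx ?orbT.
apply: IH => // x y xl yl; apply: inj; [move: xl|move: yl];
  by rewrite !inE => /orP[]->; rewrite ?orbT.
Qed.

Lemma prod_XsubC_dvdp (I : finType) (s : I -> F) (k : I -> nat) (l : seq I) p :
  uniq l -> {in l &, injective s} -> (forall i, i \in l -> ('X - (s i)%:P) ^+ k i %| p) ->
  \prod_(i <- l) ('X - (s i)%:P) ^+ k i %| p.
Proof.
elim: l => [|i l IH] /=; first by rewrite big_nil dvd1p.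
move=> /andP[il ul] inj H; rewrite big_cons Gauss_dvdp; last exact: coprimep_prod_XsubC.
rewrite H ?inE ?eqxx //=; apply: IH => // [x y xl yl|j jl].
  by apply: inj; rewrite inE ?xl ?yl orbT.
by apply: H; rewrite inE jl orbT.
Qed.

Section Functional.
Variables (m : nat) (phi : {poly F} -> F).
Hypothesis phi_lin : forall a p u, phi (a *: p + u) = a * phi p + phi u.

Lemma phi0 : phi 0 = 0.
Proof. by have := phi_lin (-1) 0 0; rewrite scaler0 addr0 mulN1r addNr. Qed.
Lemma phiD p u : phi (p + u) = phi p + phi u.
Proof. by rewrite -[p]scale1r phi_lin scale1r mul1r. Qed.
Lemma phiZ a p : phi (a *: p) = a * phi p.
Proof. by rewrite -[a *: p]addr0 phi_lin phi0 addr0. Qed.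
Lemma phi_sum I (l : seq I) (Q : pred I) (G : I -> {poly F}) :
  phi (\sum_(i <- l | Q i) G i) = \sum_(i <- l | Q i) phi (G i).
Proof. exact: (big_morph phi phiD phi0). Qed.

(* The dual polynomial b |-> phi ((X - b)^m), expanded around a. *)
Definition dual a : {poly F} :=
  \sum_(j < m.+1) ((-1) ^+ j * phi (('X - a%:P) ^+ (m - j)) *+ 'C(m, j)) *: 'X^j.

Lemma horner_dual a y : (dual a).[y] = phi (('X - (a + y)%:P) ^+ m).
Proof.
rewrite /dual horner_sum polyCD opprD addrA exprBn phi_sum; apply: eq_bigr => j _.
rewrite hornerZ hornerXn.
have -> : (-1) ^+ j * ('X - a%:P) ^+ (m - j) * y%:P ^+ j = ((-1) ^+ j * y ^+ j) *: ('X - a%:P) ^+ (m - j).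
  by rewrite -mul_polyC polyCM !polyC_exp polyCN polyC1 mulrAC.
rewrite -[X in _ = phi X]scaler_nat !phiZ -[_ *+ 'C(m, j)]mulr_natl -!mulrA.
by congr (_ * (_ * _)); rewrite mulrC.
Qed.

(** Both sides take the value [phi ((X - (a + y))^m)] at [y]; thus [dual a] is the Taylor expansion
    of [dual 0] at [a]. *)
Lemma dual_shift a : dual 0 \Po ('X + a%:P) = dual a.
Proof.
apply: poly_eq_values => y.
by rewrite horner_comp hornerD hornerX hornerC !horner_dual add0r [a + y]addrC.
Qed.

Lemma size_dual a : (size (dual a) <= m.+1)%N.
Proof.
apply: (leq_trans (size_sum _ _ _)); apply/bigmax_leqP => j _.
by apply: (leq_trans (size_scale_leq _ _)); rewrite size_polyXn.
Qed.

Lemma coef_dual a j : (j <= m)%N ->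
  (dual a)`_j = (-1) ^+ j * phi (('X - a%:P) ^+ (m - j)) *+ 'C(m, j).
Proof.
move=> hj; rewrite /dual coef_sum (bigD1 (Ordinal (hj : (j < m.+1)%N))) //= coefZ coefXn eqxx mulr1.
rewrite big1 ?addr0 // => i ne; rewrite coefZ coefXn; case: eqP => [E|_]; last by rewrite mulr0.
by case/eqP: ne; apply: val_inj.
Qed.

(** The coefficient of degree [j] in [dual a] is a multiple of the value of [phi] at
    [(X - a)^(m - j)]. Those with [j < k] vanish, so [dual 0] has a zero of order at least [k] at
    [a]. *)
Lemma dual_dvdp a k : (forall e, (m < e + k)%N -> (e <= m)%N -> phi (('X - a%:P) ^+ e) = 0) ->
  ('X - a%:P) ^+ k %| dual 0.
Proof.
move=> H; have [q Eq] : exists q, dual a = q * 'X^k.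
  exists (drop_poly k (dual a)); rewrite -{1}(poly_take_drop k (dual a)).
  rewrite (_ : take_poly k _ = 0) ?add0r //; apply/polyP => j; rewrite coef_take_poly coef0.
  case: ifP => // jk; have [jm|mj] := leqP j m.
    by rewrite coef_dual // H ?mulr0 ?mul0rn //; lia.
  by apply: nth_default; apply: (leq_trans (size_dual a)).
have -> : dual 0 = dual a \Po ('X - a%:P).
  by rewrite -(dual_shift a) -comp_polyA comp_polyD comp_polyX comp_polyC subrK comp_polyXr.
by rewrite Eq comp_polyM comp_Xn_poly dvdp_mull.
Qed.

Lemma dual_eq0 : dual 0 = 0 -> forall t, (t <= m)%N -> phi 'X^t = 0.
Proof.
move=> D0 t tm; have := @coef_dual 0 (m - t)%N (leq_subr _ _); rewrite D0 coef0 subr0 subKn //.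
move=> /esym/eqP; rewrite mulrn_eq0 mulf_eq0 signr_eq0 /= orbC => /orP[/eqP//|/eqP E].
by have := bin_gt0 m (m - t)%N; rewrite E leq_subr.
Qed.

End Functional.

(** Duality: a functional vanishing on the span has a dual polynomial of degree at most [m] with a
    zero of order [m + 1 - n_i] at each [s_i]. The orders add up to at least [m + 1], so the dual
    polynomial is 0, and the functional kills all powers up to [m]. A point with [n_i > m]
    contributes nothing, by truncation. *)
Lemma hermite_span (m : nat) (I : finType) (Q : pred I) (s : I -> F) (n : I -> nat) u :
  {in Q &, injective s} -> (m.+1 <= \sum_(i | Q i) (m.+1 - n i))%N -> (size u <= m.+1)%N ->
  exists q : I -> {poly F}, (forall i, size (q i) <= m.+1 - n i)%N /\ u = \sum_(i | Q i) ('X - (s i)%:P) ^+ n i * q i.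
Proof.
move=> inj le_sum su.
pose W (v : 'rV[F]_m.+1) := exists q : I -> {poly F}, (forall i, size (q i) <= m.+1 - n i)%N /\
  v = poly_rV (\sum_(i | Q i) ('X - (s i)%:P) ^+ n i * q i).
have size_term i (q : {poly F}) : (size q <= m.+1 - n i)%N -> (size (('X - (s i)%:P) ^+ n i * q)%R <= m.+1)%N.
  move=> sq; have [->|q0] := eqVneq q 0; first by rewrite mulr0 size_poly0.
  rewrite size_monicM ?monic_exp ?monicXsubC // size_exp_XsubC.
  by move: sq q0; rewrite -size_poly_gt0; case: (size q) => // k; lia.
have WP v : v \in span_set W <-> W v.
  apply: mem_span_set => [|a x w [q1 [h1 ->]] [q2 [h2 ->]]].
    exists (fun=> 0); split=> [i|]; first by rewrite size_poly0.
    by rewrite big1 ?linear0 // => i _; rewrite mulr0.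
  exists (fun i => a *: q1 i + q2 i); split=> [i|].
    apply: (leq_trans (size_polyD _ _)); rewrite geq_max h2 andbT.
    exact: (leq_trans (size_scale_leq _ _)).
  rewrite -linearP scaler_sumr -big_split /=; congr poly_rV; apply: eq_bigr => i _.
  by rewrite mulrDr scalerAr.
suff full : poly_rV u \in span_set W.
  have [q [hq E]] := (WP _).1 full; exists q; split=> //.
  rewrite -(poly_rV_K su) E poly_rV_K //; apply: (leq_trans (size_sum _ _ _)).
  by apply/bigmax_leqP => i _; exact: size_term.
rewrite -quot_map_eq0; apply/eqP/rowP => j.
(* Each coordinate of the quotient map is a functional vanishing on the span, and together the
   coordinates detect membership. *)
pose phi p := quot_map (span_set W) (poly_rV p) 0 j.
have phi_lin a p w : phi (a *: p + w) = a * phi p + phi w by rewrite /phi !linearP !mxE.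
have dvd i : Q i -> ('X - (s i)%:P) ^+ (m.+1 - n i) %| dual m phi 0.
  move=> Qi; apply: (dual_dvdp phi_lin) => e e1 e2.
  rewrite /phi; suff /eqP-> : quot_map (span_set W) (poly_rV (('X - (s i)%:P) ^+ e)) == 0 by rewrite mxE.
  rewrite quot_map_eq0; apply/WP.
  exists (fun i' => if i' == i then ('X - (s i)%:P) ^+ (e - n i) else 0); split=> [i'|].
    by case: eqP => [->|_]; rewrite ?size_poly0 // size_exp_XsubC; lia.
  rewrite (bigD1 i) //= eqxx big1 ?addr0 => [|i' /andP[_ /negbTE->]]; last by rewrite mulr0.
  by rewrite -exprD subnKC //; lia.
have D0 : dual m phi 0 = 0.
  apply: contraTeq le_sum => nz; rewrite -ltnNge.
  have dp : \prod_(i <- enum Q) ('X - (s i)%:P) ^+ (m.+1 - n i) %| dual m phi 0.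
    apply: prod_XsubC_dvdp; first exact: enum_uniq.
      by move=> x y; rewrite !mem_enum; exact: inj.
    by move=> i; rewrite mem_enum; exact: dvd.
  have := dvdp_leq nz dp; rewrite big_enum /= size_prod; last first.
    by move=> i _; rewrite expf_neq0 // polyXsubC_eq0.
  under eq_bigr => i _ do rewrite size_exp_XsubC -addn1.
  rewrite big_split /= sum1_card => /leq_trans/(_ (size_dual m phi 0)).
  by rewrite -addSn addnK.
rewrite mxE -[LHS]/(phi u) -[u]coefK poly_def (phi_sum phi_lin) big1 // => i _.
rewrite (phiZ phi_lin) (dual_eq0 D0) ?mulr0 //.
by rewrite -ltnS; exact: leq_trans (ltn_ord i) su.
Qed.

End Hermite.

Local Arguments line_poly : simpl never.

(** * Bivariate spanning by powers of parallel lines *)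

Section LinesSpan.
Context {R : realType} (I : finType) (Q : pred I) (c : I -> R) (n : I -> nat).

Lemma bideg_swapXY a b (p : {poly {poly R}}) : bideg_le a b p -> bideg_le b a (swapXY p).
Proof. by move=> H i j; rewrite coef_swapXY andbC; exact: H. Qed.

Lemma vertical_lines_span (m : nat) b p : {in Q &, injective c} ->
  (m.+1 <= \sum_(i | Q i) (m.+1 - n i))%N -> bideg_le m%:Z b p ->
  exists q : I -> {poly {poly R}}, (forall i, bideg_le (m%:Z - (n i)%:Z) b (q i)) /\
    p = \sum_(i | Q i) line_poly false (c i) ^+ n i * q i.
Proof.
move=> inj le_sum Hp; set w := swapXY p.
have Hw : bideg_le b m%:Z w by exact: bideg_swapXY.
have sw (j : nat) : (size (w`_j)%R <= m.+1)%N.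
  apply/leq_sizeP => i mi; apply/eqP; apply: contraTT mi => /(Hw j i); lia.
(* [hermite_span] is applied to the coefficient of each power of [t]. Choosing zero cofactors for a
   zero coefficient keeps the degree in [t] within [b]. *)
have [qq Hq] : exists qq : nat -> I -> {poly R}, forall j,
    [/\ forall i, (size (qq j i) <= m.+1 - n i)%N,
        w`_j = \sum_(i | Q i) ('X - (c i)%:P) ^+ n i * qq j i & w`_j = 0 -> forall i, qq j i = 0].
  suff /choice[qq Hqq] : forall j, exists q : I -> {poly R},
    [/\ forall i, (size (q i) <= m.+1 - n i)%N,
        w`_j = \sum_(i | Q i) ('X - (c i)%:P) ^+ n i * q i & w`_j = 0 -> forall i, q i = 0] by exists qq.
  move=> j; have [w0|w0] := eqVneq w`_j 0.
    exists (fun=> 0); split=> // [i|]; first by rewrite size_poly0.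
    by rewrite big1 // => i _; rewrite mulr0.
  have [q [h1 h2]] := hermite_span inj le_sum (sw j).
  by exists q; split=> // w1; rewrite w1 eqxx in w0.
pose t i := \poly_(j < size w) qq j i.
exists (fun i => swapXY (t i)); split=> [i a j|].
  rewrite coef_swapXY coef_poly; case: ifP => _; last by rewrite coef0 eqxx.
  have [h1 h2 h3] := Hq j => nz.
  have an : (a < m.+1 - n i)%N.
    by apply: leq_trans (h1 i); rewrite ltnNge; apply: contraNN nz => /leq_sizeP->.
  have w0 : w`_j != 0 by apply: contraNneq nz => /h3->; rewrite coef0.
  have l0 : lead_coef (w`_j) != 0 by rewrite lead_coef_eq0.
  have := Hw _ _ l0; move: an; clear; lia.
rewrite -[LHS]swapXYK -/w -[RHS]swapXYK; congr swapXY; rewrite rmorph_sum /=.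
apply/polyP => j; rewrite coef_sum.
under eq_bigr => i _ do rewrite swapXY_lineM swapXYK line_poly_true -polyC_exp coefCM coef_poly.
have [_ E h3] := Hq j; rewrite E; apply: eq_bigr => i _.
case: ltnP => // sj; rewrite (_ : qq j i = 0) ?mulr0 //.
by apply: h3; exact: nth_default.
Qed.

Lemma lines_span h (m : nat) a b p : {in Q &, injective c} ->
  (m.+1 <= \sum_(i | Q i) (m.+1 - n i))%N -> (if h then b else a) = m%:Z -> bideg_le a b p ->
  exists q : I -> {poly {poly R}},
    (forall i, bideg_le (a - if h then 0 else (n i)%:Z) (b - if h then (n i)%:Z else 0) (q i)) /\
    p = \sum_(i | Q i) line_poly h (c i) ^+ n i * q i.
Proof.
move=> inj le_sum; case: h => E Hp.
  rewrite E in Hp *; have [q [h1 h2]] := vertical_lines_span inj le_sum (bideg_swapXY Hp).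
  exists (fun i => swapXY (q i)); split=> [i|]; first by rewrite subr0; exact: bideg_swapXY.
  rewrite -[LHS]swapXYK h2 rmorph_sum /=; apply: eq_bigr => i _.
  by rewrite swapXY_lineM.
rewrite E in Hp *; have [q [h1 h2]] := vertical_lines_span inj le_sum Hp.
by exists q; split=> // i; rewrite subr0.
Qed.

End LinesSpan.

Section Deletion.
Context {R : realType} (m m' : nat) (T : tmesh R) (r : edges T -> int).
Local Notation Sg := {set edges T}.
Implicit Types (d : bool) (rho eta : Sg) (x : Sg * Sg) (A : {set Sg}).
Local Notation bspace := (corr_poly_space m m' r).
Hypotheses (hT : is_tmesh T) (hred : reduced T) (hr : is_smoothness r) (hc : constant_on_MS r).

(** The degree bound in the variable that runs along [rho], one less than [threshold]. *)
Definition along_degree rho : nat := if horizontal rho then m else m'.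

Definition crossing_free A rho eta : bool :=
  [&& eta \in MS T, horizontal eta == ~~ horizontal rho, crosses rho eta & eta \notin A].

Lemma smooth_at_vertex rho eta : rho \in MS T -> eta \in MS T -> horizontal eta = ~~ horizontal rho ->
  crosses rho eta ->
  (if horizontal rho then mu_h m r (vertex rho eta) else mu_v m' r (vertex rho eta)) =
  Num.max ((along_degree rho)%:Z - seg_smooth r eta) 0.
Proof.
move=> Mr Me hd cr; have [g1 g2 g3 g4] := crosses_vertex hT hred Mr Me hd cr.
rewrite /mu_h /mu_v /horizontal_smooth_at /vertical_smooth_at /along_degree.
case h : (horizontal rho); rewrite h /= in hd; case: pickP => [eta' /and3P[M' h' o']|/(_ eta)];
  rewrite ?Me ?hd ?g2 //.
  by rewrite (ms_uniq_at hT hred g3 M' Me _ o' g2) // hd; apply/negbTE.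
by rewrite (ms_uniq_at hT hred g3 M' Me _ o' g2) // hd.
Qed.

(** Every vertex of an MIS lies on exactly one perpendicular maximal segment. A member of [A]
    through the vertex other than [rho] can only be that one, so the vertices in [Mono] correspond
    to the crossing segments outside [A]. *)
Lemma weightE A rho : A \subset MIS T -> rho \in A ->
  weight m m' r A rho =
  \sum_(eta | crossing_free A rho eta) Num.max ((along_degree rho)%:Z - seg_smooth r eta) 0.
Proof.
move=> /fintype.subsetP sA rA; have Mi := sA _ rA; have M := MIS_MS hT hred Mi.
have [e0 er0] : exists e, e \in rho.
  by have [/finset.set0Pn] := MShat_segment (MS_MShat hT hred M).
(* A default vertex, so that [vertex rho eta] can be named in the finite type of vertices; it is not
   taken at an actual crossing. *)
have v0 : seg_lo (val e0) \in verts T.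
  by rewrite in_fsetU; apply/orP; left; apply/imfsetP; exists (val e0) => //=; exact: fsvalP.
pose v eta : verts T := insubd [` v0]%fset (vertex rho eta).
have vE eta : crossing_free A rho eta -> val (v eta) = vertex rho eta.
  move=> /and4P[Me /eqP hd cr _]; have [_ _ gv _] := crosses_vertex hT hred M Me hd cr.
  by rewrite /v val_insubd gv.
have MonoE : Mono A rho = [set v eta | eta in [set eta | crossing_free A rho eta]%SET]%SET.
  apply/finset.setP => gg; rewrite inE; apply/andP/imsetP => [[gr /forallP/= H]|[eta]].
    have [eta [Me hd ge]] := cross_at_MIS hT hred Mi (fsvalP gg) gr.
    have Ev := vertex_unique (MShat_segment (MS_MShat hT hred M)) (MShat_segment (MS_MShat hT hred Me)) hd gr ge.
    have cf : crossing_free A rho eta.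
      rewrite /crossing_free Me hd eqxx /=; apply/andP; split.
        by apply/asboolP; exists (val gg).
      apply/negP => eA; have := H eta; rewrite !inE eA ge /= andbT implybF negbK.
      by move=> /eqP E; move: hd; rewrite E; case: (horizontal rho).
    by exists eta; [rewrite inE|apply: val_inj; rewrite vE].
  rewrite inE => cf ->; rewrite vE //; have /and4P[Me /eqP hd cr eA] := cf.
  have [g1 g2 g3 _] := crosses_vertex hT hred M Me hd cr; split=> //.
  apply/forallP => eta'; apply/implyP; rewrite !inE => /andP[ne e'A]; apply/negP => o'.
  have Me' := MIS_MS hT hred (sA _ e'A).
  have [E|/negbTE E] := eqVneq (horizontal eta') (horizontal rho).
    by case/eqP: ne; exact: (ms_uniq_at hT hred g3 Me' M E o' g1).
  have E' : horizontal eta' = horizontal eta by rewrite hd; move: E; do 2 case: horizontal.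
  by case/negP: eA; rewrite -(ms_uniq_at hT hred g3 Me' Me E' o' g2).
have inj : {in [set eta | crossing_free A rho eta]%SET &, injective v}.
  move=> e1 e2; rewrite !inE => c1 c2 /(congr1 val); rewrite !vE // => E.
  have /and4P[M1 /eqP h1 k1 _] := c1; have /and4P[M2 /eqP h2 k2 _] := c2.
  have [_ o1 g1 _] := crosses_vertex hT hred M M1 h1 k1; have [_ o2 _ _] := crosses_vertex hT hred M M2 h2 k2.
  by apply: (ms_uniq_at hT hred g1 M1 M2 _ o1); rewrite ?h1 ?h2 // E.
transitivity (\sum_(gg in Mono A rho) (if horizontal rho then mu_h m r (val gg) else mu_v m' r (val gg))).
  by rewrite /weight; case: (horizontal rho).
rewrite MonoE big_imset //=; apply: eq_big => [eta|eta]; rewrite inE // => cf.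
by rewrite vE //; have /and4P[Me /eqP hd cr _] := cf; exact: smooth_at_vertex.
Qed.

(** With [n = r + 1], the truncated difference of [along_degree + 1] and [n] equals the positive
    part of [along_degree - r]; the weight condition is thus the count that [hermite_span]
    requires. *)
Lemma diagonalizable_sum A rho : A \subset MIS T -> rho \in diagonalizable_MIS m m' r A ->
  ((along_degree rho).+1 <= \sum_(eta | crossing_free A rho eta) ((along_degree rho).+1 - ms_order r eta))%N.
Proof.
move=> sA; rewrite inE => /andP[rA]; rewrite weightE // /threshold -lez_nat => H.
suff -> : (\sum_(eta | crossing_free A rho eta) ((along_degree rho).+1 - ms_order r eta))%N%:Z =
  \sum_(eta | crossing_free A rho eta) Num.max ((along_degree rho)%:Z - seg_smooth r eta) 0.
  by move: H; rewrite /along_degree; case: (horizontal rho).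
rewrite (big_morph Posz PoszD (erefl _)); apply: eq_bigr => eta _.
by have := ms_orderE hr eta; clear; case: lerP; lia.
Qed.

Lemma mem_corr A w : w \in corr_space m m' r A <-> w \in prodv (fun rho => if rho \in A then bspace rho else 0%VS).
Proof.
rewrite mem_corr_space mem_prodv; split=> H rho; have := H rho.
  case: ifP => rA [H1 H2]; last by rewrite H2 ?mem0v ?rA.
  have := H1 isT; rewrite /in_corr_poly /corr_poly_space.
  by case: ifP => _ ?; apply/mem_Rspace.
case: ifP => rA K; split=> // _; last by apply/eqP; rewrite -memv0.
by move: K; rewrite /in_corr_poly /corr_poly_space; case: ifP => _ /mem_Rspace.
Qed.

End Deletion.

(** * Deletion *)

Section Deletion2.
Context {R : realType} (m m' : nat) (T : tmesh R) (r : edges T -> int).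
Local Notation P := 'M[R]_(m.+1, m'.+1).
Local Notation Sg := {set edges T}.
Implicit Types (d : bool) (rho eta : Sg) (x : Sg * Sg) (A : {set Sg}).
Local Notation L := (ms_poly r).
Local Notation bspace := (corr_poly_space m m' r).
Local Notation qspace := (vertex_poly_space m m' r).
Local Notation coord_space := (coord_space m m' r).
Local Notation rels := (relations m m' r).
Local Notation corr := (corr_space m m' r).
Hypotheses (hT : is_tmesh T) (hred : reduced T) (hr : is_smoothness r) (hc : constant_on_MS r).

Lemma inject_at_corr A rho (B : P) : rho \in A -> B \in bspace rho -> inject_at rho B \in corr A.
Proof.
move=> rA HB; apply/mem_corr/mem_prodv => eta; rewrite ffunE.
by case: eqP => [->|_]; [rewrite rA|rewrite mem0v].
Qed.

Lemma crossing_pt rho eta : rho \in MS T -> eta \in MS T -> horizontal eta = ~~ horizontal rho ->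
  crosses rho eta -> crossing (pt (horizontal rho) rho eta).
Proof.
move=> M M' hd cr; rewrite /crossing; case h: (horizontal rho); rewrite h in hd; rewrite /= M M' h hd //=.
by rewrite crosses_sym.
Qed.

Lemma mulpoly_qspace rho eta (B : P) : B \in qspace (pt (horizontal rho) rho eta) ->
  horizontal eta = ~~ horizontal rho -> mulpoly (L rho) B \in bspace eta.
Proof.
move=> HB hd; have Er := ms_orderE hr rho; have Ee := ms_orderE hr eta.
have Gr := seg_smooth_ge hr rho; have Ge := seg_smooth_ge hr eta.
move: HB; rewrite /corr_poly_space /vertex_poly_space hd /ms_poly /ell.
case: (horizontal rho) => /= HB; apply/mem_Rspace; rewrite (bipoly_mulpoly _ HB) /=;
  try (move: Er Ee Gr Ge; clear; lia).
  have := (bideg_le_line true (coordinate rho) (ms_order r rho) _ _ _).2 ((mem_Rspace _ _ _).1 HB).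
  by apply: bideg_leW; move: Er Ee Gr Ge; clear; lia.
have := (bideg_le_line false (coordinate rho) (ms_order r rho) _ _ _).2 ((mem_Rspace _ _ _).1 HB).
by apply: bideg_leW; move: Er Ee Gr Ge; clear; lia.
Qed.

(** The vertex relation at this crossing differs from the wanted term, up to sign, only by its part
    on [eta]. That part is absent if [eta] is no MIS, and is a relation by [HA] if [eta] has been
    deleted. *)
Lemma crossing_term_relation A rho eta (B : P) : rho \in MIS T ->
  (forall w, w \in corr (MIS T :\: A)%SET -> w \in rels) -> crossing_free A rho eta ->
  B \in qspace (pt (horizontal rho) rho eta) -> inject_at rho (mulpoly (L eta) B) \in rels.
Proof.
move=> Mi HA /and4P[Me /eqP hd cr eA] HB; have M := MIS_MS hT hred Mi.
set x := pt (horizontal rho) rho eta in HB; have vx : crossing x by exact: crossing_pt.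
pose z : {ffun (unit + (Sg + Sg * Sg))%type -> P} := inject_at (ipair x) B.
have zU : z \in prodv coord_space.
  apply/mem_prodv => i; rewrite ffunE; case: eqP => [->|_]; last exact: mem0v.
  by rewrite /= vx.
have Rz : phi r z \in rels by apply/(mem_relations hT hred hr); exists z.
have ne : (eta == rho) = false by apply/eqP => E; move: hd; rewrite E; case: horizontal.
have ne' : (rho == eta) = false by rewrite eq_sym.
pose W : {ffun Sg -> P} := if eta \in MIS T then inject_at eta (mulpoly (L rho) B) else 0.
have RW : W \in rels.
  rewrite /W; case: ifP => [Mie|_]; last exact: mem0v.
  apply: HA; apply: inject_at_corr; first by rewrite finset.in_setD eA Mie.
  exact: mulpoly_qspace.
have zx : z (ipair x) = B by rewrite ffunE eqxx.
have phiz rho' : phi r z rho' = phi_term r z x rho'.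
  rewrite phiE (bigD1 x) //= big1 ?addr0 // => y /andP[vy nxy].
  by rewrite phi_term0 // ffunE; case: eqP => // - [E]; rewrite E eqxx in nxy.
have WE rho' : W rho' = if (rho' == eta) && (eta \in MIS T) then mulpoly (L rho) B else 0.
  by rewrite /W; case: ifP => Mie; rewrite ffunE ?andbT ?andbF.
have IE rho' : (inject_at rho (mulpoly (L eta) B)) rho' = if rho' == rho then mulpoly (L eta) B else 0.
  by rewrite ffunE.
(* The sign depends on which of the two segments is horizontal. *)
have [E|E] : phi r z = W - inject_at rho (mulpoly (L eta) B) \/
             phi r z = inject_at rho (mulpoly (L eta) B) - W.
  case h: (horizontal rho); [left|right]; apply/ffunP => rho'; rewrite phiz ffun_subE WE IE /phi_term zx /x h /=.
    have [->|n1] := eqVneq rho' rho; first by rewrite ne' /= Mi sub0r.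
    by rewrite subr0.
  have [->|n1] := eqVneq rho' rho; first by rewrite ne' /= Mi subr0.
  by rewrite sub0r /=; case: ifP => // _; rewrite oppr0.
- have -> : inject_at rho (mulpoly (L eta) B) = W - phi r z by rewrite E subKr.
  exact: memvB.
have -> : inject_at rho (mulpoly (L eta) B) = phi r z + W by rewrite E subrK.
exact: memvD.
Qed.

(** [lines_span] expands [B] in powers of the lines that cross [rho] outside [A]; these lines are
    distinct because two crossing segments through the same vertex of [rho] coincide. Each summand
    is a relation. *)
Lemma single_in_relations A rho (B : P) : rho \in MIS T ->
  (forall w, w \in corr (MIS T :\: A)%SET -> w \in rels) ->
  ((along_degree m m' rho).+1 <=
    \sum_(eta | crossing_free A rho eta) ((along_degree m m' rho).+1 - ms_order r eta))%N ->
  B \in bspace rho -> inject_at rho B \in rels.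
Proof.
move=> Mi HA le_sum HB; have M := MIS_MS hT hred Mi.
have inj : {in crossing_free A rho &, injective (@coordinate R T)}.
  move=> e1 e2; rewrite -!topredE /= => /and4P[M1 /eqP h1 c1 _] /and4P[M2 /eqP h2 c2 _] E.
  have [_ o1 g1 _] := crosses_vertex hT hred M M1 h1 c1; have [_ o2 _ _] := crosses_vertex hT hred M M2 h2 c2.
  by apply: (ms_uniq_at hT hred g1 M1 M2 _ o1); rewrite ?h1 ?h2 // /vertex E.
have Gr := seg_smooth_ge hr rho.
have [a [b [/andP[am bm] Eab Hb Eq]]] : exists a b, [/\ (a <= m%:Z) && (b <= m'%:Z),
    (if ~~ horizontal rho then b else a) = (along_degree m m' rho)%:Z,
   bideg_le a b (bipoly B) & forall eta, qspace (pt (horizontal rho) rho eta) =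
   Rspace m m' (a - if ~~ horizontal rho then 0 else (ms_order r eta)%:Z)
      (b - if ~~ horizontal rho then (ms_order r eta)%:Z else 0)].
  move: HB; rewrite /corr_poly_space /vertex_poly_space /along_degree; case: (horizontal rho) => /= /mem_Rspace HB;
    [exists m%:Z, (m'%:Z - seg_smooth r rho - 1)|exists (m%:Z - seg_smooth r rho - 1), m'%:Z];
    (split=> // [|eta]; [move: Gr; clear; lia|have Ee := ms_orderE hr eta; congr Rspace; move: Ee; clear; lia]).
have [q [q1 q2]] := lines_span inj le_sum Eab Hb.
have qW eta : bideg_le m%:Z m'%:Z (q eta).
  by apply: bideg_leW (q1 eta); move: am bm; clear; case: (~~ _); lia.
have Bq eta : bipoly (mxof m m' (q eta)) = q eta by exact: mxofK.
have Bs eta : mxof m m' (q eta) \in qspace (pt (horizontal rho) rho eta).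
  by rewrite Eq; apply/mem_Rspace; rewrite Bq.
have -> : inject_at rho B = \sum_(eta | crossing_free A rho eta) inject_at rho (mulpoly (L eta) (mxof m m' (q eta))).
  apply/ffunP => rho'; rewrite sum_ffunE [LHS]ffunE.
  under eq_bigr => eta _ do rewrite ffunE.
  case: eqP => _; last by rewrite big1.
  apply: bipoly_inj; rewrite bipoly_sum {1}q2; apply: eq_bigr => eta /and4P[Me /eqP hd cr _].
  have := bipoly_qterm hr (~~ horizontal rho) (crossing_pt M Me hd cr) (Bs eta).
  by rewrite cross_pt Bq => ->; rewrite /ms_poly /ell hd.
apply: memv_suml => eta cf; exact: (crossing_term_relation Mi HA cf).
Qed.

(** Invariant of the deletion: whatever is supported on deleted segments is a relation. All segments
    of one pass are tested against the same [A], so each of them relies only on segments deleted in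
    earlier passes. *)
Lemma deletion_relations k : let A := (iter k (deletion_pass m m' r) (MIS T, finset.set0)).1 in
  A \subset MIS T /\ forall w, w \in corr (MIS T :\: A)%SET -> w \in rels.
Proof.
elim: k => [|k /=]; first split=> //=.
  move=> w /mem_corr/mem_prodv H; suff -> : w = 0 by exact: mem0v.
  apply/ffunP => rho; rewrite [RHS]ffunE; have := H rho.
  by rewrite finset.setDv finset.in_set0 memv0 => /eqP.
set A := (iter k _ _).1 => -[sA HA]; split.
  exact: fintype.subset_trans (finset.subsetDl _ _) sA.
move=> w /mem_corr/mem_prodv H.
have -> : w = \sum_rho inject_at rho (w rho).
  apply/ffunP => rho; rewrite sum_ffunE (bigD1 rho) //= big1 ?addr0; first by rewrite ffunE eqxx.
  by move=> eta ne; rewrite ffunE eq_sym (negbTE ne).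
apply: memv_suml => rho _; have := H rho.
rewrite finset.in_setD finset.in_setD.
case: ifP => [/andP[out Mi] Hw|_]; last first.
  rewrite memv0 => /eqP->; rewrite (_ : inject_at rho 0 = 0) ?mem0v //.
  by apply/ffunP => eta; rewrite !ffunE if_same.
have [dz|ndz] := boolP (rho \in diagonalizable_MIS m m' r A).
  by apply: (single_in_relations Mi HA) => //; exact: diagonalizable_sum.
apply: HA; apply: inject_at_corr => //.
by rewrite finset.in_setD Mi andbT; move: out; rewrite ndz.
Qed.

Lemma CNDC_sub : CNDC m m' r \subset MIS T.
Proof. by have [] := deletion_relations #|MIS T|. Qed.

Lemma relations_sub : (rels <= corr (MIS T))%VS.
Proof.
apply/subvP => w /(mem_relations hT hred hr)[z /mem_prodv zU <-]; apply/mem_corr/mem_prodv => rho.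
rewrite phiE; apply: memv_suml => x vx.
have HB : z (ipair x) \in qspace x by have := zU (ipair x); rewrite /= vx.
have [M1 M2 h1 h2 _] := crossing_along true vx; rewrite /= in M1 M2 h1 h2.
rewrite /phi_term; case: ifP => [/andP[/eqP-> Mi]|_].
  rewrite Mi; apply: (mulpoly_qspace (rho := x.1)); last by rewrite h1.
  by rewrite h1 /= -surjective_pairing.
case: ifP => [/andP[/eqP-> Mi]|_]; last exact: mem0v.
rewrite Mi memvN; apply: (mulpoly_qspace (rho := x.2)); last by rewrite h1 h2.
by rewrite h2 /= -surjective_pairing.
Qed.

(** By the invariant, [M(CNDC)] and the relations together span [M(MIS)]; the second isomorphism
    theorem then gives [H(CNDC)] the dimension of [H(MIS)]. *)
Lemma quotient_dim : (\dim (corr_quotient m m' r (CNDC m m' r)) + \dim rels = \dim (corr (MIS T)))%N.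
Proof.
set C := CNDC m m' r; have [sC HC] := deletion_relations #|MIS T|; rewrite -/(CNDC m m' r) -/C in sC HC.
have E : (corr C + rels)%VS = corr (MIS T).
  apply/eqP; rewrite eqEsubv subv_add relations_sub andbT; apply/andP; split.
    apply/subvP => w /mem_corr/mem_prodv H; apply/mem_corr/mem_prodv => rho; have := H rho.
    by case: ifP => [/(fintype.subsetP sC)->//|_]; rewrite memv0 => /eqP->; exact: mem0v.
  apply/subvP => w /mem_corr/mem_prodv H.
  pose w1 : {ffun Sg -> P} := [ffun rho => if rho \in C then w rho else 0].
  have Cw1 : w1 \in corr C.
    by apply/mem_corr/mem_prodv => rho; rewrite ffunE; case: ifP => [rC|_];
      [have := H rho; rewrite (fintype.subsetP sC)|exact: mem0v].
  have Rw1 : w - w1 \in rels.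
    apply: HC; apply/mem_corr/mem_prodv => rho; rewrite ffun_subE [w1 rho]ffunE finset.in_setD.
    by case: ifP => rC /=; rewrite ?subrr ?mem0v // subr0; exact: H.
  by rewrite -(subrK w1 w) addrC memv_add.
have sub : (relations_in m m' r C <= corr C)%VS by exact: capvSl.
have h1 := dim_quotv sub; have h2 := dimv_sum_cap (corr C) rels.
rewrite E -/(relations_in m m' r C) -h1 addnAC in h2.
by rewrite /corr_quotient -/C; apply/esym/(addIn h2).
Qed.

Lemma corr_dim A : \dim (corr A) = (\sum_(rho in A) \dim (bspace rho))%N.
Proof.
have -> : corr A = prodv (fun rho => if rho \in A then bspace rho else 0%VS).
  by apply/vspaceP => w; apply/idP/idP => /mem_corr.
rewrite dim_prodv [RHS]big_mkcond; apply: eq_bigr => rho _.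
by case: ifP => // _; rewrite dimv0.
Qed.

Lemma coord_dim : (\sum_i \dim (coord_space i) = \dim {:P} + (\sum_(rho in CC T) \dim (bspace rho)
   + \sum_(x | crossing x) \dim (qspace x)))%N.
Proof.
rewrite big_sumType /= (big_pred1 tt) => [|[]//]; congr (_ + _)%N.
rewrite big_sumType /=; congr (_ + _)%N; rewrite [RHS]big_mkcond; apply: eq_bigr => i _.
  by case: ifP => // _; rewrite dimv0.
by case: ifP => // _; rewrite dimv0.
Qed.

(** Apart from the spline space and the quotient, every term is determined by the types, directions,
    crossings and smoothness of the maximal segments. *)
Lemma spline_quotient_dim :
  (\dim (spline_space m m' r) + \sum_(rho in MIS T) \dim (bspace rho) =
   \dim (corr_quotient m m' r (CNDC m m' r)) + (\dim {:P} + (\sum_(rho in CC T) \dim (bspace rho)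
   + \sum_(x | crossing x) \dim (qspace x))))%N.
Proof.
have := quotient_dim; have := spline_dim m m' hT hred hr hc; rewrite coord_dim corr_dim; lia.
Qed.

End Deletion2.

(** * Structural isomorphisms *)

Section EdgeCount.
Context {R : realType} (T : tmesh R).
Implicit Types (d : bool) (rho eta : {set edges T}).
Local Notation g := (grid T).
Local Notation n := (ngrid T).
Hypotheses (hT : is_tmesh T) (hred : reduced T).

Lemma seg_loE (e : seg R) : seg_lo e = pt (horiz e) (lo e) (cor e).
Proof. by rewrite /seg_lo; case: (horiz e). Qed.
Lemma seg_hiE (e : seg R) : seg_hi e = pt (horiz e) (hi e) (cor e).
Proof. by rewrite /seg_hi; case: (horiz e). Qed.

Lemma seg_lo_vert (e : edges T) : seg_lo (val e) \in verts T.
Proof. by rewrite in_fsetU; apply/orP; left; apply/imfsetP; exists (val e) => //=; exact: fsvalP. Qed.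
Lemma seg_hi_vert (e : edges T) : seg_hi (val e) \in verts T.
Proof. by rewrite in_fsetU; apply/orP; right; apply/imfsetP; exists (val e) => //=; exact: fsvalP. Qed.

Lemma edge_lt (e : edges T) : lo (val e) < hi (val e).
Proof. by case: hT => _ [H _ _] _ _; exact: (H _ (fsvalP e)). Qed.

Lemma seg_lo_on (e : edges T) : on_seg (val e) (seg_lo (val e)).
Proof. by rewrite seg_loE on_segE cross_pt along_pt eqxx lexx /= ltW // edge_lt. Qed.
Lemma seg_hi_on (e : edges T) : on_seg (val e) (seg_hi (val e)).
Proof. by rewrite seg_hiE on_segE cross_pt along_pt eqxx lexx andbT /= ltW // edge_lt. Qed.

Lemma vertex_on_edge (e : edges T) p : p \in verts T -> on_seg (val e) p ->
  p = seg_lo (val e) \/ p = seg_hi (val e).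
Proof.
move=> pv pe; case: hred => _ _ /(_ _ (edge_lt e))[/(_ (fsvalP e))[rho [rh hh [v1 v2 o1 o2] H]] _].
apply: H => //; have S := MShat_segment rh.
have := segment_line S o1; rewrite seg_loE hh cross_pt => ce.
have := @segment_interval _ T rho (seg_lo (val e)) (seg_hi (val e)) (along (horiz (val e)) p) S o1 o2.
move: pe; rewrite on_segE => /andP[/eqP c1 c2].
by rewrite hh {1}seg_loE {1}seg_hiE !along_pt -ce -c1 pt_along; apply.
Qed.

(** Taken in [MShat], because the end of a ray or cross-cut on the frontier is crossed by a boundary
    segment. *)
Definition perps rho : {set {set edges T}} :=
  [set eta in MShat T | (horizontal eta == ~~ horizontal rho) && crosses rho eta]%SET.

Lemma perpsP rho eta : eta \in perps rho ->
  [/\ eta \in MShat T, horizontal eta = ~~ horizontal rho & crosses rho eta].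
Proof. by rewrite inE => /and3P[? /eqP ? ?]. Qed.

Lemma perp_at rho p : p \in verts T -> on_segment p rho ->
  exists2 eta, eta \in perps rho & on_segment p eta.
Proof.
move=> pv pr; case: hred => _ /(_ p pv (~~ horizontal rho))[eta [[h1 h2 h3] _]] _.
exists eta => //; rewrite inE h1 h2 eqxx /=; apply/asboolP; by exists p.
Qed.

Lemma MShat_uniq_at rho eta p : p \in verts T -> rho \in MShat T -> eta \in MShat T ->
  horizontal rho = horizontal eta -> on_segment p rho -> on_segment p eta -> rho = eta.
Proof. by move=> hp h1 h2; exact: (no_collinear hred hp h1 h2). Qed.

Lemma perps_vertex rho eta : rho \in MShat T -> eta \in perps rho ->
  [/\ on_segment (vertex rho eta) rho, on_segment (vertex rho eta) eta & vertex rho eta \in verts T].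
Proof.
move=> hr /perpsP[he hd /asboolP[p [pr pe]]].
have Sr := MShat_segment hr; have Se := MShat_segment he.
rewrite -(vertex_unique Sr Se hd pr pe); split=> //; exact: (crossing_vert hT Sr Se hd pr pe).
Qed.

(** The vertices on [rho] correspond to the perpendicular segments, and all but the last of them to
    the edges of which they are the low ends. Since [perps] is transported by an isomorphism,
    corresponding segments have equally many edges. *)
Lemma edge_count rho : rho \in MS T -> #|perps rho| = #|rho|.+1.
Proof.
move=> M; have hr := MS_MShat hT hred M; have S := MShat_segment hr.
have [r1 r2] := ms_range hT hred M; set d := horizontal rho in r1 r2 *.
pose VS := [set v : verts T | on_segment (val v) rho]%SET.
have [e0 er0] : exists e, e \in rho by have [/finset.set0Pn] := S.
pose v0 : verts T := [` seg_lo_vert e0]%fset.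
pose v eta : verts T := insubd v0 (vertex rho eta).
have vE eta : eta \in perps rho -> val (v eta) = vertex rho eta.
  by move=> /(perps_vertex hr)[_ _ h]; rewrite /v val_insubd h.
have VSE : VS = [set v eta | eta in perps rho]%SET.
  apply/finset.setP => u; rewrite inE; apply/idP/imsetP => [ur|[eta ep ->]].
    have [eta ep ue] := perp_at (fsvalP u) ur; exists eta => //; apply: val_inj; rewrite vE //.
    have [he hd _] := perpsP ep.
    exact: (vertex_unique S (MShat_segment he) hd ur ue).
  by rewrite vE //; case: (perps_vertex hr ep).
have inj : {in perps rho &, injective v}.
  move=> e1 e2 p1 p2 /(congr1 val); rewrite !vE // => E.
  have [_ o1 g1] := perps_vertex hr p1; have [_ o2 _] := perps_vertex hr p2.
  have [h1 d1 _] := perpsP p1; have [h2 d2 _] := perpsP p2.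
  by apply: (MShat_uniq_at g1 h1 h2 _ o1); rewrite ?d1 ?d2 // E.
have -> : #|perps rho| = #|VS| by rewrite VSE card_in_imset.
have dir e : e \in rho -> horiz (val e) = d /\ cor (val e) = g (~~ d) (ms_line rho).
  by move=> /(ms_mem hT hred _ M)[].
have cover a : (ms_lo rho <= a < ms_hi rho)%N -> exists2 e, e \in rho & edge_covers T (val e) a.
  move=> ha; have [|c [c' [e [_ _ _ [he ce eca _]]]]] := sep_edge hT hred _ r2 (ms_sep hT hred M ha).
    by move: ha r1; clear; lia.
  by exists e => //; apply/(ms_mem hT hred _ M); split=> //; exists a.
have ends e : e \in rho -> exists i0 i1, [/\ (ms_lo rho <= i0)%N, (i0 < i1)%N, (i1 <= ms_hi rho)%N,
     lo (val e) = g d i0 /\ hi (val e) = g d i1 & forall a, (a < n d)%N -> edge_covers T (val e) a = (i0 <= a < i1)%N].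
  move=> er; have [hd _] := dir e er; have [i0 [i1 [h E0 E1 Ec]]] := edge_range hT (fsvalP e).
  rewrite hd in h E0 E1 Ec; exists i0, i1; split=> //; try (by move: h; clear; lia).
    have i0n : (i0 < n d)%N by move: h; clear; lia.
    have /andP[//] := ms_edge_a hT hred M er i0n ltac:(rewrite Ec //; move: h; clear; lia).
  have i1n : (i1.-1 < n d)%N by move: h; clear; lia.
  have := ms_edge_a hT hred M er i1n ltac:(rewrite Ec //; move: h; clear; lia).
  by move: h; clear; lia.
(* The edge over the last grid interval reaches the high end of [rho], which is therefore a vertex,
   and the only one on [rho] that is no low end. *)
have [et etr ect] := cover (ms_hi rho).-1 ltac:(move: r1; clear; lia).
have top_hi : hi (val et) = g d (ms_hi rho).
  have [i0 [i1 [h0 h1 h2 [_ ->] Ec]]] := ends et etr.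
  rewrite Ec in ect; last by move: r1; clear; lia.
  by congr (g d _); move: h0 h1 h2 ect; clear; lia.
pose top : verts T := [` seg_hi_vert et]%fset.
have topE : val top = pt d (g d (ms_hi rho)) (g (~~ d) (ms_line rho)).
  by rewrite /= seg_hiE top_hi; have [-> ->] := dir et etr.
have topVS : top \in VS by rewrite inE topE; apply: (ms_point hT hred M); move: r1; clear; lia.
rewrite (cardsD1 top VS) topVS add1n; congr _.+1.
pose lov (e : edges T) : verts T := [` seg_lo_vert e]%fset.
have lovE e : e \in rho -> val (lov e) = pt d (lo (val e)) (g (~~ d) (ms_line rho)).
  by move=> er; rewrite /= seg_loE; have [-> ->] := dir e er.
have -> : (VS :\ top)%SET = [set lov e | e in rho]%SET.
  apply/finset.setP => u; rewrite finset.in_setD1; apply/andP/imsetP => [[nt]|[e er ->]].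
    rewrite inE (ms_on hT hred _ M) -/d => /andP[/eqP uc /andP[u1 u2]].
    have /crd_grid[i hi Ei] := vert_crd d (fsvalP u); rewrite Ei in u1 u2.
    rewrite !grid_leE // in u1 u2; try (by move: r1; clear; lia).
    have ih : i != ms_hi rho.
      apply: contraNneq nt => E; apply/eqP/val_inj; rewrite topE -E -Ei -uc; apply/esym.
      exact: pt_along.
    have ia : (ms_lo rho <= i < ms_hi rho)%N by move: u1 u2 ih; clear; lia.
    have [e er eca] := cover i ia; exists e => //; apply: val_inj.
    have [hd ce] := dir e er.
    have lti : g d i < g d i.+1 by apply: grid_lt => //; move: ia r1; clear; lia.
    have ue : on_seg (val e) (val u).
      by move: eca; rewrite /edge_covers on_segE hd ce uc eqxx Ei /=; move: lti; clear; lra.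
    have [//|E] := vertex_on_edge (fsvalP u) ue.
    have := congr1 (along d) E; rewrite seg_hiE hd along_pt Ei => E'.
    by exfalso; move: eca lti; rewrite /edge_covers hd -E'; clear; lra.
  have [i0 [i1 [h0 h1 h2 [l0 l1] _]]] := ends e er; split; last first.
    by rewrite inE lovE // l0; apply: (ms_point hT hred M); move: h0 h1 h2; clear; lia.
  apply/eqP => /(congr1 val); rewrite lovE // topE => /(congr1 (along d)); rewrite !along_pt l0.
  move=> E; have := @grid_inj _ T d i0 (ms_hi rho) ltac:(move: h1 h2 r1; clear; lia) ltac:(move: r1; clear; lia) E.
  by move: h1 h2; clear; lia.
rewrite card_in_imset // => e e' er er' /(congr1 val); rewrite !lovE // => /(congr1 (along d)).
rewrite !along_pt => E; apply: val_inj.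
have [hd ce] := dir e er; have [hd' ce'] := dir e' er'.
have [i0 [i1 [h0 h1 h2 [l0 _] Ec]]] := ends e er; have [j0 [j1 [k0 k1 k2 [l0' _] Ec']]] := ends e' er'.
have Ei : i0 = j0 by apply: (@grid_inj _ T d); rewrite -?l0 -?l0' //; move: h1 h2 k1 k2 r1; clear; lia.
apply: (ecov_uniq hT (fsvalP e) (fsvalP e') (a := i0)); rewrite ?hd ?hd' ?ce ?ce' ?Ec ?Ec' //;
  move: Ei h1 h2 k1 k2 r1; clear; lia.
Qed.

End EdgeCount.

Lemma endpoints_eq (R : realFieldType) (a b c d : R) : a < b -> c < d ->
  a = c \/ a = d -> b = c \/ b = d -> a = c /\ b = d.
Proof. by move=> ab cd [E|E] [F|F]; split=> //; lra. Qed.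

Lemma addn_cancel a a' b b' c d : (a' + c = b' + d -> a + c = b + d -> a' + b = a + b')%N.
Proof. lia. Qed.

Section Isomorphism.
Context {R : realType} (m m' : nat) (T T' : tmesh R).
Variables (r : edges T -> int) (r' : edges T' -> int).
Implicit Types (rho eta : {set edges T}).
Hypotheses (hT : is_tmesh T) (hred : reduced T) (hr : is_smoothness r) (hc : constant_on_MS r).
Hypotheses (hT' : is_tmesh T') (hred' : reduced T') (hr' : is_smoothness r').
Variables (al : {set edges T} -> {set edges T'}) (al0 : R * R -> R * R) (al1 : edges T -> edges T').
Hypotheses (iso : structural_iso al) (dir : direction_preserving al)
  (ind0 : induced_on_vertices al al0) (ind1 : induced_on_edges al al0 al1)
  (smooth : forall e, e \in interior_edges T -> r' (al1 e) = r e).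

Let al_inj : {in MShat T &, injective al}. Proof. by case: iso => -[]. Qed.
Let al_MShat : (al @: MShat T)%SET = MShat T'. Proof. by case: iso => -[]. Qed.
Let al_CC : (al @: CC T)%SET = CC T'. Proof. by case: iso => _ []. Qed.
Let al_Ray : (al @: Ray T)%SET = Ray T'. Proof. by case: iso => _ []. Qed.
Let al_MIS : (al @: MIS T)%SET = MIS T'. Proof. by case: iso => _ []. Qed.
Let hatMS rho : rho \in MS T -> rho \in MShat T. Proof. exact: MS_MShat. Qed.

Lemma al_MS : (al @: MS T)%SET = MS T'.
Proof. by rewrite (MS_types hT hred) (MS_types hT' hred') !imsetU al_CC al_Ray al_MIS. Qed.

Lemma al_in_MS rho : rho \in MShat T -> (al rho \in MS T') = (rho \in MS T).
Proof.
move=> h; rewrite -al_MS; apply/imsetP/idP => [[eta M /al_inj->]|M] //; first exact: hatMS.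
by exists rho.
Qed.

Lemma al_horizontal rho : rho \in MShat T -> horizontal (al rho) = horizontal rho.
Proof. exact: dir. Qed.

Lemma al_crosses rho eta : rho \in MShat T -> eta \in MShat T -> rho != eta ->
  crosses (al rho) (al eta) = crosses rho eta.
Proof.
move=> h1 h2 ne; case: iso => _ _ H _ _.
by apply/asboolP/asboolP => /(H _ _ h1 h2 ne).
Qed.

Lemma perp_neq (U : tmesh R) (x y : {set edges U}) : horizontal y = ~~ horizontal x -> x != y.
Proof. by move=> h; apply/eqP => E; move: h; rewrite E; case: horizontal. Qed.

Lemma al_perps rho : rho \in MShat T -> perps (al rho) = (al @: perps rho)%SET.
Proof.
move=> h; apply/finset.setP => eta'; apply/idP/imsetP => [/perpsP[]|[eta /perpsP[he hd cr] ->]].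
  rewrite -al_MShat => /imsetP[eta he ->]; rewrite !al_horizontal // => hd cr; exists eta => //.
  by rewrite inE he hd eqxx -al_crosses // perp_neq.
rewrite inE -al_MShat imset_f //= !al_horizontal // hd eqxx /=.
by rewrite al_crosses // perp_neq.
Qed.

(** [al0 p] lies on the image of the perpendicular segment through [p]. Equal images force equal
    perpendicular segments, hence the same intersection with [rho]. *)
Lemma al0_inj rho p q : rho \in MS T -> p \in verts T -> q \in verts T ->
  on_segment p rho -> on_segment q rho -> al0 p = al0 q -> p = q.
Proof.
move=> M pv qv pr qr E; have h := hatMS M.
have [e1 p1 o1] := perp_at hred pv pr; have [e2 p2 o2] := perp_at hred qv qr.
have [h1 d1 c1] := perpsP p1; have [h2 d2 c2] := perpsP p2.
have [a1 b1] := ind0 h h1 (perp_neq d1) pr o1.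
have [a2 b2] := ind0 h h2 (perp_neq d2) qr o2.
have ah : al rho \in MShat T' by rewrite -al_MShat imset_f.
have ah1 : al e1 \in MShat T' by rewrite -al_MShat imset_f.
have ah2 : al e2 \in MShat T' by rewrite -al_MShat imset_f.
have pv' : al0 p \in verts T'.
  apply: (crossing_vert hT' (MShat_segment ah) (MShat_segment ah1) _ a1 b1).
  by rewrite !al_horizontal.
have Ea : al e1 = al e2.
  apply: (MShat_uniq_at hred' pv' ah1 ah2 _ b1); first by rewrite !al_horizontal // d1 d2.
  by rewrite E.
have Ee := al_inj h1 h2 Ea; subst e2.
by rewrite (vertex_unique (MShat_segment h) (MShat_segment h1) d1 pr o1)
  (vertex_unique (MShat_segment h) (MShat_segment h1) d1 qr o2).
Qed.

(** Only the unordered pair of image endpoints is prescribed; on one line it still determines the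
    edge, since [lo < hi] fixes the order. *)
Lemma al1_inj rho : rho \in MS T -> {in rho &, injective al1}.
Proof.
move=> M e e' er er' E; have h := hatMS M; have S := MShat_segment h.
have [_ I] := ind1 h er; have [_ I'] := ind1 h er'; rewrite E -I' in I.
have lr (f : edges T) : f \in rho -> on_segment (seg_lo (val f)) rho.
  by move=> fr; apply/on_segmentP; exists f => //; exact: seg_lo_on.
have hir (f : edges T) : f \in rho -> on_segment (seg_hi (val f)) rho.
  by move=> fr; apply/on_segmentP; exists f => //; exact: seg_hi_on.
have E1 : seg_lo (val e) = seg_lo (val e') \/ seg_lo (val e) = seg_hi (val e').
  have : [set al0 (seg_lo (val e)); al0 (seg_hi (val e))] (al0 (seg_lo (val e))) by left.
  rewrite I => -[] /(al0_inj M) K; [left|right]; apply: K; rewrite ?lr ?hir ?seg_lo_vert ?seg_hi_vert //.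
have E2 : seg_hi (val e) = seg_lo (val e') \/ seg_hi (val e) = seg_hi (val e').
  have : [set al0 (seg_lo (val e)); al0 (seg_hi (val e))] (al0 (seg_hi (val e))) by right.
  rewrite I => -[] /(al0_inj M) K; [left|right]; apply: K; rewrite ?lr ?hir ?seg_lo_vert ?seg_hi_vert //.
have [d1 c1] := segment_dir S er; have [d2 c2] := segment_dir S er'.
have l1 := edge_lt hT e; have l2 := edge_lt hT e'.
rewrite !seg_loE !seg_hiE d1 d2 in E1 E2.
have F1 : lo (val e) = lo (val e') \/ lo (val e) = hi (val e').
  by case: E1 => /(congr1 (along (horizontal rho))); rewrite !along_pt; [left|right].
have F2 : hi (val e) = lo (val e') \/ hi (val e) = hi (val e').
  by case: E2 => /(congr1 (along (horizontal rho))); rewrite !along_pt; [left|right].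
have {F1 F2}[F1 F2] := endpoints_eq l1 l2 F1 F2.
apply: val_inj; move: d1 c1 F1 F2; rewrite -c2 -d2.
by case: (val e) => ? ? ? ?; case: (val e') => ? ? ? ? /= -> -> -> ->.
Qed.

(** Injectivity places as many edges in [al rho] as there are in [rho], and [edge_count] in both
    meshes leaves room for no more. *)
Lemma al1_image rho : rho \in MS T -> (al1 @: rho)%SET = al rho.
Proof.
move=> M; have h := hatMS M; apply/eqP; rewrite eqEcard; apply/andP; split.
  by apply/fintype.subsetP => _ /imsetP[e er ->]; case: (ind1 h er).
rewrite card_in_imset; last exact: al1_inj.
have M' : al rho \in MS T' by rewrite al_in_MS.
rewrite -ltnS -(edge_count hT hred M) -(edge_count hT' hred' M') al_perps //.
exact: leq_imset_card.
Qed.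

Lemma al_smooth_edge rho e : rho \in MS T -> e \in al rho -> r' e = seg_smooth r rho.
Proof.
move=> M; rewrite -(al1_image M) => /imsetP[f fr ->]; rewrite smooth.
  by rewrite (seg_smooth_edge hc M fr).
by have := M; rewrite MS_maxseg => /maxsegP[_ /fintype.subsetP]; apply.
Qed.

(** Every edge of a maximal segment of [T'] is the image of an edge of one maximal segment of [T],
    so constancy is inherited from [r]. *)
Lemma al_constant : constant_on_MS r'.
Proof.
move=> rho'; rewrite -al_MS => /imsetP[rho M ->] e e' er er'.
by rewrite (al_smooth_edge M er) (al_smooth_edge M er').
Qed.

Lemma al_smooth rho : rho \in MS T -> seg_smooth r' (al rho) = seg_smooth r rho.
Proof.
move=> M; have M' : al rho \in MS T' by rewrite al_in_MS // hatMS.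
have [e er] : exists e, e \in al rho by have [/finset.set0Pn] := MShat_segment (MS_MShat hT' hred' M').
by rewrite (seg_smooth_edge al_constant M' er); exact: al_smooth_edge.
Qed.

Let al_injMS : {in MS T &, injective al}.
Proof. by move=> x y /hatMS hx /hatMS hy; exact: al_inj. Qed.
Let al_injMIS : {in MIS T &, injective al}.
Proof. by move=> x y /(MIS_MS hT hred) hx /(MIS_MS hT hred) hy; exact: al_injMS. Qed.

Lemma al_bspace rho : rho \in MS T -> corr_poly_space m m' r' (al rho) = corr_poly_space m m' r rho.
Proof. by move=> M; rewrite /corr_poly_space al_smooth // al_horizontal // hatMS. Qed.

Lemma al_sum_bspace (A : {set {set edges T}}) : A \subset MS T ->
  (\sum_(rho in (al @: A)%SET) \dim (corr_poly_space m m' r' rho) = \sum_(rho in A) \dim (corr_poly_space m m' r rho))%N.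
Proof.
move=> /fintype.subsetP sA; rewrite big_imset /=; last by move=> x y xA yA; apply: al_injMS; exact: sA.
by apply: eq_bigr => rho rA; rewrite al_bspace // sA.
Qed.

Let al2 (x : {set edges T} * {set edges T}) := (al x.1, al x.2).

Lemma al_crossings : [set x : {set edges T'} * {set edges T'} | crossing x]%SET =
  (al2 @: [set x : {set edges T} * {set edges T} | crossing x])%SET.
Proof.
have K x : x.1 \in MS T -> x.2 \in MS T -> crossing (al2 x) = crossing x.
  move=> M1 M2; have h1 := hatMS M1; have h2 := hatMS M2.
  rewrite /crossing /= !al_in_MS // M1 M2 !al_horizontal //=.
  case: (boolP (horizontal x.1)) => //= d1; case: (boolP (horizontal x.2)) => //= d2.
  by rewrite al_crosses //; apply: perp_neq; rewrite d1 (negbTE d2).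
apply/finset.setP => -[y1 y2]; rewrite inE; apply/idP/imsetP => [v|[x]].
  have /and5P[/= M1 M2 _ _ _] := v.
  move: M1 M2 v; rewrite -al_MS => /imsetP[x1 M1 ->] /imsetP[x2 M2 ->] v.
  by exists (x1, x2) => //; rewrite inE -K.
rewrite inE => v ->; rewrite -/(al2 x) K //; by case/and5P: v.
Qed.

Lemma al_sum_qspace :
  (\sum_(x | @crossing R T' x) \dim (vertex_poly_space m m' r' x) = \sum_(x | @crossing R T x) \dim (vertex_poly_space m m' r x))%N.
Proof.
transitivity (\sum_(x in [set x : {set edges T'} * {set edges T'} | crossing x]%SET) \dim (vertex_poly_space m m' r' x))%N.
  by apply: eq_bigl => x; rewrite inE.
rewrite al_crossings big_imset /=; last first.
  move=> [x1 x2] [y1 y2]; rewrite !inE => /and5P[/= M1 M2 _ _ _] /and5P[/= N1 N2 _ _ _] [] E1 E2.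
  by rewrite (al_injMS M1 N1 E1) (al_injMS M2 N2 E2).
apply: eq_big => [x|x]; rewrite inE // => /and5P[M1 M2 _ _ _].
by rewrite /vertex_poly_space /= !al_smooth.
Qed.

Lemma al_crossing_free (A : {set {set edges T}}) rho (eta' : {set edges T'}) : A \subset MIS T -> rho \in MS T ->
  crossing_free (al @: A)%SET (al rho) eta' <->
  exists2 eta, crossing_free A rho eta & eta' = al eta.
Proof.
move=> /fintype.subsetP sA M; have h := hatMS M.
have K eta : eta \in MS T -> crossing_free (al @: A)%SET (al rho) (al eta) = crossing_free A rho eta.
  move=> Me; have he := hatMS Me; rewrite /crossing_free al_in_MS // Me !al_horizontal //=.
  case: eqP => //= hd; rewrite al_crosses //; last exact: perp_neq.
  congr (_ && ~~ _); apply/imsetP/idP => [[z zA E]|eA]; last by exists eta.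
  by rewrite (al_injMS Me (MIS_MS hT hred (sA _ zA)) E).
split=> [cf|[eta cf ->]]; last by rewrite K //; case/and4P: cf.
have /and4P[Me _ _ _] := cf; move: Me cf; rewrite -al_MS => /imsetP[eta Me ->].
by rewrite K // => cf; exists eta.
Qed.

Lemma al_weight (A : {set {set edges T}}) rho : A \subset MIS T -> rho \in A ->
  weight m m' r' (al @: A)%SET (al rho) = weight m m' r A rho.
Proof.
move=> sA rA; have Mi := fintype.subsetP sA _ rA; have M := MIS_MS hT hred Mi.
have sA' : (al @: A)%SET \subset MIS T' by rewrite -al_MIS imsetS.
rewrite (weightE m m' r hT hred) // (weightE m m' r' hT' hred') ?imset_f //.
transitivity (\sum_(eta in (al @: [set eta | crossing_free A rho eta])%SET)
   Num.max ((along_degree m m' (al rho))%:Z - seg_smooth r' eta) 0).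
  apply: eq_bigl => eta'; apply/idP/imsetP => [/(al_crossing_free _ sA M)[eta cf ->]|[eta]].
    by exists eta; rewrite ?inE.
  by rewrite inE => cf ->; apply/(al_crossing_free _ sA M); exists eta.
rewrite big_imset /=; last first.
  by move=> x y; rewrite !inE => /and4P[Mx _ _ _] /and4P[My _ _ _]; exact: al_injMS.
apply: eq_big => [eta|eta]; rewrite inE // => /and4P[Me _ _ _].
by rewrite al_smooth // /along_degree al_horizontal // hatMS.
Qed.

Lemma al_diagonalizable (A : {set {set edges T}}) : A \subset MIS T ->
  diagonalizable_MIS m m' r' (al @: A)%SET = (al @: diagonalizable_MIS m m' r A)%SET.
Proof.
move=> sA.
have K rho : rho \in A -> (threshold m m' (al rho) <= weight m m' r' (al @: A)%SET (al rho)) =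
    (threshold m m' rho <= weight m m' r A rho).
  move=> rA; rewrite al_weight // /threshold al_horizontal //.
  by apply/hatMS/(MIS_MS hT hred)/(fintype.subsetP sA).
apply/finset.setP => y; rewrite inE; apply/andP/imsetP => [[/imsetP[rho rA ->]]|[rho]].
  by rewrite K // => H; exists rho => //; rewrite inE rA.
rewrite inE => /andP[rA H] ->; by rewrite imset_f // K.
Qed.

(** Weights and thresholds agree for corresponding segments, so every pass deletes corresponding
    sets. *)
Lemma al_iter k :
  (iter k (deletion_pass m m' r') (MIS T', finset.set0)).1 =
  (al @: (iter k (deletion_pass m m' r) (MIS T, finset.set0)).1)%SET.
Proof.
elim: k => [|k IH]; first by rewrite /= al_MIS.
have [sA _] := deletion_relations m m' hT hred hr k.
rewrite !iterS /= IH; set A := (iter k _ _).1 in sA *.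
rewrite al_diagonalizable //; apply/finset.setP => y; rewrite finset.in_setD.
apply/andP/imsetP => [[nd /imsetP[rho rA E]]|[rho]].
  exists rho => //; rewrite finset.in_setD rA andbT.
  by apply: contra nd => rd; rewrite E imset_f.
rewrite finset.in_setD => /andP[nd rA] ->; split; last exact: imset_f.
apply: contra nd => /imsetP[z zd E]; rewrite (al_injMIS _ _ E) //.
  exact: (fintype.subsetP sA).
by apply: (fintype.subsetP sA); move: zd; rewrite inE => /andP[].
Qed.

(** The number of passes is the number of MISs, which is the same in both meshes. *)
Lemma al_CNDC : CNDC m m' r' = (al @: CNDC m m' r)%SET.
Proof. by rewrite /CNDC -al_MIS card_in_imset // al_MIS al_iter. Qed.

Lemma iso_dims :
  (\dim (spline_space m m' r') + \dim (corr_quotient m m' r (CNDC m m' r)) =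
   \dim (spline_space m m' r) + \dim (corr_quotient m m' r' (CNDC m m' r')))%N /\
  \dim (corr_space m m' r' (CNDC m m' r')) = \dim (corr_space m m' r (CNDC m m' r)).
Proof.
have sMIS : MIS T \subset MS T by apply/fintype.subsetP => x; exact: (MIS_MS hT hred).
split; last first.
  rewrite !corr_dim al_CNDC al_sum_bspace //.
  exact: fintype.subset_trans (CNDC_sub m m' hT hred hr) sMIS.
have sCC : CC T \subset MS T by apply/fintype.subsetP => x; exact: (CC_MS hT hred).
have := spline_quotient_dim m m' hT' hred' hr' al_constant.
have := al_sum_bspace sCC; have := al_sum_bspace sMIS; have := al_sum_qspace.
rewrite al_CC al_MIS => -> -> -> H.
exact: (addn_cancel H (spline_quotient_dim m m' hT hred hr hc)).
Qed.

End Isomorphism.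

(** * The rank of a coordinate matrix *)

Section CoordinateMatrix.
Import VectorInternalTheory.

Lemma rank_b2mx (F : fieldType) (V : vectType F) n (X : n.-tuple V) : \rank (b2mx X) = \dim (span X).
Proof.
have -> : span X = mx2vs (b2mx X) by rewrite unlock tvalK; case: _ / (esym _).
by rewrite /dimv mx2vsK.
Qed.

(** The matrix of [X] is the transposed coordinate matrix times the matrix of [b], and the latter
    has full row rank because [b] is free. *)
Lemma rank_coord_mx (F : fieldType) (V : vectType F) (b X : seq V) :
  free b -> (span X <= span b)%VS -> \rank (coord_mx b X) = \dim (span X).
Proof.
move=> fb Xb; rewrite -(rank_b2mx (in_tuple X)).
have -> : b2mx (in_tuple X) = (coord_mx b X)^T *m b2mx (in_tuple b).
  apply/row_matrixP => j; rewrite row_mul mulmx_sum_row rowK (tnth_nth 0) /=.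
  have /coord_span {1}-> : X`_j \in span (in_tuple b).
    by apply: (subvP Xb); apply/memv_span/mem_nth.
  rewrite linear_sum; apply: eq_bigr => i _.
  by rewrite linearZ /= rowK (tnth_nth 0) !mxE.
rewrite mxrankMfree ?mxrank_tr // /row_free rank_b2mx.
by rewrite (eqnP fb).
Qed.

End CoordinateMatrix.

Lemma struct_class_refl (R : realType) (T : tmesh R) (r : edges T -> int) :
  is_tmesh T -> reduced T -> is_smoothness r -> struct_class r r.
Proof.
move=> hT hred hr; split=> //; exists id, id, id.
by do !split=> //; rewrite imset_id.
Qed.

Theorem corollary3p20 (R : realType) (T : tmesh R) (r : edges T -> int)
    (m m' : nat) (hT : is_tmesh T) (hred : reduced T) (hr : is_smoothness r)
    (hconst : constant_on_MS r) :
  (dimensionally_stable m m' r <->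
   forall (T1 : tmesh R) (r1 : edges T1 -> int)
          (T2 : tmesh R) (r2 : edges T2 -> int),
     struct_class r r1 -> struct_class r r2 ->
     \dim (corr_quotient m m' r1 (CNDC m m' r1)) =
     \dim (corr_quotient m m' r2 (CNDC m m' r2)))
  /\
  (forall b X : forall (T' : tmesh R) (r' : edges T' -> int),
                  seq (corr_family m m' T'),
     (forall (T' : tmesh R) (r' : edges T' -> int), struct_class r r' ->
        basis_of (corr_space m m' r' (CNDC m m' r')) (b T' r') /\
        span (X T' r') = relations_in m m' r' (CNDC m m' r')) ->
     (dimensionally_stable m m' r <->
      forall (T1 : tmesh R) (r1 : edges T1 -> int)
             (T2 : tmesh R) (r2 : edges T2 -> int),
        struct_class r r1 -> struct_class r r2 ->
        \rank (coord_mx (b T1 r1) (X T1 r1)) =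
        \rank (coord_mx (b T2 r2) (X T2 r2)))).
Proof.
have rr := struct_class_refl hT hred hr.
have dims T' (r' : edges T' -> int) : struct_class r r' ->
    (\dim (spline_space m m' r') + \dim (corr_quotient m m' r (CNDC m m' r)) =
     \dim (spline_space m m' r) + \dim (corr_quotient m m' r' (CNDC m m' r')))%N /\
    \dim (corr_space m m' r' (CNDC m m' r')) = \dim (corr_space m m' r (CNDC m m' r)).
  case=> hT' hred' hr' [al [al0 [al1 [iso dir ind0 ind1 sm]]]].
  exact: (iso_dims m m' hT hred hr hconst hT' hred' hr' iso dir ind0 ind1 sm).
have stable : dimensionally_stable m m' r <->
    forall T' (r' : edges T' -> int), struct_class r r' ->
    \dim (corr_quotient m m' r' (CNDC m m' r')) = \dim (corr_quotient m m' r (CNDC m m' r)).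
  split=> H T' r' c; have [D _] := dims _ _ c; have E := H _ _ c.
    by move: D; rewrite E => /addnI.
  by move: D; rewrite E => /addIn.
(* Since [(T, r)] belongs to its own class, agreement with it amounts to agreement of any two
   members. *)
have pairwise (f : forall T' : tmesh R, (edges T' -> int) -> nat) :
    (forall T' (r' : edges T' -> int), struct_class r r' -> f T' r' = f T r) <->
    (forall (T1 : tmesh R) (r1 : edges T1 -> int) (T2 : tmesh R) (r2 : edges T2 -> int),
     struct_class r r1 -> struct_class r r2 -> f T1 r1 = f T2 r2).
  split=> [H T1 r1 T2 r2 /H -> /H -> //|H T' r' c]; exact: H.
split; first by rewrite stable (pairwise (fun T' r' => \dim (corr_quotient m m' r' (CNDC m m' r')))).
move=> b X bX; rewrite stable -(pairwise (fun T' r' => \rank (coord_mx (b T' r') (X T' r')))).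
(* The rank and the dimension of the quotient add up to the dimension of [M(CNDC)], which is
   constant on the class; so one is constant exactly when the other is. *)
have rank T' (r' : edges T' -> int) : struct_class r r' ->
    (\dim (corr_quotient m m' r' (CNDC m m' r')) + \rank (coord_mx (b T' r') (X T' r')) =
    \dim (corr_space m m' r (CNDC m m' r)))%N.
  move=> c; have [/andP[/eqP sb fb] sX] := bX _ _ c.
  rewrite rank_coord_mx // ?sb ?sX ?capvSl //.
  by rewrite dim_quotv ?capvSl // (dims _ _ c).2.
have Er := rank _ _ rr.
by split=> H T' r' c; have := rank _ _ c; rewrite -Er H //; [move/addnI|move/addIn].
Qed.
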